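(* Let $f:L^2(0,T)\to\mathbb{R}$ and $J=f+\mathrm{TGV}$ on $\mathrm{BV}(0,T)$ satisfy: (A1) $f$ is continuously Fréchet differentiable; (A2) there is $L_f>0$ with $\|\nabla f(u_1)-\nabla f(u_2)\|_{L^2}\le L_f\|u_1-u_2\|_{L^2}$ for all $u_1,u_2\in L^2(0,T)$; (A3) there is $C_f>0$ with $f(u)\ge-C_f$ for all $u\in L^2(0,T)$; (A4) the sublevel sets of $J$ are bounded in $\mathrm{BV}(0,T)$. Let $\{u_k\}_{k\ge1}$ be generated by the algorithm described in the context, assumed not to terminate after finitely many iterations. Then $\{u_k\}_k$ admits at least one weak* accumulation point in $\mathrm{BV}(0,T)$, and every such point $\bar u$ satisfies $-\nabla f(\bar u)\in\partial_2\mathrm{TGV}(\bar u)$, i.e. $$(-\nabla f(\bar u),u-\bar u)_{L^2}+\mathrm{TGV}(\bar u)\le\mathrm{TGV}(u)\quad\text{for all }u\in\mathrm{BV}(0,T).$$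
   Context: $T>0$, $\alpha,\beta>0$ fixed. $C_0(0,T)$: continuous functions on $(0,T)$ vanishing at the boundary, uniform norm $\|\cdot\|_C$; $M(0,T)=C_0(0,T)^*$ with dual norm $\|\cdot\|_M$; $\mathrm{BV}(0,T)$: functions $u\in L^1(0,T)$ with $Du\in M(0,T)$, norm $\|u\|_{L^1}+\|Du\|_M$, with its usual weak* topology as a dual space. $\mathrm{TGV}(u)=\sup\{\int_0^Tuv''\,|\,v\in C_c^\infty(0,T),\|v\|_C\le\alpha,\|v'\|_C\le\beta\}=\inf_{w\in\mathrm{BV}(0,T)}\alpha\|Du-w\|_M+\beta\|Dw\|_M$. $\mathcal{L}$: affine functions $x\mapsto cx+d$. $S_{x}=1_{(x,T)}$; $K_{x}(y)=1_{(0,x)}(y)(x-y)$ if $x<T/2$, $K_{x}(y)=1_{(x,T)}(y)(y-x)$ if $x\ge T/2$. $\operatorname{Ext}B:=\{\pm S_x/\alpha\,|\,x\in(0,T)\}\cup\{\pm K_x/\beta\,|\,x\in(\beta/\alpha,T-\beta/\alpha)\}$. $\nabla f(u)\in L^2(0,T)$: Riesz representative of the Fréchet derivative. For a finite ordered set $\mathcal{A}=\{v_j\}_{j=1}^N\subset\operatorname{Ext}B$, let $\mathcal{P}(\mathcal{A})$ be the problem $\min_{\lambda\in\mathbb{R}_+^N,\,\ell\in\mathcal{L}}\big[f(\sum_{j=1}^N\lambda_jv_j+\ell)+\sum_{j=1}^N\lambda_j\big]$. Algorithm. Input: a finite set $\mathcal{A}_0=\{u_j^0\}_{j=1}^{N_0}\subset\operatorname{Ext}B$.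 Compute a minimizer of $\mathcal{P}(\mathcal{A}_0)$, let $u_1$ be the corresponding function $\sum_j\lambda_ju_j^0+\ell$, and obtain $\mathcal{A}_1$ from $\mathcal{A}_0$ by removing all elements with zero weight. For $k=1,2,\dots$: write $\mathcal{A}_k=\{u_j^k\}_{j=1}^{N_k}$ and $u_k=\sum_{j=1}^{N_k}\lambda_j^ku_j^k+\ell^k$, where $(\lambda^k,\ell^k)$ consists of the remaining (positive) weights and the affine part of the previously computed minimizer (it is a minimizer of $\mathcal{P}(\mathcal{A}_k)$). Set $p_k(x)=\int_0^x\nabla f(u_k)(s)\,ds$, $P_k(x)=-\int_0^xp_k(s)\,ds$ and choose $\hat x_k^S,\hat x_k^K\in(0,T)$ with $|p_k(\hat x_k^S)|=\|p_k\|_C$, $|P_k(\hat x_k^K)|=\|P_k\|_C$. If $\|p_k\|_C\le\alpha$ and $\|P_k\|_C\le\beta$, terminate. Otherwise set $\widehat u_k=(\operatorname{sign}(p_k(\hat x_k^S))/\alpha)S_{\hat x_k^S}$ if $\|p_k\|_C/\alpha\ge\|P_k\|_C/\beta$ and $\widehat u_k=(\operatorname{sign}(P_k(\hat x_k^K))/\beta)K_{\hat x_k^K}$ else; let $\mathcal{A}_k^+=\mathcal{A}_k\cup\{\widehat u_k\}$, compute a minimizer of $\mathcal{P}(\mathcal{A}_k^+)$, let $u_{k+1}$ be the corresponding function, and obtain $\mathcal{A}_{k+1}$ from $\mathcal{A}_k^+$ by removing all elements with zero weight.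
   Formalization: TGV is taken as the infimum over w of α‖Du−w‖+β‖Dw‖; the printed supremum has its bounds interchanged (it should read ‖v‖≤β, ‖v'‖≤α), since as printed it gives β for u=S_x while the infimum gives α. *)

(* Defs.v *)
From HB Require Import structures.
From mathcomp Require Import all_boot all_order all_algebra.
From mathcomp Require Import finmap.
From mathcomp Require Import all_classical all_reals all_analysis.
From mathcomp Require Import measurable_realfun ess_sup_inf hoelder.

(* The open interval (0,T) is handled by functions on the whole line: Lebesgue *)
(* spaces use the restriction leb0T of the Lebesgue measure to (0,T), and      *)
(* C_0(0,T) is the space of continuous functions on the line vanishing outside *)
(* (0,T) (extension by zero is an isometry).                                   *)

Set Implicit Arguments.
Unset Strict Implicit.
Unset Printing Implicit Defensive.
Import Order.TTheory GRing.Theory Num.Theory.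
Import numFieldNormedType.Exports.

Local Open Scope classical_set_scope.
Local Open Scope ring_scope.
Local Open Scope quotient_scope.

(* The library's Lp spaces LspaceType (functions modulo equality a.e.) carry   *)
(* no algebraic structure; the pointwise operations on representatives and     *)
(* the norm 'N[mu]_p make them normed modules.                                 *)
Section Lspace_structure.
Context d (X : measurableType d) (R : realType).
Variables (mu : {measure set X -> \bar R}) (p : \bar R) (p1 : (1 <= p)%E).

Local Notation ty := (LspaceType mu p1).
Local Notation fty := (LfunType mu p1).
Local Notation mty := {mfun X >-> measurableTypeR R}.
Local Notation qty := {mfun_ mu, X >-> measurableTypeR R}.

HB.instance Definition _ := gen_eqMixin ty.
HB.instance Definition _ := gen_choiceMixin ty.

Lemma ae_eq_Lnorm (f g : mty) :
  f = g %[ae mu] -> ('N[mu]_p[EFin \o f] = 'N[mu]_p[EFin \o g])%E.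
Proof.
move=> fg; rewrite unlock /Lnorm; case: p p1 => [r r1|_|//].
- congr (_ `^ _)%E; apply: ae_eq_integral => //=.
  + apply/measurable_EFinP/(measurableT_comp (measurable_powR _)).
    exact: measurableT_comp.
  + apply/measurable_EFinP/(measurableT_comp (measurable_powR _)).
    exact: measurableT_comp.
  + by apply: filterS fg => x /= /[apply] ->.
- case: ifPn => // _; apply: ess_sup_inf.eq_ess_sup.
  by apply: filterS fg => x /= /(_ I) ->.
Qed.

Lemma repr_pi_ae (f : mty) : ((\pi_qty f : qty) : X -> R) = f %[ae mu].
Proof.
rewrite /aqEqMfun_to_fun.
by have /eqmodP/asboolP := reprK (\pi_qty f).
Qed.

Definition mfun_of_Lfun (f : fty) : mty :=
  MeasurableFun.Pack (MeasurableFun.Class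
    (@isMeasurableFun.Build _ _ X (measurableTypeR R) f (measurable_funPT f))).

Lemma finite_norm_pi (f : fty) :
  finite_norm mu p (\pi_qty (mfun_of_Lfun f) : qty).
Proof.
rewrite /finite_norm /aqEqMfun_to_fun (ae_eq_Lnorm (repr_pi_ae (mfun_of_Lfun f))).
exact: Lfunction_finite.
Qed.

Definition Lclass (f : fty) : ty :=
  LebesgueSpace.Pack (LebesgueSpace.Class
    (isFinLebesgue.Build _ _ _ mu p p1 _ (finite_norm_pi f))).

Lemma LclassE (f : fty) : (Lclass f : X -> R) = f %[ae mu].
Proof. exact: (repr_pi_ae (mfun_of_Lfun f)). Qed.

Lemma Lrepr_subproof (x : ty) : (x : X -> R) \in Lfun mu p.
Proof.
rewrite inE; apply/andP; split; rewrite inE/=.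
  exact: (@measurable_funPT _ _ _ _ (repr (x : qty) : mty)).
exact: Lebesgue_finite.
Qed.

Definition Lrepr (x : ty) : fty := Lfun_Sub p1 (Lrepr_subproof x).

Lemma Lspace_ext (x y : ty) : (x : X -> R) = y %[ae mu] -> x = y.
Proof.
move=> xy.
have : (x : qty) = (y : qty).
  rewrite -[x : qty]reprK -[y : qty]reprK; apply/eqmodP/asboolP; exact: xy.
case: x {xy} => x [[xm]]; case: y => y [[ym]] /= xy.
by subst y; rewrite (Prop_irrelevance xm ym).
Qed.

Lemma LreprK (x : ty) : Lclass (Lrepr x) = x.
Proof. exact/Lspace_ext/LclassE. Qed.

Let zero := Lclass 0.
Let opp x := Lclass (- Lrepr x).
Let add x y := Lclass (Lrepr x + Lrepr y).
Let scale (a : R) x := Lclass (a *: Lrepr x).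

Let addE (x y : ty) : (add x y : X -> R) = (x : X -> R) \+ y %[ae mu].
Proof. exact: LclassE. Qed.
Let oppE (x : ty) : (opp x : X -> R) = \- (x : X -> R) %[ae mu].
Proof. exact: LclassE. Qed.
Let scaleE (a : R) (x : ty) : (scale a x : X -> R) = a \*: (x : X -> R) %[ae mu].
Proof. exact: LclassE. Qed.
Let zeroE : (zero : X -> R) = cst 0 %[ae mu].
Proof. exact: LclassE. Qed.

Let addA : associative add.
Proof.
move=> x y z; apply: Lspace_ext.
apply: filterS (filterI (filterI (addE x (add y z)) (addE y z))
  (filterI (addE (add x y) z) (addE x y))).
by move=> t [[/(_ I) -> /(_ I) /= ->] [/(_ I) -> /(_ I) /= ->]] _; rewrite addrA.
Qed.

Let addC : commutative add.
Proof.
move=> x y; apply: Lspace_ext.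
apply: filterS (filterI (addE x y) (addE y x)).
by move=> t [/(_ I) -> /(_ I) ->] _ /=; rewrite addrC.
Qed.

Let add0 : left_id zero add.
Proof.
move=> x; apply: Lspace_ext; apply: filterS (filterI (addE zero x) zeroE).
by move=> t [/(_ I) -> /(_ I) /= ->] _; rewrite add0r.
Qed.

Let addN : left_inverse zero opp add.
Proof.
move=> x; apply: Lspace_ext.
apply: filterS (filterI (addE (opp x) x) (filterI (oppE x) zeroE)).
by move=> t [/(_ I) -> [/(_ I) /= -> /(_ I) ->]] _; rewrite addNr.
Qed.

HB.instance Definition _ := GRing.isZmodule.Build ty addA addC add0 addN.

Let scaleA a b x : scale a (scale b x) = scale (a * b) x.
Proof.
apply: Lspace_ext.
apply: filterS (filterI (scaleE a (scale b x))
  (filterI (scaleE b x) (scaleE (a * b) x))).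
by move=> t [/(_ I) -> [/(_ I) /= -> /(_ I) ->]] _ /=; rewrite scalerA.
Qed.

Let scale1 : left_id 1 scale.
Proof.
move=> x; apply: Lspace_ext; apply: filterS (scaleE 1 x).
by move=> t /(_ I) -> _ /=; rewrite scale1r.
Qed.

Let scaleDr : right_distributive scale +%R.
Proof.
move=> a x y; apply: Lspace_ext.
apply: filterS (filterI (filterI (scaleE a (x + y)) (addE x y))
  (filterI (addE (scale a x) (scale a y)) (filterI (scaleE a x) (scaleE a y)))).
move=> t [[/(_ I) -> /(_ I) /= e] [/(_ I) -> [/(_ I) /= -> /(_ I) /= ->]]] _ /=.
by rewrite e scalerDr.
Qed.

Let scaleDl x : {morph scale^~ x : a b / a + b}.
Proof.
move=> a b; apply: Lspace_ext.
apply: filterS (filterI (scaleE (a + b) x)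
  (filterI (addE (scale a x) (scale b x)) (filterI (scaleE a x) (scaleE b x)))).
move=> t [/(_ I) -> [/(_ I) -> [/(_ I) /= -> /(_ I) /= ->]]] _ /=.
by rewrite scalerDl.
Qed.

HB.instance Definition _ :=
  GRing.Zmodule_isLmodule.Build R ty scaleA scale1 scaleDr scaleDl.

Definition Lspace_norm (x : ty) : R := fine 'N[mu]_p[EFin \o (x : X -> R)]%E.

Lemma Lspace_normE (f : fty) : Lspace_norm (Lclass f) = fine 'N[mu]_p[EFin \o f]%E.
Proof. by congr fine; exact: (ae_eq_Lnorm (repr_pi_ae (mfun_of_Lfun f))). Qed.

Let normD x y : Lspace_norm (x + y) <= Lspace_norm x + Lspace_norm y.
Proof. by rewrite [x + y]/(add x y) Lspace_normE ler_LnormD. Qed.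

Let normZ (a : R) x : Lspace_norm (a *: x) = `|a| * Lspace_norm x.
Proof.
rewrite [a *: x]/(scale a x) Lspace_normE LnormZ fineM//.
by rewrite -(finite_norm_fine (Lrepr x)).
Qed.

Let norm0 x : Lspace_norm x = 0 -> x = 0.
Proof.
move=> /(@fine_Lnormr_eq0 _ _ _ _ _ p1 (Lrepr x)) x0; apply: Lspace_ext.
by apply: filterS (filterI x0 zeroE) => t [/(_ I) /= -> /(_ I) ->].
Qed.

HB.instance Definition _ := Lmodule_isNormed.Build R ty normD normZ norm0.

Lemma LspaceD (x y : ty) : (x + y : X -> R) = (x : X -> R) \+ y %[ae mu].
Proof. exact: addE. Qed.
Lemma LspaceN (x : ty) : (- x : X -> R) = \- (x : X -> R) %[ae mu].
Proof. exact: oppE. Qed.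
Lemma LspaceZ (a : R) (x : ty) : (a *: x : X -> R) = a \*: (x : X -> R) %[ae mu].
Proof. exact: scaleE. Qed.
Lemma Lspace0 : ((0 : ty) : X -> R) = cst 0 %[ae mu].
Proof. exact: zeroE. Qed.
Lemma LspacenormE (x : ty) : `|x|%:E = ('N[mu]_p[EFin \o (x : X -> R)])%E.
Proof. by rewrite -(finite_norm_fine (Lrepr x)). Qed.

End Lspace_structure.

Definition supnorm (R : realType) (T : R) (h : R -> R) : R :=
  sup [set `|h x| | x in `]0, T[].

Section C0.
Context (R : realType) (T : R).

Definition C0_pred : {pred R -> R} :=
  mem [set phi : R -> R | continuous phi /\ forall x, ~ (0 < x < T) -> phi x = 0].

Record C0 := MkC0 { C0_fun :> R -> R ; C0P : C0_fun \in C0_pred }.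

HB.instance Definition _ := [isSub for C0_fun].
HB.instance Definition _ := [Choice of C0 by <:].

Let C0_closed : submod_closed C0_pred.
Proof.
split; first by apply/mem_set; split => // x; exact: cst_continuous.
move=> a f g /set_mem[cf f0] /set_mem[cg g0]; apply/mem_set; split.
  move=> x; apply: continuousD; last exact: cg.
  by apply: continuousZ; [exact: cst_continuous|exact: cf].
by move=> x xT; rewrite /= !fctE f0// g0// scaler0 addr0.
Qed.

HB.instance Definition _ := GRing.isSubmodClosed.Build R _ C0_pred C0_closed.
HB.instance Definition _ := [SubChoice_isSubLmodule of C0 by <:].

Lemma C0_bounded (phi : C0) : has_ubound [set `|phi x| | x in `]0, T[].
Proof.
have [T0|T0] := leP 0 T; last first.
  exists 0 => y [x /=]; rewrite in_itv/= => /andP[x0 xT].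
  by have := lt_trans x0 (lt_trans xT T0); rewrite ltxx.
have [cphi _] := set_mem (C0P phi).
have [|c _ cmax] := @EVT_max _ (fun x => `|phi x|) _ _ T0.
  apply: continuous_subspaceT => x.
  by apply: continuous_comp; [exact: cphi|exact: norm_continuous].
exists `|phi c| => y [x /=]; rewrite in_itv/= => /andP[x0 xT] <-.
by apply: cmax; rewrite in_itv/= !ltW.
Qed.

Let nrm (phi : C0) : R := supnorm T phi.

Let nrm_ge (phi : C0) x : `|phi x| <= nrm phi.
Proof.
have [xT|/negP xT] := boolP (0 < x < T).
  by apply: ub_le_sup; [exact: C0_bounded|exists x => //=; rewrite in_itv].
have [_ ->//] := set_mem (C0P phi); rewrite normr0 /nrm /supnorm.
have [->|/set0P[y Ay]] := eqVneq [set `|phi x| | x in `]0, T[] set0.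
  by rewrite sup0.
apply: (le_trans _ (ub_le_sup (C0_bounded phi) Ay)).
by case: Ay => z _ <-.
Qed.

Let nrm_le (phi : C0) M : 0 <= M -> (forall x, `|phi x| <= M) -> nrm phi <= M.
Proof.
move=> M0 phiM; rewrite /nrm /supnorm.
have [->|/set0P An0] := eqVneq [set `|phi x| | x in `]0, T[] set0.
  by rewrite sup0.
by apply: ge_sup => // _ [x _ <-].
Qed.

Let nrm_ge0 phi : 0 <= nrm phi.
Proof. exact: le_trans (nrm_ge phi 0). Qed.

Let nrmD x y : nrm (x + y) <= nrm x + nrm y.
Proof.
apply: nrm_le => [|t]; first by rewrite addr_ge0.
by rewrite (le_trans (ler_normD _ _))// lerD.
Qed.

Let nrmZ (a : R) x : nrm (a *: x) = `|a| * nrm x.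
Proof.
have le b y : nrm (b *: y) <= `|b| * nrm y.
  apply: nrm_le => [|t]; first by rewrite mulr_ge0.
  by rewrite normrM ler_wpM2l.
have [->|a0] := eqVneq a 0.
  rewrite normr0 mul0r; apply/eqP; rewrite eq_le nrm_ge0 andbT.
  by rewrite (le_trans (le _ _))// normr0 mul0r.
apply/eqP; rewrite eq_le le/= -ler_pdivlMl ?normr_gt0//.
by rewrite -normfV (le_trans _ (le _ _))// scalerA mulVf// scale1r.
Qed.

Let nrm0 x : nrm x = 0 -> x = 0.
Proof.
move=> x0; apply/val_inj/funext => t; apply/eqP; rewrite -normr_le0.
by rewrite -x0 nrm_ge.
Qed.

HB.instance Definition _ := Lmodule_isNormed.Build R C0 nrmD nrmZ nrm0.

Lemma C0_normE (phi : C0) : `|phi| = supnorm T phi.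
Proof. by []. Qed.

End C0.
Section interval.
Context (R : realType) (T : R).

Definition leb0T : set (measurableTypeR R) -> \bar R :=
  mrestr (@lebesgue_measure R) (measurable_itv `]0, T[).

HB.instance Definition _ := Measure.on leb0T.

Definition L2 := LspaceType2 leb0T.

HB.instance Definition _ := NormedModule.on L2.

(* The class in L^2(0,T) of a function g.  The default value 0 is never used   *)
(* below: step functions, piecewise affine functions and, by the embedding of  *)
(* BV(0,T) into L^oo(0,T), all functions of bounded variation are in L^2(0,T). *)
Definition toL2 (g : R -> R) : L2 :=
  if pselect (g \in Lfun leb0T 2%:E) is left gP
  then Lclass (Lfun_Sub (lee1n 2) gP) else 0.

Definition L2inner (a b : L2) : R := \int[leb0T]_x (a x * b x).

(* The Riesz representative of the Frechet derivative. *)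
Definition gradient (f : L2 -> R) (u : L2) : L2 :=
  get [set g : L2 | forall h, 'd f u h = L2inner g h].

(* The second clause is continuity of the derivative in the operator norm. *)
Definition continuously_differentiable (f : L2 -> R) : Prop :=
  (forall u, differentiable f u) /\
  (forall u e, 0 < e ->
     \forall w \near u, forall h, `|'d f w h - 'd f u h| <= e * `|h|).

Definition test_function (phi : R -> R) : Prop :=
  (forall n x, derivable (derive1n n phi) x 1) /\
  (exists a b, [/\ 0 < a, b < T & forall x, ~ (a <= x <= b) -> phi x = 0]).

(* M(0,T) is literally the dual of C_0(0,T): continuous linear functionals. *)
Definition is_weak_derivative (u : R -> R) (m : C0 T -> R) : Prop :=
  forall phi : C0 T, test_function phi ->
    m phi = - \int[leb0T]_x (u x * derive1 phi x).

Definition is_BV (u : R -> R) : Prop :=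
  u \in Lfun leb0T 1 /\
  exists m : {linear C0 T -> R}, continuous m /\ is_weak_derivative u m.

(* Elements are representatives; all notions below only depend on their class  *)
(* modulo equality a.e. on (0,T).                                              *)
Record BV := MkBV { BV_fun :> R -> R ; BVP : is_BV BV_fun }.

HB.instance Definition _ := gen_eqMixin BV.
HB.instance Definition _ := gen_choiceMixin BV.

(* The distributional derivative Du (unique, by density of the test functions  *)
(* in C_0(0,T)).                                                               *)
Definition BVD (u : BV) : {linear C0 T -> R} :=
  get [set m : {linear C0 T -> R} | continuous m /\ is_weak_derivative u m].

Definition dualnorm (m : C0 T -> R) : R :=
  sup [set `|m phi| | phi in [set phi : C0 T | `|phi| <= 1]].

Definition BVnorm (u : BV) : R :=
  fine ('N[leb0T]_1[EFin \o u])%E + dualnorm (BVD u).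

(* BV(0,T) embeds through u |-> (u, Du) isometrically onto a weak* closed      *)
(* subspace of M x M = (C_0 x C_0)^*, hence is the dual of a quotient of       *)
(* C_0 x C_0.  Its weak* topology is the topology of pointwise convergence of  *)
(* the functionals (phi, psi) |-> int u phi + <Du, psi>.                       *)
Definition BVpairing (u : BV) : {ptws (C0 T * C0 T) -> R} :=
  fun p => \int[leb0T]_x (u x * p.1 x) + BVD u p.2.

HB.instance Definition _ := Topological.copy BV (initial_topology BVpairing).

(* An absolutely continuous measure w dx is the functional phi |-> int w phi.  *)
(* In predual form, TGV(u) is the supremum of int u v'' over test functions v  *)
(* with supnorm v <= beta and supnorm v' <= alpha (the constants swap roles).  *)
Definition TGV (alpha beta : R) (u : BV) : R :=
  inf [set alpha * dualnorm (fun phi => BVD u phi - \int[leb0T]_x (w x * phi x))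
           + beta * dualnorm (BVD w) | w in [set: BV]].

End interval.

Section algorithm.
Context (R : realType) (T alpha beta : R) (f : L2 T -> R).

Definition Sfun (x : R) : R -> R := \1_(`]x, T[%classic).

Definition Kfun (x : R) : R -> R := fun y =>
  if x < T / 2 then \1_(`]0, x[%classic) y * (x - y)
  else \1_(`]x, T[%classic) y * (y - x).

Definition ExtB : set (R -> R) :=
  [set v | exists (b : bool) (x : R),
     0 < x < T /\ v = (fun y => (-1) ^+ b / alpha * Sfun x y)] `|`
  [set v | exists (b : bool) (x : R),
     beta / alpha < x < T - beta / alpha /\
     v = (fun y => (-1) ^+ b / beta * Kfun x y)].

Definition affine : set (R -> R) :=
  [set l | exists c d, l = (fun x => c * x + d)].

(* Weights are indexed by the atoms themselves; values of lam outside A are    *)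
(* irrelevant.                                                                 *)
Definition comb (A : {fset (R -> R)}) (lam : (R -> R) -> R) (l : R -> R) : R -> R :=
  fun x => \sum_(v <- A) lam v * v x + l x.

Definition objective (A : {fset (R -> R)}) (lam : (R -> R) -> R) (l : R -> R) : R :=
  f (toL2 T (comb A lam l)) + \sum_(v <- A) lam v.

Definition feasible (A : {fset (R -> R)}) (lam : (R -> R) -> R) (l : R -> R) : Prop :=
  (forall v, v \in A -> 0 <= lam v) /\ affine l.

Definition is_minimizer (A : {fset (R -> R)}) (lam : (R -> R) -> R) (l : R -> R) : Prop :=
  feasible A lam l /\
  forall lam' l', feasible A lam' l' -> objective A lam l <= objective A lam' l'.

Definition pfun (u : R -> R) (x : R) : R :=
  \int[lebesgue_measure]_(s in `]0, x[) gradient f (toL2 T u) s.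

Definition Pfun (u : R -> R) (x : R) : R :=
  - \int[lebesgue_measure]_(s in `]0, x[) pfun u s.

Definition stopping (u : R -> R) : Prop :=
  supnorm T (pfun u) <= alpha /\ supnorm T (Pfun u) <= beta.

Definition is_max_point (h : R -> R) (x : R) : Prop :=
  0 < x < T /\ `|h x| = supnorm T h.

Definition new_atom (u : R -> R) (xS xK : R) : R -> R :=
  if supnorm T (Pfun u) / beta <= supnorm T (pfun u) / alpha
  then fun y => Num.sg (pfun u xS) / alpha * Sfun xS y
  else fun y => Num.sg (Pfun u xK) / beta * Kfun xK y.

(* (lam k.+1, l k.+1) is the minimizer computed at step k and u k.+1 the       *)
(* corresponding function; Aplus 0 = A 0 encodes the initial step.  The values *)
(* lam 0, l 0, u 0, xS 0 and xK 0 play no role.  All u k, k >= 1, have bounded *)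
(* variation, so that typing the sequence in BV is no restriction.             *)
Record algorithm_run (A Aplus : nat -> {fset (R -> R)})
    (lam : nat -> (R -> R) -> R) (l : nat -> R -> R) (u : nat -> BV T)
    (xS xK : nat -> R) : Prop := AlgorithmRun {
  run_init : [set` A 0] `<=` ExtB ;
  run_Aplus0 : Aplus 0 = A 0 ;
  run_xS : forall k, (1 <= k)%N -> is_max_point (pfun (u k)) (xS k) ;
  run_xK : forall k, (1 <= k)%N -> is_max_point (Pfun (u k)) (xK k) ;
  run_Aplus : forall k, (1 <= k)%N ->
    Aplus k = (A k `|` [fset new_atom (u k) (xS k) (xK k)])%fset ;
  run_minimizer : forall k, is_minimizer (Aplus k) (lam k.+1) (l k.+1) ;
  run_u : forall k, u k.+1 = comb (Aplus k) (lam k.+1) (l k.+1) :> (R -> R) ;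
  run_A : forall k, A k.+1 = [fset v in Aplus k | lam k.+1 v != 0]%fset
}.

End algorithm.

(* Main.v *)
Require Import Defs.
From HB Require Import structures.
From mathcomp Require Import all_boot all_order all_algebra.
From mathcomp Require Import finmap.
From mathcomp Require Import all_classical all_reals all_analysis.
From mathcomp Require Import measurable_realfun hoelder.
From mathcomp Require Import ring lra.
Import Order.TTheory GRing.Theory Num.Theory.
Import numFieldNormedType.Exports.
Local Open Scope classical_set_scope.
Local Open Scope ring_scope.

(* Write S for the sum of the weights of an iterate u, so that TGV u <= S, and *)
(* g for the gradient at u.  Stationarity of the finite-dimensional problems   *)
(* in the weights and in the affine part yields (g, u) = - S and (g, l) = 0    *)
(* for all affine l.  Hence g = p' and p = - P' with p, P in C_0(0,T), and     *)
(* pairing the two primitives with Du - w and Dw gives                         *)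
(* - (g, v) <= gap * TGV v for all v, where gap = max (|p|/alpha) (|P|/beta).  *)
(* The inserted atom v0 has - (g, v0) = gap, so a step of size t in its        *)
(* direction decreases the objective by t (gap - 1) - O(t^2).  The objective   *)
(* being bounded below, gap tends to 1.  Along an ultrafilter finer than the   *)
(* sequence, the iterates, bounded in BV by (A4), and near-optimal measures in *)
(* TGV converge weak*, and the iterates converge strongly in L^2, since        *)
(* primitives of L^2 functions form compact subsets of C_0.  Passing to the    *)
(* limit in TGV u <= S = - (g, u) and - (g, v) <= gap * TGV v gives            *)
(* - (g, v - u) + TGV u <= TGV v.                                              *)

Set Implicit Arguments.
Unset Strict Implicit.
Unset Printing Implicit Defensive.

(** The claim is the sum of two estimates at the limit, [TGV u <= - (g, u)] and [- (g, v) <= TGV v]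
    for all [v]. The iterates satisfy the first one with the sum of the weights in the middle, and
    the second one up to the factor [gap]. The first holds because atoms and affine functions have
    explicit competitors in TGV ([atom_decomposition], [comb_decomposition]) and because rescaling a
    minimizer does not improve it ([minimizer_self]). The second is duality ([gradient_dual]):
    affine directions cost nothing, so [g] is orthogonal to them, its first and second primitives
    lie in C_0(0,T), and two integrations by parts test every competitor.

    The factor tends to 1 as in conditional gradient methods. The inserted atom attains [gap]
    ([new_atomP]), so the best step along it lowers the objective by at least a fixed multiple of
    the square of [gap - 1] ([insertion_step], [descent_gap_cvg]); as the objective is bounded
    below, these squares tend to 0.

    The functional analysis rests on one identity. For [h] in L^2 let [prim h] be the primitive of
    [h] minus its mean; then the derivative of [u] at [prim h] is minus the inner product of [u]
    minus its mean with [h] ([BVD_prim]). It comes from [L2_Riesz] and [du_Bois_Reymond], which also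
    embed BV into L^2, and it determines the derivative since primitives are dense in C_0(0,T)
    ([functional_prim_eq]). Primitives of a bounded set of L^2 are uniformly Hoelder continuous,
    which upgrades weak* convergence to strong L^2 convergence ([weak_pair_strong_cvg]). The
    Lipschitz gradient then converges as well, TGV is lower semicontinuous along the competitors
    ([tgv_value_lsc]), and both estimates pass to the limit ([limit_optimal]). Ultrafilters replace
    subsequences throughout ([ultralimit_functional], [cluster_ultraP]). *)

Section restricted_integral.
Context d (X : measurableType d) (R : realType).
Variables (m : {measure set X -> \bar R}) (D : set X) (mD : measurable D).

Lemma integral_mrestr (f : X -> \bar R) : measurable_fun setT f ->
  (\int[mrestr m mD]_x f x = \int[m]_(x in D) f x)%E.
Proof.
move=> mf; rewrite [RHS](_ : _ = \int[mrestr m mD]_(x in D) f x)%E; last first.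
  by apply: eq_measure_integral => A mA AD /=; rewrite /mrestr setIidl.
rewrite [RHS]integral_mkcond; apply: ae_eq_integral => //.
  by apply/(measurable_restrictT _ _).1 => //; exact: measurable_funS mf.
exists (~` D); split; first exact: measurableC.
  by rewrite /= /mrestr setICl measure0.
move=> x /=; apply: contra_not => Dx _.
by rewrite patchE mem_set.
Qed.

Lemma Rintegral_mrestr (f : X -> R) : measurable_fun setT f ->
  \int[mrestr m mD]_x f x = \int[m]_(x in D) f x.
Proof. by move=> mf; congr fine; apply: integral_mrestr; exact/measurable_EFinP. Qed.

End restricted_integral.

Section Rintegral_extra.
Context d (X : measurableType d) (R : realType).
Variables (m : {measure set X -> \bar R}).
Implicit Types f g : X -> R.

Lemma ae_eq_Rintegral f g : measurable_fun setT f -> measurable_fun setT g ->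
  f = g %[ae m] -> \int[m]_x f x = \int[m]_x g x.
Proof.
move=> mf mg fg; congr fine; apply: ae_eq_integral => //.
- exact/measurable_EFinP.
- exact/measurable_EFinP.
- by apply: filterS fg => x /(_ I) -> _.
Qed.

Lemma Lfun_measurable p f : f \in Lfun m p -> measurable_fun setT f.
Proof. by rewrite inE => /andP[/[!inE]]. Qed.

Lemma Lfun2P f : f \in Lfun m 2%:E <->
  measurable_fun setT f /\ m.-integrable setT (EFin \o (fun x => f x ^+ 2)).
Proof.
split=> [fl|[mf fi]]; first by split; [exact: Lfun_measurable fl|exact: Lfun2_integrable_sqr].
rewrite inE; apply/andP; split; rewrite inE//=/finite_norm unlock/= poweR_lty//.
case/integrableP: fi => _; congr (_ < _)%E; apply: eq_integral => x _.
by rewrite /= normrX powR_mulrn.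
Qed.

Lemma Lfun1D f g : f \in Lfun m 1 -> g \in Lfun m 1 -> f \+ g \in Lfun m 1.
Proof. by move=> fl gl; exact: (@rpredD _ (Lfun m 1) f g). Qed.

End Rintegral_extra.

(** * The Hilbert space of square integrable functions *)

Section L2_space.
Context (R : realType) (T : R).
Local Notation mu := (leb0T T).
Local Notation L2 := (L2 T).
Local Notation RM := (measurableTypeR R).
Implicit Types (a b c : L2) (f g h : RM -> R).

Lemma leb0T_setT : mu setT = lebesgue_measure (`]0, T[ : set R).
Proof. by rewrite /leb0T /mrestr setTI. Qed.

Lemma leb0T_fin_num_fun : fin_num_fun mu.
Proof.
move=> A mA; rewrite ge0_fin_numE// (@le_lt_trans _ _ (mu setT))//.
  by apply: le_measure; rewrite ?inE.
by rewrite leb0T_setT /= lebesgue_measure_itv /=; case: ifP; rewrite ltry.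
Qed.

HB.instance Definition _ := @Measure_isFinite.Build _ _ _ (leb0T T) leb0T_fin_num_fun.

Lemma leb0T_setTE : 0 < T -> mu setT = T%:E.
Proof. by move=> T0; rewrite leb0T_setT lebesgue_measure_itv/= lte_fin T0 sube0. Qed.

Lemma Rintegral_leb0T f : measurable_fun setT f ->
  \int[mu]_x f x = \int[lebesgue_measure]_(x in `]0, T[) f x.
Proof. exact: Rintegral_mrestr. Qed.

Lemma ae_leb0T (P : RM -> Prop) : (forall x, 0 < x < T -> P x) -> {ae mu, forall x, P x}.
Proof.
move=> PT; exists (~` `]0, T[); split; first exact: measurableC.
  by rewrite /leb0T /mrestr setICl measure0.
by move=> x /=; apply: contra_not; rewrite /= in_itv/= => /PT.
Qed.

Lemma bounded_integrable f (M : R) : measurable_fun setT f ->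
  (forall x, 0 < x < T -> `|f x| <= M) -> mu.-integrable setT (EFin \o f).
Proof.
move=> mf fM.
have : mu.-integrable setT (EFin \o (f \_ `]0, T[)).
  apply: measurable_bounded_integrable => //; first by rewrite ltey_eq leb0T_fin_num_fun.
    by apply/(measurable_restrictT _ _).1 => //; exact: measurable_funS mf.
  exists `|M|; split; first by rewrite num_real.
  move=> N MN x _ /=; rewrite patchE; case: ifPn => [|_]; last by rewrite normr0 (le_trans _ (ltW MN)).
  by rewrite inE/= in_itv/= => /fM/le_trans; apply; rewrite (le_trans (ler_norm _))// ltW.
move=> /integrableP[m1 i1]; apply/integrableP; split; first exact/measurable_EFinP.
move: i1; congr (_ < _)%E; apply: ae_eq_integral => //.
- exact: measurableT_comp.
- by apply: measurableT_comp => //; exact/measurable_EFinP.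
- by apply: ae_leb0T => x xT _ /=; rewrite patchE mem_set//= in_itv.
Qed.

Lemma bounded_Lfun1 f (M : R) : measurable_fun setT f ->
  (forall x, 0 < x < T -> `|f x| <= M) -> f \in Lfun mu 1.
Proof. by move=> mf fM; apply/Lfun1_integrable; exact: bounded_integrable fM. Qed.

Lemma bounded_Lfun2 f (M : R) : measurable_fun setT f ->
  (forall x, 0 < x < T -> `|f x| <= M) -> f \in Lfun mu 2%:E.
Proof.
move=> mf fM; apply/Lfun2P; split => //; apply: (@bounded_integrable _ (M ^+ 2)).
  exact: measurable_funX.
move=> x xT; have := fM _ xT; rewrite normrX => fxM.
by rewrite lerXn2r// nnegrE (le_trans _ fxM).
Qed.

Lemma Lfun2_Lfun1 f : f \in Lfun mu 2%:E -> f \in Lfun mu 1.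
Proof. by apply: Lfun_subset12; exact: leb0T_fin_num_fun. Qed.

Lemma Lfun1M f g (M : R) : f \in Lfun mu 1 -> measurable_fun setT g ->
  (forall x, 0 < x < T -> `|g x| <= M) -> f \* g \in Lfun mu 1.
Proof.
move=> fl mg gM; have mf := Lfun_measurable fl.
move/Lfun1_integrable : fl => fi; apply/Lfun1_integrable.
have mfg : measurable_fun setT (f \* g) by exact: measurable_funM.
have Mi : mu.-integrable setT (EFin \o (fun x => M * f x)).
  by apply: eq_integrable (integrableZl measurableT M fi).
apply/integrableP; split; first exact/measurable_EFinP.
case/integrableP: Mi => _; apply: le_lt_trans; apply: ae_ge0_le_integral => //.
- by apply: measurableT_comp => //; exact/measurable_EFinP.
- by apply: measurableT_comp => //; apply/measurable_EFinP; exact: measurable_funM.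
apply: ae_leb0T => x xT _ /=; rewrite lee_fin !normrM mulrC ler_wpM2r//.
by rewrite (le_trans (gM _ xT))// ler_norm.
Qed.

Lemma L2_Lfun a : (a : RM -> R) \in Lfun mu 2%:E.
Proof. exact: Lrepr_subproof. Qed.

Lemma L2_measurable a : measurable_fun setT (a : RM -> R).
Proof. exact: Lfun_measurable (L2_Lfun a). Qed.

Lemma L2M a b : ((a : RM -> R) \* b) \in Lfun mu 1.
Proof. by apply: Lfun2_mul_Lfun1; exact: L2_Lfun. Qed.

Lemma Lfun1_RintegralD f g : f \in Lfun mu 1 -> g \in Lfun mu 1 ->
  \int[mu]_x (f x + g x) = \int[mu]_x f x + \int[mu]_x g x.
Proof. by move=> /Lfun1_integrable fi /Lfun1_integrable gi; rewrite RintegralD. Qed.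

Lemma Lfun1_RintegralB f g : f \in Lfun mu 1 -> g \in Lfun mu 1 ->
  \int[mu]_x (f x - g x) = \int[mu]_x f x - \int[mu]_x g x.
Proof. by move=> /Lfun1_integrable fi /Lfun1_integrable gi; rewrite RintegralB. Qed.

Lemma Lfun1_RintegralZ (k : R) f : f \in Lfun mu 1 ->
  \int[mu]_x (k * f x) = k * \int[mu]_x f x.
Proof. by move=> /Lfun1_integrable fi; rewrite RintegralZl. Qed.

Lemma L2innerC a b : L2inner a b = L2inner b a.
Proof. by apply: eq_Rintegral => x _; rewrite mulrC. Qed.

Lemma L2innerDl a b c : L2inner (a + b) c = L2inner a c + L2inner b c.
Proof.
rewrite -Lfun1_RintegralD; [|exact: L2M..].
apply: ae_eq_Rintegral.
- by apply: measurable_funM; exact: L2_measurable.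
- by apply: measurable_funD; apply: measurable_funM; exact: L2_measurable.
- by apply: filterS (LspaceD a b) => x /(_ I) -> _ /=; rewrite mulrDl.
Qed.

Lemma L2innerZl (k : R) a b : L2inner (k *: a) b = k * L2inner a b.
Proof.
rewrite -Lfun1_RintegralZ; last exact: L2M.
apply: ae_eq_Rintegral.
- by apply: measurable_funM; exact: L2_measurable.
- by apply: measurable_funM => //; apply: measurable_funM; exact: L2_measurable.
- by apply: filterS (LspaceZ k a) => x /(_ I) -> _ /=; rewrite mulrA.
Qed.

Lemma L2innerDr a b c : L2inner c (a + b) = L2inner c a + L2inner c b.
Proof. by rewrite L2innerC L2innerDl !(L2innerC c). Qed.

Lemma L2innerZr (k : R) a b : L2inner b (k *: a) = k * L2inner b a.
Proof. by rewrite L2innerC L2innerZl L2innerC. Qed.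

Lemma L2innerNl a b : L2inner (- a) b = - L2inner a b.
Proof. by rewrite -scaleN1r L2innerZl mulN1r. Qed.

Lemma L2innerNr a b : L2inner b (- a) = - L2inner b a.
Proof. by rewrite L2innerC L2innerNl L2innerC. Qed.

Lemma L2innerBl a b c : L2inner (a - b) c = L2inner a c - L2inner b c.
Proof. by rewrite L2innerDl L2innerNl. Qed.

Lemma L2innerBr a b c : L2inner c (a - b) = L2inner c a - L2inner c b.
Proof. by rewrite L2innerDr L2innerNr. Qed.

Lemma L2inner0l a : L2inner 0 a = 0.
Proof. by have := L2innerZl 0 0 a; rewrite scale0r mul0r. Qed.

Lemma L2inner0r a : L2inner a 0 = 0.
Proof. by rewrite L2innerC L2inner0l. Qed.

Lemma L2inner_norm a : L2inner a a = `|a| ^+ 2.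
Proof.
have -> : `|a| = fine 'N[mu]_2[EFin \o (a : RM -> R)]%E by [].
rewrite unlock /= fine_poweR powR12_sqrt; last first.
  by apply/fine_ge0/integral_ge0 => x _; rewrite lee_fin powR_ge0.
rewrite sqr_sqrtr; last by apply/fine_ge0/integral_ge0 => x _; rewrite lee_fin powR_ge0.
congr fine; apply: eq_integral => x _; rewrite powR_mulrn//.
by rewrite real_normK ?num_real// expr2.
Qed.

(** Expanding the square of [|b| a - |a| c] for [c = b] and for [c = - b] gives the upper and the
    lower bound. *)
Lemma L2inner_CS a b : `|L2inner a b| <= `|a| * `|b|.
Proof.
have [->|a0] := eqVneq a 0; first by rewrite L2inner0l !normr0 mul0r.
have [->|b0] := eqVneq b 0; first by rewrite L2inner0r !normr0 mulr0.
have pa : 0 < `|a| by rewrite normr_gt0.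
have pb : 0 < `|b| by rewrite normr_gt0.
have key (c' : L2) : `|c'| = `|b| -> L2inner a c' <= `|a| * `|b|.
  move=> c'b; have := sqr_ge0 `|(`|b| *: a - `|a| *: c')|.
  rewrite -L2inner_norm L2innerBl !L2innerBr !L2innerZl !L2innerZr !L2inner_norm.
  rewrite (L2innerC c') c'b => H.
  have {}H : 0 <= 2 * (`|a| * `|b|) * (`|a| * `|b| - L2inner a c').
    by apply: le_trans H _; rewrite le_eqVlt; apply/orP; left; apply/eqP; ring.
  by rewrite -subr_ge0 -(pmulr_rge0 _ (_ : 0 < 2 * (`|a| * `|b|)))// !mulr_gt0.
by rewrite ler_norml key// lerNl -L2innerNr key ?normrN.
Qed.

Lemma toL2E f : f \in Lfun mu 2%:E -> (toL2 T f : RM -> R) = f %[ae mu].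
Proof. by move=> fl; rewrite /toL2; case: pselect => // fl'; exact: LclassE. Qed.

Lemma toL2_coe a : toL2 T a = a.
Proof. by apply: Lspace_ext; apply: toL2E; exact: L2_Lfun. Qed.

Lemma toL2_0 : toL2 T (cst 0) = 0.
Proof.
have l0 : (cst 0 : RM -> R) \in Lfun mu 2%:E by exact: Lfun_cst.
apply: Lspace_ext; apply: filterS (filterI (toL2E l0) (Lspace0 mu (lee1n 2))).
by move=> x [/(_ I) -> /(_ I) ->].
Qed.

Lemma eq_toL2 f g : f \in Lfun mu 2%:E -> g \in Lfun mu 2%:E -> f = g %[ae mu] ->
  toL2 T f = toL2 T g.
Proof.
move=> fl gl fg; apply: Lspace_ext.
apply: filterS (filterI (toL2E fl) (filterI (toL2E gl) fg)).
by move=> x [/(_ I) -> [/(_ I) -> /(_ I) ->]].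
Qed.

Lemma Lfun2D f g : f \in Lfun mu 2%:E -> g \in Lfun mu 2%:E -> f \+ g \in Lfun mu 2%:E.
Proof.
move=> fl gl; have := @Lfun_addr_closed _ _ _ mu _ (lee1n 2).
by move=> [_]; apply.
Qed.

Lemma Lfun2Z (k : R) f : f \in Lfun mu 2%:E -> (fun x => k * f x) \in Lfun mu 2%:E.
Proof.
move=> fl; have := Lfun_scale k (ler1n _ 2) fl.
by rewrite (_ : k \o* f = (fun x => k * f x))//; apply/funext => x /=; rewrite mulrC.
Qed.

Lemma toL2D f g : f \in Lfun mu 2%:E -> g \in Lfun mu 2%:E ->
  toL2 T (f \+ g) = toL2 T f + toL2 T g.
Proof.
move=> fl gl; apply: Lspace_ext.
apply: filterS (filterI (filterI (toL2E fl) (toL2E gl))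
  (filterI (toL2E (Lfun2D fl gl)) (LspaceD (toL2 T f) (toL2 T g)))).
by move=> x [[/(_ I) e1 /(_ I) e2] [/(_ I) -> /(_ I) ->]] _ /=; rewrite e1 e2.
Qed.

Lemma toL2Z (k : R) f : f \in Lfun mu 2%:E -> toL2 T (fun x => k * f x) = k *: toL2 T f.
Proof.
move=> fl; apply: Lspace_ext.
apply: filterS (filterI (toL2E fl) (filterI (toL2E (Lfun2Z k fl)) (LspaceZ k (toL2 T f)))).
by move=> x [/(_ I) e1 [/(_ I) -> /(_ I) ->]] _ /=; rewrite e1.
Qed.

Lemma L2inner_toL2r a f : f \in Lfun mu 2%:E -> L2inner a (toL2 T f) = \int[mu]_x (a x * f x).
Proof.
move=> fl; apply: ae_eq_Rintegral.
- by apply: measurable_funM; exact: L2_measurable.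
- by apply: measurable_funM; [exact: L2_measurable|exact: Lfun_measurable fl].
- by apply: filterS (toL2E fl) => x /(_ I) ->.
Qed.

Lemma L2inner_toL2 f g : f \in Lfun mu 2%:E -> g \in Lfun mu 2%:E ->
  L2inner (toL2 T f) (toL2 T g) = \int[mu]_x (f x * g x).
Proof.
move=> fl gl; rewrite L2inner_toL2r//; apply: ae_eq_Rintegral.
- by apply: measurable_funM; [exact: L2_measurable|exact: Lfun_measurable gl].
- by apply: measurable_funM; [exact: Lfun_measurable fl|exact: Lfun_measurable gl].
- by apply: filterS (toL2E fl) => x /(_ I) ->.
Qed.

Lemma toL2_norm f : f \in Lfun mu 2%:E -> `|toL2 T f| ^+ 2 = \int[mu]_x (f x ^+ 2).
Proof.
move=> fl; rewrite -L2inner_norm L2inner_toL2r//; apply: ae_eq_Rintegral.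
- by apply: measurable_funM; [exact: L2_measurable|exact: Lfun_measurable fl].
- by apply: measurable_funX; exact: Lfun_measurable fl.
- by apply: filterS (toL2E fl) => x /(_ I) -> _; rewrite expr2.
Qed.

Lemma toL2_le f g : f \in Lfun mu 2%:E -> g \in Lfun mu 2%:E ->
  (forall x, 0 < x < T -> `|f x| <= `|g x|) -> `|toL2 T f| <= `|toL2 T g|.
Proof.
move=> fl gl fg; rewrite -(@ler_pXn2r _ 2)// ?nnegrE// !toL2_norm//.
have [mf fi] := (Lfun2P _ f).1 fl; have [mg gi] := (Lfun2P _ g).1 gl.
rewrite -lee_fin /Rintegral !fineK; [|exact: (integrable_fin_num measurableT gi)
  |exact: (integrable_fin_num measurableT fi)].
apply: ae_ge0_le_integral => //.
- by move=> x _; rewrite lee_fin sqr_ge0.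
- by apply/measurable_EFinP; exact: measurable_funX.
- by move=> x _; rewrite lee_fin sqr_ge0.
- by apply/measurable_EFinP; exact: measurable_funX.
apply: ae_leb0T => x /fg H _; rewrite lee_fin -(real_normK (num_real (f x))).
by rewrite -(real_normK (num_real (g x))) lerXn2r.
Qed.

End L2_space.

(** * Riesz representation of bounded functionals on L^2(0,T) *)

Section Riesz.
Context (R : realType) (T : R).
Local Notation mu := (leb0T T).
Local Notation L2 := (L2 T).
Local Notation RM := (measurableTypeR R).

Import HBNNSimple.

(** A property of bare functions, so that explicit formulas and pointwise limits can be treated
    without bundling a linear map; [functional_continuous_linear] bundles them when a derivative is
    required. *)
Definition bounded_functional (V : normedModType R) (F : V -> R) :=
  (forall (k : R) a b, F (k *: a + b) = k * F a + F b) /\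
  exists C, forall a, `|F a| <= C * `|a|.

Section functional.
Variables (V : normedModType R) (F : V -> R).
Hypothesis bF : bounded_functional F.

Lemma bounded_functional0 : F 0 = 0.
Proof. by have := bF.1 (-1) 0 0; rewrite scaler0 addr0 mulN1r addNr. Qed.

Lemma bounded_functionalZ k a : F (k *: a) = k * F a.
Proof. by have := bF.1 k a 0; rewrite !addr0 bounded_functional0 addr0. Qed.

Lemma bounded_functionalD a b : F (a + b) = F a + F b.
Proof. by have := bF.1 1 a b; rewrite scale1r mul1r. Qed.

Lemma bounded_functionalN a : F (- a) = - F a.
Proof. by rewrite -scaleN1r bounded_functionalZ mulN1r. Qed.

Lemma bounded_functionalB a b : F (a - b) = F a - F b.
Proof. by rewrite bounded_functionalD bounded_functionalN. Qed.

Lemma bounded_functional_bound : exists2 C, 0 <= C & forall a, `|F a| <= C * `|a|.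
Proof.
have [C FC] := bF.2; exists `|C| => // a.
by apply: le_trans (FC a) _; rewrite ler_wpM2r// ler_norm.
Qed.

End functional.

Lemma bounded_functional_inner (g : L2) : bounded_functional (L2inner g).
Proof.
split; first by move=> k a b; rewrite L2innerDr L2innerZr.
by exists `|g| => a; exact: L2inner_CS.
Qed.

Lemma indic_Lfun2 (A : set RM) : measurable A -> (\1_A : RM -> R) \in Lfun mu 2%:E.
Proof.
move=> mA; apply: (@bounded_Lfun2 _ _ _ 1); first exact: measurable_indic.
by move=> x _; rewrite indicE; case: (_ \in _); rewrite ?normr1 ?normr0.
Qed.

Lemma indic_norm (A : set RM) : measurable A ->
  (`|toL2 T (\1_A : RM -> R)| ^+ 2)%:E = mu A.
Proof.
move=> mA; rewrite toL2_norm; last exact: indic_Lfun2.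
rewrite (_ : (fun x => _) = \1_A); last first.
  by apply/funext => x; rewrite indicE; case: (_ \in _); rewrite ?expr1n ?expr0n.
rewrite /Rintegral integral_indic// setIT fineK//.
exact: leb0T_fin_num_fun.
Qed.

Lemma nnsfun_Lfun2 (s : {nnsfun RM >-> R}) : (s : RM -> R) \in Lfun mu 2%:E.
Proof.
have [M [_ sM]] : bounded_fun (s : RM -> R) by exact: simple_bounded.
apply: (@bounded_Lfun2 _ _ _ (M + 1)); first exact: measurable_funPT.
by move=> x _; apply: (sM (M + 1)) => //; rewrite ltrDl.
Qed.

(** Agreement on indicators propagates to simple functions, which are finite combinations of them.
    [Phi] is additive on bounded functions only, because it will be integration against a density
    known merely to be integrable. *)
Lemma functional_nnsfun (F : L2 -> R) (Phi : (RM -> R) -> R) : bounded_functional F ->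
  (forall (k : R) (f : RM -> R) (A : set RM) (M : R), measurable_fun setT f -> (forall x, `|f x| <= M) -> measurable A ->
     Phi (fun x => k * \1_A x + f x) = k * Phi \1_A + Phi f) ->
  Phi (cst 0) = 0 ->
  (forall A : set RM, measurable A -> F (toL2 T (\1_A : RM -> R)) = Phi \1_A) ->
  forall s : {nnsfun RM >-> R}, F (toL2 T s) = Phi s.
Proof.
move=> bF PhiD Phi0 FPhi s.
have -> : (s : RM -> R) = (fun x => \sum_(y <- fset_set (range s)) y * \1_(s @^-1` [set y]) x).
  by apply/funext => x; rewrite fimfunE fsbig_finite.
have mpre y : measurable (s @^-1` [set y] : set RM) by exact: measurable_sfunP.
pose S r := fun x : RM => \sum_(y <- r) y * \1_(s @^-1` [set y]) x.
suff : forall r : seq R, [/\ measurable_fun setT (S r), exists M, forall x, `|S r x| <= M &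
  F (toL2 T (S r)) = Phi (S r)] by move=> /(_ (fset_set (range s)))[].
elim=> [|y r [mr [M rM] IH]].
  have -> : S [::] = cst 0 by apply/funext => x; rewrite /S big_nil.
  split; [exact: measurable_cst|by exists 0 => x; rewrite normr0|].
  by rewrite Phi0 toL2_0 bounded_functional0.
have -> : S (y :: r) = (fun x => y * \1_(s @^-1` [set y]) x) \+ S r.
  by apply/funext => x; rewrite /S big_cons.
have yl := Lfun2Z y (indic_Lfun2 (mpre y)).
have rl : S r \in Lfun mu 2%:E by apply: (bounded_Lfun2 (M := M)).
split; first by apply: measurable_funD => //; exact: Lfun_measurable yl.
- exists (`|y| + M) => x /=; rewrite (le_trans (ler_normD _ _))// lerD// normrM.
  by rewrite indicE; case: (_ \in _); rewrite ?normr1 ?mulr1// normr0 mulr0.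
- by rewrite toL2D// toL2Z ?indic_Lfun2// bF.1 IH FPhi// -(PhiD _ _ _ M).
Qed.

Lemma L2_approx_nnsfun (f : RM -> R) : measurable_fun setT f -> (forall x, 0 <= f x) ->
  exists s : {nnsfun RM >-> R}^nat, [/\ forall n x, 0 <= s n x <= f x,
    forall x m n, (m <= n)%N -> s m x <= s n x & forall x, s n x @[n --> \oo] --> f x].
Proof.
move=> mf f0.
have mEf : measurable_fun setT (EFin \o f) by exact/measurable_EFinP.
pose s := nnsfun_approx (@measurableT _ RM) mEf; exists s.
have f0' x : setT x -> (0%:E <= (EFin \o f) x)%E by rewrite lee_fin.
have sf x : s n x @[n --> \oo] --> f x.
  have H := cvg_nnsfun_approx (@measurableT _ RM) mEf f0' (x := x) Logic.I.
  exact: (fine_cvg H).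
have nd x m n : (m <= n)%N -> s m x <= s n x.
  by move=> mn; have /lefP := nd_nnsfun_approx (@measurableT _ RM) mEf mn; exact.
split => // n x; rewrite fun_ge0 /=.
rewrite -(cvg_lim (@Rhausdorff R) (sf x)).
apply: (@nondecreasing_cvgn_le _ (fun n => s n x) _ _ n); first by move=> *; exact: nd.
by apply/cvg_ex; exists (f x); exact: sf.
Qed.

(** Dominated convergence: [0 <= s n <= f] bounds the squared error by [f ^+ 2]. *)
Lemma L2_cvg_nnsfun (f : RM -> R) (s : {nnsfun RM >-> R}^nat) : f \in Lfun mu 2%:E ->
  (forall n x, 0 <= s n x <= f x) -> (forall x, s n x @[n --> \oo] --> f x) ->
  `|toL2 T f - toL2 T (s n)| ^+ 2 @[n --> \oo] --> 0.
Proof.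
move=> fl sle sf; have [mf fi] := (Lfun2P _ f).1 fl.
have nl n : (fun x => -1 * s n x) \in Lfun mu 2%:E by apply: Lfun2Z; exact: nnsfun_Lfun2.
have E n : `|toL2 T f - toL2 T (s n)| ^+ 2 = \int[mu]_x ((f x - s n x) ^+ 2).
  rewrite -scaleN1r -toL2Z ?nnsfun_Lfun2// -toL2D// toL2_norm; last exact: Lfun2D.
  by apply: eq_Rintegral => x _ /=; rewrite mulN1r.
rewrite (_ : (fun n => _) = fun n => \int[mu]_x ((f x - s n x) ^+ 2)); last exact/funext.
have ms n : measurable_fun setT (s n : RM -> R) by exact: measurable_funPT.
have [] := @dominated_convergence _ _ _ mu setT measurableT
  (fun n => EFin \o (fun x => (f x - s n x) ^+ 2)) (cst 0%E) (EFin \o (fun x => f x ^+ 2)).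
- by move=> n; apply/measurable_EFinP/measurable_funX/measurable_funB.
- exact: measurable_cst.
- apply: aeW => x _; apply: cvg_EFin; first exact: nearW.
  rewrite /= -[X in _ --> X](_ : (f x - f x) ^+ 2 = 0); last by rewrite subrr expr0n.
  by apply: cvgM; apply: cvgB => //; exact: cvg_cst.
- exact: fi.
- apply: aeW => x n _ /=; rewrite lee_fin ger0_norm ?sqr_ge0//.
  have /andP[s0 sx] := sle n x.
  by rewrite lerXn2r ?nnegrE ?subr_ge0// ?(le_trans s0)// gerBl.
by move=> _ _; rewrite integral0 => /fine_cvg.
Qed.

(** Indicators span a dense subspace: a nonnegative function is a limit of simple ones, and [a] is
    the difference of the nonnegative functions [max a 0] and [max a 0 - a]. *)
Lemma L2_functional_eq0 (F : L2 -> R) : bounded_functional F ->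
  (forall A : set RM, measurable A -> F (toL2 T (\1_A : RM -> R)) = 0) -> forall a, F a = 0.
Proof.
move=> bF F0; have [C C0 FC] := bounded_functional_bound bF.
have Fs (s : {nnsfun RM >-> R}) : F (toL2 T s) = 0.
  by apply: (functional_nnsfun (Phi := cst 0)) => // k f A M; rewrite /cst mulr0 addr0.
have Fp (f : RM -> R) : f \in Lfun mu 2%:E -> (forall x, 0 <= f x) -> F (toL2 T f) = 0.
  move=> fl f0; have [s [s1 s2 s3]] := L2_approx_nnsfun (Lfun_measurable fl) f0.
  have sc := L2_cvg_nnsfun fl s1 s3.
  apply/eqP; rewrite -sqrf_eq0 eq_le sqr_ge0 andbT.
  have : C ^+ 2 * `|toL2 T f - toL2 T (s n)| ^+ 2 @[n --> \oo] --> C ^+ 2 * 0.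
    by apply: cvgMr; exact: sc.
  rewrite mulr0 => /cvgr_to_ge; apply; apply: nearW => n.
  rewrite -exprMn -(real_normK (num_real (F _))) lerXn2r ?nnegrE//.
    by rewrite mulr_ge0.
  by rewrite -[F (toL2 T f)]subr0 -(Fs (s n)) -bounded_functionalB.
move=> a; rewrite -(toL2_coe a).
have ml := L2_measurable a.
have al := L2_Lfun a.
have pl : (fun x => Num.max (a x) 0) \in Lfun mu 2%:E.
  apply/Lfun2P; have [_ ai] := (Lfun2P _ _).1 al.
  have mp : measurable_fun setT (fun x : RM => Num.max (a x) 0).
    by apply: measurable_maxr => //; exact: measurable_cst.
  split => //; apply: le_integrable ai => //.
    by apply/measurable_EFinP; exact: measurable_funX.
  move=> x _ /=; rewrite lee_fin !ger0_norm ?sqr_ge0//.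
  by case: (leP (a x) 0) => // _; rewrite expr0n sqr_ge0.
have nl : (fun x => Num.max (a x) 0 - a x) \in Lfun mu 2%:E.
  rewrite (_ : (fun x => _) = (fun x => Num.max (a x) 0) \+ (fun x => -1 * a x)).
    by apply: Lfun2D => //; exact: Lfun2Z.
  by apply/funext => x /=; rewrite mulN1r.
rewrite (_ : (a : RM -> R) = (fun x => Num.max (a x) 0) \+ (fun x => -1 * (Num.max (a x) 0 - a x))).
  rewrite toL2D ?Lfun2Z// toL2Z// bounded_functionalD// bounded_functionalZ// !Fp ?mulr0 ?addr0//.
    by move=> x; rewrite subr_ge0 le_max lexx.
  by move=> x; rewrite le_max lexx orbT.
by apply/funext => x /=; rewrite mulN1r opprB addrCA subrr addr0.
Qed.

(** Let simple [s] increase to the positive part of [g]. As [s] vanishes where [g <= 0], [|s|^2] is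
    at most the pairing of [g] with [s], hence at most [C |s|]; so [|s| <= C], and monotone
    convergence concludes. *)
Lemma Lfun2_of_bounded_pairing (g : RM -> R) (C : R) : 0 <= C -> g \in Lfun mu 1 ->
  (forall s : {nnsfun RM >-> R}, \int[mu]_x (g x * s x) <= C * `|toL2 T s|) ->
  (fun x => Num.max (g x) 0) \in Lfun mu 2%:E.
Proof.
move=> C0 gl gs; have mg := Lfun_measurable gl.
pose p (x : RM) := Num.max (g x) 0.
have p0 x : 0 <= p x by rewrite le_max lexx orbT.
have mp : measurable_fun setT p by apply: measurable_maxr => //; exact: measurable_cst.
have [s [s1 s2 s3]] := L2_approx_nnsfun mp p0.
have ms n : measurable_fun setT (s n : RM -> R) by exact: measurable_funPT.
have sC n : (\int[mu]_x ((s n x) ^+ 2)%:E <= (C ^+ 2)%:E)%E.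
  have [_ si] := (Lfun2P _ _).1 (nnsfun_Lfun2 (s n)).
  have <- : (`|toL2 T (s n)| ^+ 2)%:E = (\int[mu]_x ((s n x) ^+ 2)%:E)%E.
    by rewrite toL2_norm ?nnsfun_Lfun2// /Rintegral fineK//; exact: (integrable_fin_num measurableT si).
  rewrite lee_fin lerXn2r ?nnegrE//.
  have [->//|n0] := eqVneq `|toL2 T (s n)| 0.
  have np : 0 < `|toL2 T (s n)| by rewrite lt_neqAle eq_sym n0 normr_ge0.
  rewrite -(ler_pM2r np) (le_trans _ (gs (s n)))// -expr2 toL2_norm ?nnsfun_Lfun2//.
  apply: le_Rintegral => //.
    have [M [_ sM]] : bounded_fun (s n : RM -> R) by exact: simple_bounded.
    apply/Lfun1_integrable; apply: (Lfun1M (M := M + 1)) => // x _.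
    by apply: (sM (M + 1)) => //; rewrite ltrDl.
  move=> x _; have /andP[a b] := s1 n x.
  move: b; rewrite /p expr2; case: (leP (g x) 0) => gx b; last by rewrite ler_wpM2r.
  by have /eqP -> : s n x == 0 by [rewrite eq_le a b]; rewrite !mulr0.
apply/Lfun2P; split => //; apply/integrableP; split.
  by apply/measurable_EFinP; exact: measurable_funX.
apply: (@le_lt_trans _ _ (C ^+ 2)%:E); last exact: ltry.
have E x : `|((p x) ^+ 2)%:E|%E = limn (fun n => ((s n x) ^+ 2)%:E).
  rewrite gee0_abs ?lee_fin ?sqr_ge0//; apply/esym/cvg_lim => //.
  by apply: cvg_EFin; [exact: nearW|apply: cvgM; exact: s3].
under eq_integral do rewrite E.
have mono := @cvg_monotone_convergence _ _ _ mu setT measurableT (fun n x => ((s n x) ^+ 2)%:E).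
have {mono} : (\int[mu]_x ((s n x) ^+ 2)%:E @[n --> \oo] -->
    \int[mu]_x limn (fun n => ((s n x) ^+ 2)%:E))%E.
  apply: mono.
  - by move=> n; apply/measurable_EFinP/measurable_funX.
  - by move=> n x _; rewrite lee_fin sqr_ge0.
  - move=> x _ m n mn; rewrite lee_fin lerXn2r ?nnegrE//; exact: s2.
move=> sl; rewrite -(cvg_lim _ sl)//.
apply: lime_le; last by apply: nearW => n; exact: sC.
by apply/cvg_ex; eexists; exact: sl.
Qed.

Section representation.
Variables (F : L2 -> R) (bF : bounded_functional F).

Definition functional_charge (A : set RM) : \bar R := (F (toL2 T (\1_A : RM -> R)))%:E.

Lemma functional_charge0 : functional_charge set0 = 0%E.
Proof. by rewrite /functional_charge indic0 toL2_0 bounded_functional0. Qed.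

Lemma functional_chargeU (A B : set RM) : measurable A -> measurable B -> A `&` B = set0 ->
  functional_charge (A `|` B) = (functional_charge A + functional_charge B)%E.
Proof.
move=> mA mB AB; rewrite /functional_charge -EFinD -bounded_functionalD//; apply: congr1; apply: congr1.
rewrite -toL2D ?indic_Lfun2//; congr toL2; apply/funext => x /=.
rewrite !indicE in_setU.
have : ~ (A `&` B) x by rewrite AB.
have [Ax|Ax] := boolP (x \in A); have [Bx|Bx] := boolP (x \in B); rewrite ?addr0 ?add0r//.
by case; split; exact: set_mem.
Qed.

Lemma functional_charge_le : exists2 C, 0 <= C & forall A, measurable A ->
  (functional_charge A * functional_charge A <= C%:E * mu A)%E.
Proof.
have [C C0 FC] := bounded_functional_bound bF; exists (C ^+ 2); first exact: sqr_ge0.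
move=> A mA; rewrite -indic_norm// -!EFinM lee_fin -exprMn -expr2.
by rewrite -(real_normK (num_real (F _))) lerXn2r ?nnegrE ?mulr_ge0.
Qed.

(** The tail [D n] of a disjoint union has measure tending to 0 because [mu] is finite, and the
    square of the charge of [D n] is at most [C * mu (D n)]. *)
Lemma functional_charge_sigma_additive : semi_sigma_additive functional_charge.
Proof.
move=> A mA tA mUA.
pose S n := \big[setU/set0]_(i < n) A i.
have mS n : measurable (S n) by apply: bigsetU_measurable.
have SU n : S n `<=` \bigcup_k A k.
  by move=> x; rewrite /S -bigcup_mkord => -[i _ Ax]; exists i.
pose D n := (\bigcup_k A k) `\` S n.
have mD n : measurable (D n) by exact: measurableD.
have SD n : \bigcup_k A k = S n `|` D n by rewrite /D setDUK.
have SD0 n : S n `&` D n = set0 by rewrite /D setDIK.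
have nuS n : (\sum_(0 <= i < n) functional_charge (A i) = functional_charge (S n))%E.
  elim: n => [|n IH]; first by rewrite big_nil /S big_ord0 functional_charge0.
  rewrite big_nat_recr//= IH /S big_ord_recr/= functional_chargeU//.
    by apply: bigsetU_measurable.
  rewrite -bigcup_mkord setI_bigcupl bigcup0// => i /= ni.
  by move/trivIsetP : tA; apply => //; rewrite ltn_eqF.
have muD : fine (mu (D n)) @[n --> \oo] --> 0.
  have muA := @measure_semi_sigma_additive _ _ _ mu _ mA tA mUA.
  have finA : mu (\bigcup_k A k) \is a fin_num by exact: leb0T_fin_num_fun.
  have E n : (\sum_(0 <= i < n) mu (A i) = mu (S n))%E.
    elim: n => [|n IH]; first by rewrite big_nil /S big_ord0 measure0.
    rewrite big_nat_recr//= IH /S big_ord_recr/= measureU//.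
      by apply: bigsetU_measurable.
    rewrite -bigcup_mkord setI_bigcupl bigcup0// => i /= ni.
    by move/trivIsetP : tA; apply => //; rewrite ltn_eqF.
  have {}muA : fine (mu (S n)) @[n --> \oo] --> fine (mu (\bigcup_k A k)).
    apply: fine_cvg; rewrite fineK//; move: muA.
    by rewrite (_ : (fun n => _) = (fun n => mu (S n)))//; apply/funext.
  have -> : (fun n => fine (mu (D n))) = (fun n => fine (mu (\bigcup_k A k)) - fine (mu (S n))).
    apply/funext => n; have finS : mu (S n) \is a fin_num by exact: leb0T_fin_num_fun.
    rewrite [in RHS](SD n) measureU// fineD//; first by rewrite addrAC subrr add0r.
    exact: leb0T_fin_num_fun.
  rewrite -[X in _ --> X](subrr (fine (mu (\bigcup_k A k)))).
  by apply: cvgB => //; exact: cvg_cst.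
have [C C0 nuC] := functional_charge_le.
rewrite (_ : (fun n => _) = (fun n => functional_charge (S n))); last by apply/funext.
rewrite /functional_charge; apply: cvg_EFin; first exact: nearW.
set f := F _; rewrite /comp /=.
have H n : (F (toL2 T (\1_(S n) : RM -> R)) - f) ^+ 2 <= C * fine (mu (D n)).
  have := functional_chargeU (mS n) (mD n) (SD0 n).
  rewrite -SD /functional_charge -EFinD => -[]; rewrite -/f => ->.
  have := nuC _ (mD n); rewrite -[X in (_ <= _ * X)%E]fineK ?lee_fin; last exact: leb0T_fin_num_fun.
  move=> h.
  by rewrite opprD addrA subrr add0r sqrrN expr2.
apply/cvgrPdist_lt => e e0.
have Ce : 0 < e ^+ 2 / (C + 1) by rewrite divr_gt0 ?exprn_gt0 ?ltr_wpDl.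
move/cvgrPdist_lt : muD => /(_ _ Ce); apply: filterS => n.
rewrite sub0r normrN ger0_norm; last exact: fine_ge0.
rewrite ltr_pdivlMr ?ltr_wpDl// => Hn.
rewrite distrC -(@ltr_pXn2r _ 2) ?nnegrE// ?(ltW e0)// real_normK ?num_real//.
apply: le_lt_trans (H n) _; apply: le_lt_trans Hn.
by rewrite mulrC ler_wpM2l ?fine_ge0// lerDl.
Qed.

HB.instance Definition _ := isCharge.Build _ _ _ functional_charge
  functional_charge0 (fun _ _ => isT) functional_charge_sigma_additive.

(* Riesz representation in L^2(0,T): the density is a Radon-Nikodym derivative, *)
(* and it is square integrable by testing against its own truncations.          *)
Lemma L2_Riesz : exists g : L2, forall a, F a = L2inner g a.
Proof.
have [C C0 FC] := bounded_functional_bound bF.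
have ac : functional_charge `<< mu.
  apply/null_content_dominatesP => A mA muA.
  have [C' _ /(_ A mA)] := functional_charge_le.
  rewrite muA mule0 /functional_charge -EFinM lee_fin -expr2 => H; congr EFin; apply/eqP.
  by rewrite -sqrf_eq0 eq_le H sqr_ge0.
pose k := fine \o Radon_Nikodym functional_charge mu.
have kE : EFin \o k = Radon_Nikodym functional_charge mu.
  by apply/funext => x /=; rewrite fineK// Radon_Nikodym_fin_num.
have kl : k \in Lfun mu 1.
  by apply/Lfun1_integrable; rewrite kE; exact: Radon_Nikodym_integrable.
have mk := Lfun_measurable kl.
have kA (A : set RM) : measurable A -> F (toL2 T (\1_A : RM -> R)) = \int[mu]_x (k x * \1_A x).
  move=> mA; apply: EFin_inj; rewrite -[LHS]/(functional_charge A).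
  rewrite (Radon_Nikodym_integral ac)// -kE integral_mkcond /Rintegral fineK.
    by apply: eq_integral => x _; rewrite epatch_indic.
  have : mu.-integrable setT (EFin \o (k \* (\1_A : RM -> R))).
    apply/Lfun1_integrable; apply: (Lfun1M (M := 1)) => //.
    by move=> x _; rewrite indicE; case: (_ \in _); rewrite ?normr1 ?normr0.
  exact: integrable_fin_num.
have bnd (G : L2 -> R) (h : RM -> R) : h \in Lfun mu 1 -> bounded_functional G ->
    (forall A : set RM, measurable A -> G (toL2 T (\1_A : RM -> R)) = \int[mu]_x (h x * \1_A x)) ->
    forall s : {nnsfun RM >-> R}, G (toL2 T s) = \int[mu]_x (h x * s x).
  move=> hl bG GA s.
  apply: (functional_nnsfun (Phi := fun q => \int[mu]_x (h x * q x))) => //.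
  - move=> c f A M mf fM mA; have mh := Lfun_measurable hl.
    have Al : h \* (\1_A : RM -> R) \in Lfun mu 1.
      apply: (Lfun1M (M := 1)) => // x _.
      by rewrite indicE; case: (_ \in _); rewrite ?normr1 ?normr0.
    rewrite -Lfun1_RintegralZ// -Lfun1_RintegralD; last 2 first.
    + apply/Lfun1_integrable; apply: eq_integrable (integrableZl measurableT c
        ((Lfun1_integrable _ _).1 Al)) => //.
    + exact: (Lfun1M (M := M)).
    by apply: eq_Rintegral => x _; rewrite mulrDr mulrCA.
  - by under eq_Rintegral do rewrite mulr0; rewrite /Rintegral integral0.
have kpos : (fun x => Num.max (k x) 0) \in Lfun mu 2%:E.
  apply: (Lfun2_of_bounded_pairing C0 kl) => s.
  by rewrite -(bnd F)// (le_trans (ler_norm _)).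
have bN : bounded_functional (fun a => - F a).
  split; first by move=> c a b; rewrite bF.1 opprD mulrN.
  by exists C => a; rewrite normrN.
have kNl : (fun x => - k x) \in Lfun mu 1.
  apply/Lfun1_integrable; have /Lfun1_integrable ki := kl.
  by apply: eq_integrable (integrableN ki).
have kneg : (fun x => Num.max (- k x) 0) \in Lfun mu 2%:E.
  apply: (Lfun2_of_bounded_pairing C0 kNl) => s.
  rewrite -(bnd _ _ kNl bN _ s); first by rewrite (le_trans (ler_norm _))// normrN.
  move=> A mA; rewrite kA// -mulN1r -Lfun1_RintegralZ.
    by apply: eq_Rintegral => x _; rewrite mulN1r mulNr.
  apply: (Lfun1M (M := 1)) => // x _.
  by rewrite indicE; case: (_ \in _); rewrite ?normr1 ?normr0.
have k2 : k \in Lfun mu 2%:E.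
  rewrite (_ : k = (fun x => Num.max (k x) 0) \+ (fun x => -1 * Num.max (- k x) 0)).
    by apply: Lfun2D => //; exact: Lfun2Z.
  apply/funext => x /=; rewrite mulN1r.
  by case: (leP (k x) 0) => kx; case: leP; lra.
exists (toL2 T k) => a; apply/eqP; rewrite -subr_eq0; apply/eqP.
have [C' bF2] := (bounded_functional_inner (toL2 T k)).2.
apply: (L2_functional_eq0 (F := fun a => F a - L2inner (toL2 T k) a)).
  split; first by move=> c x y; rewrite bF.1 (bounded_functional_inner _).1; ring.
  exists (C + C') => x; rewrite mulrDl (le_trans (ler_normB _ _))//.
  by rewrite lerD.
move=> A mA; rewrite kA// L2inner_toL2 ?subrr//; exact: indic_Lfun2.
Qed.

End representation.

End Riesz.

(** * Smooth bumps and the lemma of du Bois-Reymond *)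

Section smooth_functions.
Context (R : realType).
Implicit Types (f g : R -> R) (c x t : R) (p : {poly R}).

(** Differentiability of order [n + 1]. Recursion on the first derivative makes sums, products and
    affine changes of variable amenable to induction. *)
Fixpoint Cn n f := (forall x, derivable f x 1) /\ (if n is n'.+1 then Cn n' (derive1 f) else True).

Lemma Cn_derivable1n n f : Cn n f -> forall x, derivable (derive1n n f) x 1.
Proof.
elim: n f => [|n IH] f [df H] x; first by rewrite derive1n0.
by rewrite derive1Sn; exact: IH.
Qed.

Lemma CnW n f : Cn n.+1 f -> Cn n f.
Proof. by elim: n f => [|n IH] f [df H]; split => //; exact: IH. Qed.

Lemma derive1_is f df : (forall x, is_derive x 1 f (df x)) -> (derive1 f) = df.
Proof. by move=> fd; apply/funext => x; rewrite derive1E; exact: derive_val. Qed.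

Lemma derivable_is f x : derivable f x 1 -> is_derive x 1 f ((derive1 f) x).
Proof. by move=> /derivableP; rewrite derive1E. Qed.

Lemma CnD n f g : Cn n f -> Cn n g -> Cn n (f \+ g).
Proof.
elim: n f g => [|n IH] f g [df Hf] [dg Hg].
  by split => // x; exact: derivableD.
split; first by move=> x; exact: derivableD.
rewrite (_ : derive1 (f \+ g) = (derive1 f) \+ (derive1 g)); first exact: IH.
by apply: derive1_is => x; apply: is_deriveD; exact: derivable_is.
Qed.

Lemma CnM n f g : Cn n f -> Cn n g -> Cn n (f \* g).
Proof.
elim: n f g => [|n IH] f g [df Hf] [dg Hg].
  by split => // x; exact: derivableM.
split; first by move=> x; exact: derivableM.
rewrite (_ : derive1 (f \* g) = (f \* (derive1 g)) \+ (g \* (derive1 f))).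
  by apply: CnD; apply: IH => //; apply: CnW; split.
apply: derive1_is => x.
by have := is_deriveM (derivable_is (df x)) (derivable_is (dg x)).
Qed.

Lemma Cn_cst n c : Cn n (cst c).
Proof.
elim: n c => [|n IH] c; split => //; try by move=> x; exact: derivable_cst.
by rewrite (_ : derive1 _ = cst 0)//; apply: derive1_is => x; exact: is_derive_cst.
Qed.

Lemma Cn_affine n f c t : Cn n f -> Cn n (fun x => f (c * x + t)).
Proof.
elim: n f => [|n IH] f [df Hf].
all: have D x : is_derive x 1 (fun x => f (c * x + t)) ((derive1 f) (c * x + t) * c).
1,3: apply: (@is_derive1_comp _ f (fun x => c * x + t)); first exact: derivable_is.
1,2: have := is_deriveD (is_deriveZ c (is_derive_id x 1)) (is_derive_cst t x 1).
1,2: by rewrite addr0 /GRing.scale/= mulr1.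
- by split => // x; exact: ex_derive.
- split => [x|]; first exact: ex_derive.
  rewrite (derive1_is D); apply: CnM; last exact: Cn_cst.
  exact: IH.
Qed.

Lemma is_derive0_quadratic f M x : (forall h, `|f (x + h) - f x| <= M * h ^+ 2) ->
  is_derive x 1 f 0.
Proof.
move=> fM.
have H : h^-1 *: ((f \o shift x) (h *: 1) - f x) @[h --> 0^'] --> (0 : R).
  apply/cvgrPdist_lt => e e0; near=> h.
  have h0 : h != 0 by near: h; exact: nbhs_dnbhs_neq.
  rewrite sub0r normrN normrM normfV /shift/= [_ *: _]mulr1 addrC.
  rewrite mulrC ltr_pdivrMr ?normr_gt0//.
  rewrite [X in `|X|]addrC (addrC h); apply: le_lt_trans (fM h) _.
  rewrite -real_normK ?num_real// expr2 mulrA.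
  rewrite ltr_pM2r ?normr_gt0//.
  apply: (@le_lt_trans _ _ (`|M| * `|h|)); first by rewrite ler_wpM2r// ler_norm.
  have : `|h| < e / (`|M| + 1).
    near: h; apply: dnbhs0_lt; by rewrite divr_gt0 ?ltr_wpDl.
  rewrite ltr_pdivlMr ?ltr_wpDl// => /(le_lt_trans _); apply.
  by rewrite mulrC ler_wpM2l// lerDl.
split; first by apply/cvg_ex; exists 0.
exact: cvg_lim H.
Unshelve. all: by end_near.
Qed.

Lemma expR_dominates_poly c p : 0 < c ->
  exists M, forall s, 0 < s -> `|p.[s] * expR (- c * s)| <= M.
Proof.
move=> c0.
have mono n : exists M, forall s, 0 < s -> s ^+ n * expR (- c * s) <= M.
  case: n => [|n].
    by exists 1 => s s0; rewrite expr0 mul1r -expR0 ler_expR mulNr oppr_le0 mulr_ge0// ltW.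
  (* The constant comes from [expR (c s) = expR (c s / n.+1) ^+ n.+1] and [1 + x <= expR x]. *)
  exists ((n.+1%:R / c) ^+ n.+1) => s s0.
  rewrite mulNr expRN ler_pdivrMr ?expR_gt0//.
  have -> : c * s = n.+1%:R * (c * s / n.+1%:R) by field; rewrite nat1r pnatr_eq0.
  rewrite expRM_natl.
  suff : s ^+ n.+1 <= ((n.+1%:R / c) * expR (c * s / n.+1%:R)) ^+ n.+1 by rewrite exprMn.
  have a0 : 0 <= n.+1%:R / c by rewrite divr_ge0 ?(ltW c0).
  have a1 : 0 <= n.+1%:R / c * expR (c * s / n.+1%:R) by rewrite mulr_ge0// expR_ge0.
  apply: lerXn2r; rewrite ?nnegrE//; first exact: ltW.
  apply: (@le_trans _ _ ((n.+1%:R / c) * (1 + c * s / n.+1%:R))); last first.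
    by rewrite ler_wpM2l// expR_ge1Dx.
  rewrite mulrDr mulr1 (_ : _ / c * (_ / _) = s); first by rewrite lerDr.
  by field; rewrite nat1r pnatr_eq0/= gt_eqF.
(* The extra power of [s] absorbs the factor ['X] in the induction on the polynomial. *)
suff /(_ 0%N)[M pM] : forall n, exists M, forall s, 0 < s -> `|p.[s] * s ^+ n * expR (- c * s)| <= M.
  by exists M => s /pM; rewrite expr0 mulr1.
elim/poly_ind: p => [|p a IH] n.
  by exists 0 => s s0; rewrite horner0 !mul0r normr0.
have [M1 H1] := IH n.+1; have [M2 H2] := mono n.
exists (M1 + `|a| * M2) => s s0.
rewrite hornerMXaddC.
have -> : (p.[s] * s + a) * s ^+ n * expR (- c * s) =
  p.[s] * s ^+ n.+1 * expR (- c * s) + a * (s ^+ n * expR (- c * s)) by rewrite exprS; ring.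
rewrite (le_trans (ler_normD _ _))// lerD ?H1// normrM ler_wpM2l//.
by rewrite ger0_norm ?H2// mulr_ge0 ?expR_ge0// exprn_ge0// ltW.
Qed.

(** Carrying the polynomial [p] makes the family closed under differentiation, hence smooth; [p = 1]
    is the classical flat function. *)
Definition flat_exp c p t : R := if 0 < t then p.[t^-1] * expR (- c * t^-1) else 0.

Lemma is_derive_flat_exp c p t : 0 < c ->
  is_derive t 1 (flat_exp c p) (flat_exp c ('X^2 * (c%:P * p - p^`())) t).
Proof.
move=> c0; have [t0|t0|t0] := ltgtP t 0.
- rewrite [X in is_derive _ _ _ X](_ : _ = 0); last by rewrite /flat_exp lt_gtF.
  have := is_derive_cst (0 : R) t 1; apply: near_eq_is_derive.
  near=> x; rewrite /flat_exp lt_gtF//; near: x; exact: lt_nbhsl.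
- rewrite {2}/flat_exp t0.
  apply: (@near_eq_is_derive _ _ _ (fun x => p.[x^-1] * expR (- c * x^-1))).
    near=> x; rewrite /flat_exp ifT//; near: x; exact: lt_nbhsr.
  have dV := is_deriveV (lt0r_neq0 t0) (is_derive_id t 1).
  have d1 := is_derive1_comp (is_derive_poly p t^-1) dV.
  have d2 := @is_derive1_comp _ expR (fun y => - c * y^-1) t _ _
    (is_derive_expR (- c * t^-1)) (is_deriveZ (- c) dV).
  apply: (is_derive_eq (is_deriveM d1 d2)).
  rewrite /GRing.scale/= hornerM hornerXn hornerD hornerN hornerM hornerC -exprVn.
  by ring.
- rewrite t0 {2}/flat_exp ltxx.
  (* The factor ['X^2], evaluated at [1 / h], turns boundedness into a quadratic estimate at 0, so
     that the derivative there is 0. *)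
  have [M HM] := expR_dominates_poly (p * 'X^2) c0.
  apply: (@is_derive0_quadratic _ `|M|) => h.
  rewrite add0r {2}/flat_exp ltxx subr0 /flat_exp; case: ifPn => h0; last by rewrite normr0 mulr_ge0 ?sqr_ge0.
  have hV : 0 < h^-1 by rewrite invr_gt0.
  have := HM _ hV; rewrite hornerM hornerXn => {}HM.
  have -> : p.[h^-1] * expR (- c * h^-1) = p.[h^-1] * h^-1 ^+ 2 * expR (- c * h^-1) * h ^+ 2.
    by rewrite exprVn; field; rewrite gt_eqF.
  rewrite normrM (ger0_norm (sqr_ge0 h)) ler_wpM2r ?sqr_ge0//.
  exact: le_trans (HM) (ler_norm _).
Unshelve. all: by end_near.
Qed.

Lemma Cn_flat_exp n c p : 0 < c -> Cn n (flat_exp c p).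
Proof.
move=> c0; have d q t : derivable (flat_exp c q) t 1 by case: (is_derive_flat_exp q t c0).
elim: n p => [|n IH] p; split => //.
by rewrite (derive1_is (fun t => is_derive_flat_exp p t c0)).
Qed.

(** As [1 / n.+1] tends to 0 these smooth functions, bounded by 1, converge pointwise to the
    indicator of []a, b[]. *)
Definition bump (a b : R) (n : nat) x : R :=
  flat_exp n.+1%:R^-1 1%:P (x - a) * flat_exp n.+1%:R^-1 1%:P (b - x).

Lemma Cn_bump m a b n : Cn m (bump a b n).
Proof.
have n0 : 0 < n.+1%:R^-1 :> R by rewrite invr_gt0.
apply: CnM.
- have := Cn_affine 1 (- a) (Cn_flat_exp m 1%:P n0).
  by rewrite (_ : (fun x => _ (1 * x - a)) = (fun x => flat_exp n.+1%:R^-1 1%:P (x - a)))//; apply/funext => x; rewrite mul1r.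
- have := Cn_affine (-1) b (Cn_flat_exp m 1%:P n0).
  by rewrite (_ : (fun x => _ (-1 * x + b)) = (fun x => flat_exp n.+1%:R^-1 1%:P (b - x)))//; apply/funext => x; rewrite mulN1r addrC.
Qed.

Lemma bump_out a b n x : ~ (a < x < b) -> bump a b n x = 0.
Proof.
rewrite /bump /flat_exp !subr_gt0 => ab.
have [ax|] := boolP (a < x); last by rewrite mul0r.
have [xb|] := boolP (x < b); last by rewrite mulr0.
by case: ab; rewrite ax.
Qed.

Lemma bump_in a b n x : a < x < b ->
  bump a b n x = expR (- n.+1%:R^-1 * ((x - a)^-1 + (b - x)^-1)).
Proof.
move=> /andP[ax xb]; rewrite /bump /flat_exp !subr_gt0 ax xb !hornerC !mul1r.
by rewrite -expRD -mulrDr.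
Qed.

Lemma bump_bound a b n x : 0 <= bump a b n x <= 1.
Proof.
have [xab|/negP xab] := boolP (a < x < b); last by rewrite bump_out// lexx ler01.
rewrite bump_in// expR_ge0 -expR0 ler_expR mulNr oppr_le0.
by move/andP: xab => [ax xb]; rewrite mulr_ge0 ?invr_ge0// addr_ge0// invr_ge0 subr_ge0 ltW.
Qed.

Lemma bump_cvg a b x : a < x < b -> bump a b n x @[n --> \oo] --> (1 : R).
Proof.
move=> xab; rewrite (_ : (fun n => _) =
    (fun n => expR (- n.+1%:R^-1 * ((x - a)^-1 + (b - x)^-1)))); last first.
  by apply/funext => n; rewrite bump_in.
rewrite -expR0; apply: continuous_cvg; first exact: continuous_expR.
have : - (harmonic n : R) * ((x - a)^-1 + (b - x)^-1) @[n --> \oo] -->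
    - 0 * ((x - a)^-1 + (b - x)^-1).
  by apply: cvgMl; apply: cvgN; exact: cvg_harmonic.
by rewrite oppr0 mul0r expR0.
Qed.

Lemma Cn_continuous n f : Cn n f -> continuous f.
Proof.
case: n => [|n] [df _] x; apply: differentiable_continuous; exact/derivable1_diffP.
Qed.

End smooth_functions.

Section du_Bois_Reymond.
Context (R : realType) (T : R).
Local Notation mu := (leb0T T).
Local Notation RM := (measurableTypeR R).
Local Notation leb := (@lebesgue_measure R).

Lemma continuous_measurable (h : RM -> R) : continuous (h : R -> R) -> measurable_fun setT h.
Proof. by move=> ch; exact: continuous_measurable_fun. Qed.

Lemma C0_continuous (phi : C0 T) : continuous (phi : R -> R).
Proof. by have [] := set_mem (C0P phi). Qed.

Lemma C0_out (phi : C0 T) x : ~ (0 < x < T) -> phi x = 0.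
Proof. by have [_] := set_mem (C0P phi); apply. Qed.

Lemma C0_measurable (phi : C0 T) : measurable_fun setT (phi : RM -> R).
Proof. by apply: continuous_measurable; exact: C0_continuous. Qed.

Lemma C0_le_norm (phi : C0 T) x : `|phi x| <= `|phi|.
Proof.
rewrite C0_normE; have [xT|/negP xT] := boolP (0 < x < T).
  by apply: ub_le_sup; [exact: C0_bounded|exists x => //=; rewrite in_itv].
rewrite C0_out// normr0 /supnorm.
have [->|/set0P[y Ay]] := eqVneq [set `|phi x| | x in `]0, T[] set0.
  by rewrite sup0.
apply: (le_trans _ (ub_le_sup (C0_bounded phi) Ay)).
by case: Ay => z _ <-.
Qed.

Lemma C0_norm_le (phi : C0 T) M : 0 <= M -> (forall x, 0 < x < T -> `|phi x| <= M) -> `|phi| <= M.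
Proof.
move=> M0 phiM; rewrite C0_normE /supnorm.
have [->|/set0P An0] := eqVneq [set `|phi x| | x in `]0, T[] set0.
  by rewrite sup0.
by apply: ge_sup => // _ [x xT <-]; apply: phiM; move: xT; rewrite /= in_itv.
Qed.

Lemma compactly_supported_integrable (h : RM -> R) a b : continuous (h : R -> R) ->
  (forall x, ~ (a <= x <= b) -> h x = 0) -> leb.-integrable setT (EFin \o h).
Proof.
move=> ch h0.
have := @continuous_compact_integrable R h `[a, b] (@segment_compact _ _ _).
move=> /(_ (continuous_subspaceT ch)) hi.
have : leb.-integrable setT (EFin \o h \_ `[a, b]).
  rewrite -restrict_EFin; exact/(integrable_mkcond _ _).1.
rewrite (_ : h \_ `[a, b] = h)//; apply/funext => x; rewrite patchE.
by case: ifPn => // /negP; rewrite inE/= in_itv/= => /h0.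
Qed.

(** The primitive starting at minus infinity vanishes to the left of [a], and to the right of [b]
    because the total integral is 0. *)
Lemma smooth_primitive (h : R -> R) a b : 0 < a -> b < T -> (forall n, Cn n h) ->
  (forall x, ~ (a <= x <= b) -> h x = 0) -> \int[mu]_x h x = 0 ->
  exists phi : C0 T, test_function T phi /\ derive1 phi = h.
Proof.
move=> a0 bT sh h0 Ih.
have ch : continuous h by exact: Cn_continuous (sh 0%N).
have hi := compactly_supported_integrable ch h0.
have mh : measurable_fun setT (h : RM -> R) by exact: continuous_measurable.
pose phi x := \int[leb]_(t in `]-oo, x]) h t.
have dphi (x : R) : is_derive x 1 phi (h x).
  have [||||d1 d2] := @continuous_FTC1 _ h -oo%O x (x + 1).
  - by rewrite ltrDl.
  - by apply: integrableS hi.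
  - by rewrite ltNyr.
  - exact: ch.
  by split; [exact: d1|rewrite -derive1E; exact: d2].
have phi0 x : ~ (a <= x <= b) -> phi x = 0.
  move=> xab; have [xa|ax] := ltP x a.
    rewrite /phi; under eq_Rintegral => t.
      rewrite inE/= in_itv/= => tx; rewrite h0; last by case/andP => /(le_lt_trans)/(_ (le_lt_trans tx xa)); rewrite ltxx.
      over.
    by rewrite /Rintegral integral0.
  have bx : b < x by rewrite ltNge; apply/negP => xb; apply: xab; rewrite ax.
  rewrite -Ih Rintegral_leb0T// /phi Rintegral_mkcond [RHS]Rintegral_mkcond.
  apply: eq_Rintegral => t _; rewrite !patchE !mem_setE !in_itv/=.
  have [tab|/negP tab] := boolP (a <= t <= b); last by rewrite h0// !if_same.
  case/andP: tab => at_ tb.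
  by rewrite (le_trans tb (ltW bx)) (lt_le_trans a0 at_) (le_lt_trans tb bT).
have cphi : continuous phi.
  by move=> x; apply: differentiable_continuous; apply/derivable1_diffP; case: (dphi x).
have phiP : phi \in C0_pred T.
  apply/mem_set; split => // x xT; apply: phi0; apply: contra_not xT => /andP[ax xb].
  by rewrite (lt_le_trans a0 ax) (le_lt_trans xb bT).
exists (MkC0 phiP); rewrite /= (derive1_is dphi); split => //; split.
  case=> [|n] x; first by rewrite derive1n0; case: (dphi x).
  by rewrite derive1Sn (derive1_is dphi); exact: (Cn_derivable1n (sh n)).
by exists a, b; split.
Qed.

Lemma bump_measurable a b n : measurable_fun setT (bump a b n : RM -> R).
Proof. by apply: continuous_measurable; exact: Cn_continuous (Cn_bump 0 a b n). Qed.

Lemma bump_norm_le (a b : R) n (x : R) : `|bump a b n x| <= 1.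
Proof. by have /andP[? ?] := bump_bound a b n x; rewrite ger0_norm. Qed.

Lemma bump_Lfun1M (v : RM -> R) a b n : v \in Lfun mu 1 -> v \* (bump a b n : RM -> R) \in Lfun mu 1.
Proof.
move=> vl; apply: (Lfun1M (M := 1)) => //; first exact: bump_measurable.
by move=> x _; exact: bump_norm_le.
Qed.

Lemma Rintegral_bump_cvg (v : RM -> R) a b : v \in Lfun mu 1 ->
  \int[mu]_x (v x * bump a b n x) @[n --> \oo] --> \int[mu]_x (v x * \1_(`]a, b[) x).
Proof.
move=> vl; have mv := Lfun_measurable vl.
have mi : measurable_fun setT (\1_(`]a, b[ : set RM) : RM -> R) by exact: measurable_indic.
have [] := @dominated_convergence _ _ _ mu setT measurableT
  (fun n => EFin \o (fun x => v x * bump a b n x))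
  (EFin \o (fun x => v x * \1_(`]a, b[ : set RM) x)) (EFin \o (fun x => `|v x|)).
- by move=> n; apply/measurable_EFinP/measurable_funM => //; exact: bump_measurable.
- by apply/measurable_EFinP/measurable_funM.
- apply: aeW => x _; apply: cvg_EFin; first exact: nearW.
  rewrite /comp /=; apply: cvgMr; rewrite indicE mem_setE in_itv/=.
  have [xab|/negP xab] := boolP (a < x < b); first exact: bump_cvg.
  by under eq_fun do rewrite bump_out//; exact: cvg_cst.
- by apply/Lfun1_integrable; exact: Lfun_norm.
- apply: aeW => x n _ /=; rewrite lee_fin normrM ler_piMr//.
  exact: bump_norm_le.
move=> gi _ H; apply: fine_cvg; rewrite fineK//.
exact: (integrable_fin_num measurableT gi).
Qed.

Lemma leb0T_integrable (f : RM -> R) : mu.-integrable setT (EFin \o f) ->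
  leb.-integrable `]0, T[ (EFin \o f).
Proof.
move=> /integrableP[mf fi]; apply/integrableP; split; first exact: measurable_funS mf.
have <- // := @integral_mrestr _ RM R leb _ (measurable_itv `]0, T[) (fun x => `|(f x)%:E|%E).
exact: measurableT_comp.
Qed.

Lemma ae_leb_leb0T (P : RM -> Prop) : {ae leb, forall x, P x} -> {ae mu, forall x, P x}.
Proof.
move=> [N [mN N0 sN]]; exists N; split => //.
apply/eqP; rewrite eq_le measure_ge0 andbT -N0.
by rewrite /leb0T /mrestr/= le_measure ?inE//; exact: measurableI.
Qed.

(** By Lebesgue differentiation [v] is almost everywhere the derivative of its primitive, and the
    hypothesis makes this primitive constant on (0,T). *)
Lemma ae_eq0_of_intervals (v : RM -> R) : v \in Lfun mu 1 ->
  (forall a b, 0 < a -> a < b -> b < T -> \int[mu]_x (v x * \1_(`]a, b[) x) = 0) ->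
  v = cst 0 %[ae mu].
Proof.
move=> vl v0; have mv := Lfun_measurable vl.
have vi := (Lfun1_integrable _ _).1 vl.
pose w : R -> R := v \_ `]0, T[.
have wi : leb.-integrable setT (EFin \o w).
  rewrite /w -restrict_EFin; apply/(integrable_mkcond _ _).1 => //; exact: leb0T_integrable.
have FTC : {ae leb, forall x : R, derivable (fun x : R => \int[leb]_(t in `]-oo, x]) w t) x 1 /\
    derive1 (fun x : R => \int[leb]_(t in `]-oo, x]) w t) x = w x}.
  apply: FTC1Ny => [y|]; first by apply: integrableS wi.
  split; [by case/integrableP : wi => /measurable_EFinP|exact: openT|].
  move=> K _ cK; have mK : measurable K by exact: compact_measurable.
  have /integrableP[_] : leb.-integrable K (EFin \o w) by apply: integrableS wi.
  by [].
have FF : Filter (nbhs (almost_everywhere mu)) by exact: ae_filter_ringOfSetsType.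
apply: (@filterS RM _ FF _ _ _ (filterI (ae_leb_leb0T FTC) (@ae_leb0T _ T (fun x : RM => 0 < x < T) (fun x h => h)))).
move=> x [[_ F'] xT] _.
have vw y : 0 < y < T -> v y = w y by move=> yT; rewrite /w patchE mem_setE in_itv/= yT.
rewrite vw// -F' derive1E /=.
have H y z : 0 < y < T -> 0 < z < T -> y < z ->
    \int[leb]_(t in `]-oo, y]) w t = \int[leb]_(t in `]-oo, z]) w t.
  move=> yT zT yz; apply/esym/eqP; rewrite -subr_eq0.
  rewrite (Rintegral_itvB (x := y) (a := -oo%O) (b := BRight z))//; last 2 first.
  - by apply: integrableS wi.
  - by rewrite bnd_simp ltW.
  apply/eqP; rewrite -(Rintegral_itv_bndo_bndc (r := z)); last by apply: integrableS wi.
  have /andP[y0 _] := yT; have /andP[_ zT'] := zT.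
  rewrite -(v0 y z)// Rintegral_leb0T; last by apply: measurable_funM.
  rewrite Rintegral_mkcond [RHS]Rintegral_mkcond; apply: eq_Rintegral => t _.
  rewrite !patchE indicE !mem_setE !in_itv/=.
  have [/andP[yt tz]|tyz] := boolP (y < t < z); last by rewrite mulr0 if_same.
  by rewrite (lt_trans y0 yt) (lt_trans tz zT') mulr1 /w patchE mem_setE in_itv/= (lt_trans y0 yt) (lt_trans tz zT').
rewrite -(near_eq_derive (f := cst (\int[leb]_(t in `]-oo, x]) w t))); first exact: derive_cst.
near=> y.
have yT : 0 < y < T by near: y; exact: near_in_itvoo.
by rewrite /cst; have [xy|xy|->//] := ltgtP x y; [exact: H|apply/esym; exact: H].
Unshelve. all: by end_near.
Qed.

(** The integrals converge to [b0 - a0], so they cannot all vanish. *)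
Lemma exists_bump_integral (a0 b0 : R) : 0 < a0 -> a0 < b0 -> b0 < T ->
  exists n, \int[mu]_x bump a0 b0 n x != 0.
Proof.
move=> a0_gt0 ab0 b0T.
have c1 c : (cst c : RM -> R) \in Lfun mu 1 by exact: Lfun_cst.
apply: contrapT => /forallNP H.
have H0 n : \int[mu]_x bump a0 b0 n x = 0.
  by apply/eqP/negP => /negP; exact: H.
have := @Rintegral_bump_cvg (cst 1) a0 b0 (c1 1).
rewrite (_ : (fun n => _) = cst 0); last first.
  by apply/funext => n; rewrite -[RHS](H0 n); apply: eq_Rintegral => x _; rewrite mul1r.
move=> /cvg_lim; rewrite lim_cst// => /(_ (@Rhausdorff _)).
under eq_Rintegral do rewrite mul1r.
rewrite Rintegral_leb0T; last exact: measurable_indic.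
rewrite /Rintegral integral_indic//=.
rewrite (_ : _ `&` _ = `]a0, b0[%classic); last first.
  apply/seteqP; split=> x /=; rewrite !in_itv/=; first by case.
  by move=> /andP[ax xb]; rewrite ax xb (lt_trans a0_gt0 ax) (lt_trans xb b0T).
by rewrite lebesgue_measure_itv/= lte_fin ab0 -EFinB/=; lra.
Qed.

(** Any bump minus the multiple of a fixed normalized bump [eta] with the same integral is the
    derivative of a test function. Hence [w - c], where [c] is the average of [w] against [eta],
    integrates to 0 against all bumps, and in the limit over all intervals. *)
Lemma du_Bois_Reymond (w : RM -> R) : 0 < T -> w \in Lfun mu 1 ->
  (forall phi : C0 T, test_function T phi -> \int[mu]_x (w x * derive1 phi x) = 0) ->
  exists c, w = cst c %[ae mu].
Proof.
move=> T0 wl w0; have mw := Lfun_measurable wl.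
pose a0 := T / 4; pose b0 := 3 * T / 4.
have a0_gt0 : 0 < a0 by rewrite /a0; lra.
have ab0 : a0 < b0 by rewrite /a0 /b0; lra.
have b0T : b0 < T by rewrite /b0; lra.
have c1 c : (cst c : RM -> R) \in Lfun mu 1 by exact: Lfun_cst.
have [n In] := exists_bump_integral a0_gt0 ab0 b0T.
set J := \int[mu]_x bump a0 b0 n x in In.
pose eta x := J^-1 * bump a0 b0 n x.
have blm a b m : (bump a b m : RM -> R) \in Lfun mu 1.
  by apply: (bounded_Lfun1 (M := 1)) => [|x _]; [exact: bump_measurable|exact: bump_norm_le].
have etal : (eta : RM -> R) \in Lfun mu 1.
  apply: (bounded_Lfun1 (M := `|J^-1|)) => [|x _].
    by apply: measurable_funM => //; exact: bump_measurable.
  by rewrite normrM ler_piMr// bump_norm_le.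
have Ieta : \int[mu]_x eta x = 1 by rewrite Lfun1_RintegralZ// mulVf.
pose c := \int[mu]_x (w x * eta x); exists c.
pose v x := w x - c.
have vl : (v : RM -> R) \in Lfun mu 1.
  by apply: (@Lfun1D _ _ _ mu w (cst (- c))).
suff : (v : RM -> R) = cst 0 %[ae mu].
  by apply: filterS => x /(_ Logic.I) /eqP; rewrite subr_eq0 => /eqP.
apply: ae_eq0_of_intervals => // a b a_gt0 ab bT.
have vb m : \int[mu]_x (v x * bump a b m x) = 0.
  pose k := \int[mu]_x bump a b m x.
  pose h x := bump a b m x + (- k * J^-1) * bump a0 b0 n x.
  have hE : h = (fun x => bump a b m x - k * eta x) by apply/funext => x; rewrite /h /eta; ring.
  have hn : forall j, Cn j h.
    move=> j; apply: CnD; first exact: Cn_bump.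
    by apply: CnM; [exact: Cn_cst|exact: Cn_bump].
  have ketal : (fun x => k * eta x : R) \in Lfun mu 1.
    have -> : (fun x : R => k * eta x) = (cst k \* eta) by [].
    apply/Lfun1_integrable; apply: eq_integrable (integrableZl measurableT k
      ((Lfun1_integrable _ _).1 etal)) => //.
  have [|||||phi [tphi phiE]] := @smooth_primitive h (Num.min a a0) (Num.max b b0).
  - by rewrite lt_min a_gt0.
  - by rewrite gt_max bT.
  - exact: hn.
  - move=> x xab; rewrite /h !bump_out ?mulr0 ?addr0//.
    + by apply: contra_not xab => /andP[ax xb]; rewrite ge_min le_max (ltW ax) (ltW xb) !orbT.
    + by apply: contra_not xab => /andP[ax xb]; rewrite ge_min le_max (ltW ax) (ltW xb).
  - by rewrite hE Lfun1_RintegralB// Lfun1_RintegralZ// Ieta mulr1 subrr.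
  have := w0 phi tphi; rewrite phiE hE.
  have wbl : w \* (bump a b m : RM -> R) \in Lfun mu 1 by exact: bump_Lfun1M.
  have wel : w \* eta \in Lfun mu 1.
    apply: (Lfun1M (M := `|J^-1|)) => //; first exact: Lfun_measurable etal.
    by move=> x _; rewrite normrM ler_piMr// bump_norm_le.
  have kwel : (fun x => k * (w x * eta x)) \in Lfun mu 1.
    apply/Lfun1_integrable; apply: eq_integrable (integrableZl measurableT k
      ((Lfun1_integrable _ _).1 wel)) => //.
  have cbl : (fun x => c * bump a b m x) \in Lfun mu 1.
    apply/Lfun1_integrable; apply: eq_integrable (integrableZl measurableT c
      ((Lfun1_integrable _ _).1 (blm a b m))) => //.
  have -> : \int[mu]_x (w x * (bump a b m x - k * eta x)) =
      \int[mu]_x (w x * bump a b m x - k * (w x * eta x)).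
    by apply: eq_Rintegral => x _; ring.
  rewrite Lfun1_RintegralB// Lfun1_RintegralZ// -/c => H.
  have -> : \int[mu]_x (v x * bump a b m x) =
      \int[mu]_x (w x * bump a b m x - c * bump a b m x).
    by apply: eq_Rintegral => x _; rewrite /v; ring.
  by rewrite Lfun1_RintegralB// Lfun1_RintegralZ// -/k mulrC.
have := @Rintegral_bump_cvg v a b vl; rewrite (_ : (fun n => _) = cst 0); last exact/funext.
by move=> /cvg_lim; rewrite lim_cst// => /(_ (@Rhausdorff _)) <-.
Qed.

End du_Bois_Reymond.

(** * Primitives and their interpolation *)

Section ultralimits.
Context (R : realType).

Lemma ultra_fmap (I J : Type) (U : set_system I) (a : I -> J) :
  UltraFilter U -> UltraFilter (a @ U).
Proof.
move=> UU; have PU := @ultra_proper _ U UU.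
apply: Build_UltraFilter => G PG aG; apply/seteqP; split => // A GA.
have [//|UA] := in_ultra_setVsetC (a @^-1` A) UU.
have GA' : G (~` A) by apply: aG.
have /(@filter_not_empty _ _ _)[] : G set0.
by rewrite -(setICr A); exact: filterI.
Qed.

(** Compactness of a segment. One ultrafilter serves all bounded sequences at once, in particular
    the values on all test functions, without a diagonal argument. *)
Lemma ultra_cvg_bounded (I : Type) (U : set_system I) (a : I -> R) (M : R) :
  UltraFilter U -> (forall n, `|a n| <= M) -> exists l : R, a n @[n --> U] --> l.
Proof.
move=> UU aM; have PU := @ultra_proper _ U UU.
have := @segment_compact R (- M) M; rewrite compact_ultra.
move=> /(_ (a @ U) (ultra_fmap a UU)); case.
  apply: (@filterS _ U _ setT) => [n _|]; last exact: filterT.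
  by rewrite /= in_itv/= -ler_norml.
by move=> l [_ al]; exists l.
Qed.

Lemma ultra_above_oo : exists U : set_system nat, UltraFilter U /\ \oo `<=` U.
Proof. exact: ultraFilterLemma. Qed.

(** Heine's theorem: counterexamples at distance at most [1 / n.+1] would have a common limit along
    an ultrafilter. *)
Lemma unif_continuous_segment (f : R -> R) (a b e : R) : continuous f -> 0 < e ->
  exists2 d, 0 < d & forall x y, a <= x <= b -> a <= y <= b -> `|x - y| <= d -> `|f x - f y| <= e.
Proof.
move=> cf e0; apply: contrapT => H.
have {}H n : exists p : R * R, [/\ a <= p.1 <= b, a <= p.2 <= b,
    `|p.1 - p.2| <= n.+1%:R^-1 & e < `|f p.1 - f p.2|].
  apply: contrapT => Hn; apply: H; exists n.+1%:R^-1; first by rewrite invr_gt0.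
  move=> x y xab yab xy; rewrite leNgt; apply/negP => xye.
  by apply: Hn; exists (x, y).
have [p Hp] := choice H.
have [U [UU ooU]] := ultra_above_oo; have PU := @ultra_proper _ U UU.
have [l xl] : exists l : R, (p n).1 @[n --> U] --> l.
  apply: (@ultra_cvg_bounded _ _ _ (`|a| + `|b|)) => // n.
  have [/andP[ax xb] _ _ _] := Hp n.
  rewrite ler_norml; have := ler_norm b; have := ler_norm (- a); rewrite normrN.
  have := normr_ge0 a; have := normr_ge0 b; lra.
have yx : (p n).1 - (p n).2 @[n --> U] --> (0 : R).
  apply/cvgrPdist_le => d d0; move/cvgrPdist_le : (@cvg_harmonic R) => /(_ d d0) /ooU.
  apply: filterS => n; rewrite !sub0r !normrN => /(le_trans (ler_norm _)); apply: le_trans.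
  by have [] := Hp n.
have yl : (p n).2 @[n --> U] --> l.
  have -> : (fun n => (p n).2) = (fun n => (p n).1 - ((p n).1 - (p n).2)).
    by apply/funext => n; rewrite subKr.
  by rewrite -[X in _ --> X]subr0; exact: cvgB.
have fxy : `|f (p n).1 - f (p n).2| @[n --> U] --> (0 : R).
  rewrite -(normr0 R) -(subrr (f l)); apply: cvg_norm; apply: cvgB.
  - by apply: continuous_cvg xl; exact: cf.
  - by apply: continuous_cvg yl; exact: cf.
have : e <= 0.
  apply: (cvgr_to_ge fxy); apply: nearW => n.
  by have [_ _ _ /ltW] := Hp n.
by rewrite leNgt e0.
Qed.

End ultralimits.

Section primitives.
Context (R : realType) (T : R) (T0 : 0 < T).
Local Notation mu := (leb0T T).
Local Notation RM := (measurableTypeR R).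
Local Notation leb := (@lebesgue_measure R).
Local Notation L2 := (L2 T).
Local Notation C0 := (C0 T).
Implicit Types (h : L2) (psi : C0).

Definition one : L2 := toL2 T (cst 1).

Lemma cst_Lfun2 (c : R) : (cst c : RM -> R) \in Lfun mu 2%:E.
Proof. exact: Lfun_cst. Qed.

Lemma L2inner_one h : L2inner h one = \int[mu]_x h x.
Proof.
rewrite L2inner_toL2r; last exact: cst_Lfun2.
by apply: eq_Rintegral => x _; rewrite /cst mulr1.
Qed.

Lemma L2inner_indic (A B : set RM) : measurable A -> measurable B ->
  L2inner (toL2 T (\1_A : RM -> R)) (toL2 T (\1_B : RM -> R)) = fine (mu (A `&` B)).
Proof.
move=> mA mB; rewrite L2inner_toL2 ?indic_Lfun2//.
rewrite (_ : (fun x => _) = \1_(A `&` B)).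
  by rewrite /Rintegral integral_indic ?setIT//; exact: measurableI.
apply/funext => x; rewrite !indicE in_setI.
by case: (x \in A); case: (x \in B); rewrite ?(mulr1, mulr0, mul0r).
Qed.

Lemma oneE : one = toL2 T (\1_(setT : set RM) : RM -> R).
Proof. by rewrite indicT. Qed.

Lemma L2inner_one_one : L2inner one one = T.
Proof. by rewrite oneE L2inner_indic// setIT leb0T_setTE. Qed.

(** Projection onto [[0, T]]. Composing with it extends primitives to the whole line, by zero since
    [step 0 = step T = 0]. *)
Definition clamp (x : R) := Num.min (Num.max x 0) T.

Lemma clamp_itv x : 0 <= clamp x <= T.
Proof. by rewrite /clamp le_min ge_min le_max !lexx (ltW T0) !orbT. Qed.

Lemma clampE x : 0 <= x <= T -> clamp x = x.
Proof. by case/andP => x0 xT; rewrite /clamp (max_idPl x0) (min_idPl xT). Qed.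

Lemma clamp_out x : ~ (0 < x < T) -> clamp x = 0 \/ clamp x = T.
Proof.
move=> xT; rewrite /clamp; have [x0|x0] := leP x 0.
  by left; rewrite min_l// ltW.
right; rewrite min_r// leNgt; apply/negP => H; apply: xT; exact/andP.
Qed.

Lemma clamp_lip x y : `|clamp x - clamp y| <= `|x - y|.
Proof.
have := ler_norm (x - y); have := ler_norm (y - x); rewrite distrC /clamp => h1 h2.
by have [?|?] := leP x 0; have [?|?] := leP y 0; rewrite ?(min_l _ (ltW T0));
  do ?[case: (leP _ T) => ?]; rewrite ler_norml; apply/andP; split; lra.
Qed.

Definition below (x : R) : L2 := toL2 T (\1_(`]-oo, x[ : set RM) : RM -> R).

(* Pairing with [step x] integrates over (0,x) after removing the mean, so that *)
(* the primitive vanishes at both ends of (0,T).                               *)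
Definition step (x : R) : L2 := below x - (x / T) *: one.

Lemma below_Lfun2 (x : R) : (\1_(`]-oo, x[ : set RM) : RM -> R) \in Lfun mu 2%:E.
Proof. exact: indic_Lfun2. Qed.

Lemma below0 : below 0 = 0.
Proof.
rewrite /below -(toL2_0 T); apply: eq_toL2; [exact: below_Lfun2|exact: cst_Lfun2|].
apply: ae_leb0T => x /andP[x0 _] _; rewrite indicE memNset//= in_itv/=.
by apply/negP; rewrite -leNgt ltW.
Qed.

Lemma belowT : below T = one.
Proof.
apply: eq_toL2; [exact: below_Lfun2|exact: cst_Lfun2|].
by apply: ae_leb0T => x /andP[_ xT] _; rewrite indicE mem_set//= in_itv/=.
Qed.

Lemma step0 : step 0 = 0.
Proof. by rewrite /step below0 mul0r scale0r subrr. Qed.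

Lemma stepT : step T = 0.
Proof. by rewrite /step belowT divff ?gt_eqF// scale1r subrr. Qed.

Lemma mu_itv (a b : R) (c d : bool) : 0 <= a -> a <= b -> b <= T ->
  mu [set` Interval (BSide c a) (BSide d b)] = (b - a)%:E.
Proof.
move=> a0 ab bT; rewrite /leb0T /mrestr.
have [->|anb] := eqVneq a b.
  rewrite subrr; apply/eqP; rewrite eq_le measure_ge0 andbT.
  apply: (@le_trans _ _ (leb [set` Interval (BSide c b) (BSide d b)])).
    by rewrite le_measure ?inE//; exact: measurableI.
  by rewrite lebesgue_measure_itv/= lte_fin ltxx.
have {}ab : a < b by rewrite lt_neqAle anb ab.
apply/eqP; rewrite eq_le; apply/andP; split.
  apply: (@le_trans _ _ (leb [set` Interval (BSide c a) (BSide d b)])).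
    by rewrite le_measure ?inE//; exact: measurableI.
  by rewrite lebesgue_measure_itv/= lte_fin ab EFinB.
apply: (@le_trans _ _ (leb `]a, b[)).
  by rewrite lebesgue_measure_itv/= lte_fin ab EFinB.
rewrite le_measure ?inE//; first exact: measurableI.
move=> x /=; rewrite !in_itv/= => /andP[ax xb]; split.
  by case: c; case: d => /=; rewrite ?ax ?xb ?(ltW ax) ?(ltW xb).
by rewrite (le_lt_trans a0 ax) (lt_le_trans xb bT).
Qed.

(** The indicator of [[y, x[] and its mean, as a constant function, each have norm at most
    [sqrt (x - y)]. This is the source of the Hoelder exponent 1/2 of primitives. *)
Lemma step_lip x y : 0 <= y -> y <= x -> x <= T -> `|step x - step y| <= 2 * Num.sqrt (x - y).
Proof.
move=> y0 yx xT.
have -> : step x - step y = toL2 T (\1_(`[y, x[ : set RM) : RM -> R) - ((x - y) / T) *: one.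
  have -> : step x - step y = (below x - below y) - ((x - y) / T) *: one.
    rewrite /step mulrBl scalerBl !opprB [_ *: one - below y]addrC addrACA.
    by congr (_ + _); rewrite addrC.
  congr (_ - _); rewrite /below -scaleN1r -toL2Z ?below_Lfun2// -toL2D ?below_Lfun2//; last first.
    by apply: Lfun2Z; exact: below_Lfun2.
  congr toL2; apply/funext => t /=; rewrite mulN1r !indicE !mem_setE !in_itv/=.
  have [yt|ty] := leP y t; rewrite ?subr0//=.
  by rewrite (lt_le_trans ty yx) subrr.
apply: le_trans (ler_normB _ _) _.
have d0 : 0 <= x - y by rewrite subr_ge0.
have dT : x - y <= T by lra.
have -> : 2 * Num.sqrt (x - y) = Num.sqrt (x - y) + Num.sqrt (x - y) by lra.
apply: lerD.
  rewrite -(@ler_pXn2r _ 2) ?nnegrE ?sqrtr_ge0// sqr_sqrtr//.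
  by rewrite -lee_fin indic_norm// mu_itv.
rewrite -(@ler_pXn2r _ 2) ?nnegrE ?sqrtr_ge0// sqr_sqrtr//.
rewrite normrZ exprMn real_normK ?num_real// -L2inner_norm L2inner_one_one.
rewrite expr_div_n expr2 [T ^+ 2]expr2 invfM -!mulrA mulVf ?gt_eqF// mulr1 ler_piMr//.
by rewrite ler_pdivrMr// mul1r.
Qed.

Definition prim_fun h (x : R) : R := L2inner h (step (clamp x)).

Lemma prim_fun_holder h x y : `|prim_fun h x - prim_fun h y| <= 2 * `|h| * Num.sqrt `|x - y|.
Proof.
wlog yx : x y / clamp y <= clamp x.
  move=> H; have [|/ltW] := leP (clamp y) (clamp x); first exact: H.
  by move=> /H; rewrite distrC (distrC y).
rewrite /prim_fun -L2innerBr; apply: le_trans (L2inner_CS _ _) _.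
rewrite (mulrC 2) -mulrA ler_wpM2l//.
have /andP[cy0 _] := clamp_itv y; have /andP[_ cxT] := clamp_itv x.
apply: le_trans (step_lip cy0 yx cxT) _.
rewrite ler_wpM2l// ler_sqrt//; apply: le_trans (clamp_lip x y); exact: ler_norm.
Qed.

Lemma holder_continuous (f : R -> R) (M : R) :
  (forall x y, `|f x - f y| <= M * Num.sqrt `|x - y|) -> continuous f.
Proof.
move=> fM x; apply/cvgrPdist_le => e e0.
pose d := (e / (`|M| + 1)) ^+ 2.
have d0 : 0 < d by rewrite exprn_gt0// divr_gt0 ?ltr_wpDl.
near=> y; apply: le_trans (fM _ _) _.
have xy : `|x - y| <= d by near: y; apply: cvgr_dist_le => //; exact: cvg_id.
apply: (@le_trans _ _ ((`|M| + 1) * (e / (`|M| + 1)))); last first.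
  by rewrite mulrC divfK// gt_eqF ?ltr_wpDl.
apply: (@le_trans _ _ (`|M| * Num.sqrt `|x - y|)).
  by rewrite ler_wpM2r ?sqrtr_ge0// ler_norm.
apply: ler_pM => //; first by rewrite lerDl.
rewrite -(@ler_pXn2r _ 2) ?nnegrE ?sqrtr_ge0//; first by rewrite sqr_sqrtr.
by rewrite divr_ge0 ?(ltW e0)// addr_ge0.
Unshelve. all: by end_near.
Qed.

Lemma prim_subproof h : prim_fun h \in C0_pred T.
Proof.
apply/mem_set; split; first exact: holder_continuous (prim_fun_holder h).
by move=> x /clamp_out[]; rewrite /prim_fun => ->; rewrite ?step0 ?stepT L2inner0r.
Qed.

Definition prim h : C0 := MkC0 (prim_subproof h).

Lemma primE h x : 0 <= x <= T -> prim h x = L2inner h (below x) - x / T * L2inner h one.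
Proof. by move=> xT; rewrite /= /prim_fun clampE// /step L2innerBr L2innerZr. Qed.

Lemma prim_linear (k : R) (a b : L2) : prim (k *: a + b) = k *: prim a + prim b.
Proof.
by apply/val_inj/funext => x /=; rewrite /prim_fun L2innerDl L2innerZl.
Qed.

Lemma prim_norm h : `|prim h| <= 2 * Num.sqrt T * `|h|.
Proof.
apply: C0_norm_le => [|x /andP[x0 xT]]; first by rewrite !mulr_ge0 ?sqrtr_ge0.
have := prim_fun_holder h x 0.
have -> : prim_fun h 0 = 0 by rewrite /prim_fun clampE ?lexx ?ltW// step0 L2inner0r.
rewrite subr0 => /le_trans; apply.
by rewrite mulrAC ler_wpM2r// ler_wpM2l// ler_sqrt ?ltW// subr0 gtr0_norm// ltW.
Qed.

End primitives.

Section interpolation.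
Context (R : realType) (T : R) (T0 : 0 < T).
Local Notation RM := (measurableTypeR R).
Local Notation L2 := (L2 T).
Local Notation C0 := (C0 T).
Local Notation prim := (prim T0).
Local Notation one := (one T).
Implicit Types (h : L2) (psi : C0).

Variable (n : nat).
Let N : R := n.+1%:R.
Let N0 : 0 < N. Proof. by rewrite ltr0n. Qed.

Definition node (i : nat) : R := i%:R * T / n.+1%:R.

(** Normalized to integral 1, so that the coefficients in [interp] are the increments of [psi]. *)
Definition cell (i : nat) : L2 := (N / T) *: toL2 T (\1_(`]node i, node i.+1[ : set RM) : RM -> R).

(* The primitive of [interp psi] is the piecewise affine interpolant of [psi]. *)
Definition interp psi : L2 := \sum_(i < n.+1) (psi (node i.+1) - psi (node i)) *: cell i.

Lemma nodeS i : node i.+1 = node i + T / N.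
Proof. by rewrite /node -natr1 mulrDl mul1r mulrDl. Qed.

Lemma node_le i j : (i <= j)%N -> node i <= node j.
Proof. by move=> ij; rewrite /node ler_pM2r ?invr_gt0// ler_pM2r// ler_nat. Qed.

Lemma node0 : node 0 = 0. Proof. by rewrite /node !mul0r. Qed.

Lemma nodeN : node n.+1 = T.
Proof. by rewrite /node mulrAC divff ?mul1r// pnatr_eq0. Qed.

Lemma node_itv i : (i <= n.+1)%N -> 0 <= node i <= T.
Proof. by move=> iN; rewrite -{1}node0 -nodeN !node_le. Qed.

Lemma cell_step i x : (i < n.+1)%N -> 0 <= x <= T ->
  L2inner (cell i) (below T x) =
  if x <= node i then 0 else if node i.+1 <= x then 1 else (N / T) * (x - node i).
Proof.
move=> iN /andP[x0 xT]; rewrite /cell L2innerZl L2inner_indic//.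
have /andP[i0 _] := node_itv (ltnW iN); have /andP[_ iT] := node_itv iN.
have ii : node i <= node i.+1 by rewrite node_le.
have [xi|ix] := leP x (node i).
  rewrite (_ : _ `&` _ = set0) ?measure0 ?mulr0//.
  apply/seteqP; split => // t /=; rewrite !in_itv/= => -[/andP[it _] tx].
  by have := lt_le_trans (lt_trans it tx) xi; rewrite ltxx.
have [ix1|xi1] := leP (node i.+1) x.
  rewrite (_ : _ `&` _ = `]node i, node i.+1[%classic).
    by rewrite mu_itv//= nodeS addrAC subrr add0r; field; rewrite !gt_eqF.
  apply/seteqP; split => t /=; rewrite !in_itv/=; first by case.
  by move=> /andP[it ti]; rewrite it ti (lt_le_trans ti).
rewrite (_ : _ `&` _ = `]node i, x[%classic); first by rewrite mu_itv//= ltW.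
apply/seteqP; split => t /=; rewrite !in_itv/=.
  by move=> [/andP[it _] ->]; rewrite it.
by move=> /andP[it tx]; rewrite it tx (lt_trans tx).
Qed.

Lemma cell_one i : (i < n.+1)%N -> L2inner (cell i) one = 1.
Proof.
move=> iN; rewrite -belowT cell_step// ?lexx ?(ltW T0)//.
have /andP[_ iT] := node_itv iN; rewrite iT leNgt (lt_le_trans _ iT)//.
by rewrite nodeS ltrDl divr_gt0.
Qed.

(** At a point of cell [j] the sum telescopes to [psi (node j)] plus a fraction of one increment,
    each causing an error at most [e]. The mean subtracted by [prim] is 0 because [psi] vanishes at
    both ends. *)
Lemma interp_err psi e :
  (forall x y, 0 <= x <= T -> 0 <= y <= T -> `|x - y| <= T / n.+1%:R -> `|psi x - psi y| <= e) ->
  `|psi - prim (interp psi)| <= 2 * e.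
Proof.
move=> osc.
have psi0 : psi 0 = 0 by apply: C0_out; rewrite ltxx.
have psiT : psi T = 0 by apply: C0_out; rewrite ltxx andbF.
have TN : 0 < T / N by rewrite divr_gt0.
have e0 : 0 <= e.
  apply: (le_trans (normr_ge0 (psi 0 - psi 0))); apply: osc; rewrite ?lexx ?(ltW T0)//.
  by rewrite subrr normr0 ltW.
apply: C0_norm_le => [|x /andP[x0 xT]]; first by rewrite mulr_ge0.
have xT' : 0 <= x <= T by rewrite !ltW.
have [j [jN jx xj]] : exists j, [/\ (j < n.+1)%N, node j <= x & x < node j.+1].
  have H : exists j, (node j.+1 > x) && (j <= n)%N.
    by exists n; rewrite nodeN xT leqnn.
  case: (ex_minnP H) => j /andP[xj jn] jmin; exists j; split => //.
  case: j => [|j] in xj jn jmin *; first by rewrite node0 ltW.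
  rewrite leNgt; apply/negP => xj'.
  by have := jmin j; rewrite xj' (ltnW jn) ltnn => /(_ isT).
pose d i := psi (node i.+1) - psi (node i).
have inner_sum (b : L2) : L2inner (interp psi) b = \sum_(i < n.+1) d i * L2inner (cell i) b.
  rewrite /interp; elim/big_rec2 : _ => [|i y z _ IH]; first by rewrite L2inner0l.
  by rewrite L2innerDl L2innerZl IH.
have tel m : \sum_(i < m) d i = psi (node m).
  by rewrite -(big_mkord xpredT d) telescope_sumr// node0 psi0 subr0.
have -> : (psi - prim (interp psi)) x = psi x - prim (interp psi) x by [].
rewrite primE// !inner_sum.
have -> : \sum_(i < n.+1) d i * L2inner (cell i) one = 0.
  under eq_bigr => i _ do rewrite cell_one// mulr1.
  by rewrite tel nodeN psiT.
rewrite mulr0 subr0.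
have -> : \sum_(i < n.+1) d i * L2inner (cell i) (below T x) =
    psi (node j) + d j * L2inner (cell j) (below T x).
  rewrite -(big_mkord xpredT (fun i => d i * L2inner (cell i) (below T x))).
  rewrite (big_cat_nat (n := j)) //=; last exact: ltnW.
  rewrite [X in _ + X]big_ltn// (_ : \sum_(j.+1 <= i < n.+1) _ = 0) ?addr0.
    congr (_ + _); rewrite -(tel j) -(big_mkord xpredT d) big_nat [RHS]big_nat.
    apply: eq_bigr => i /andP[_ ij]; rewrite cell_step//; last exact: ltn_trans jN.
    have ijx : node i.+1 <= x by apply: le_trans jx; exact: node_le.
    by rewrite ijx ifF ?mulr1//; apply/negbTE; rewrite -ltNge (lt_le_trans _ ijx)// nodeS ltrDl.
  rewrite big_nat big1// => i /andP[ji iN]; rewrite cell_step//.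
  by rewrite ifT ?mulr0// (le_trans (ltW xj))// node_le.
have cj : 0 <= L2inner (cell j) (below T x) <= 1.
  rewrite cell_step//; case: (leP x (node j)) => xj1; first by rewrite lexx ler01.
  rewrite [node j.+1 <= x]leNgt xj/= mulr_ge0 ?divr_ge0 ?subr_ge0// ?(ltW N0) ?(ltW T0)//=.
  rewrite -(@ler_pM2l _ (T / N))// mulrA (_ : T / N * (N / T) = 1) ?mul1r ?mulr1.
    by rewrite lerBlDl -nodeS ltW.
  by field; rewrite !gt_eqF.
have nj := node_itv (ltnW jN); have nj1 := node_itv jN.
rewrite opprD addrA (le_trans (ler_normB _ _))//.
have -> : 2 * e = e + e by ring.
apply: lerD.
  apply: osc => //; rewrite ger0_norm ?subr_ge0//.
  by rewrite lerBlDl -nodeS ltW.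
rewrite normrM; move/andP : cj => [c0 c1]; rewrite (ger0_norm c0).
apply: (@le_trans _ _ `|d j|); first by rewrite ler_piMr.
apply: osc => //; rewrite nodeS addrAC subrr add0r gtr0_norm//.
Qed.

End interpolation.

(** * Functions of bounded variation and weak* compactness *)

Section weak_derivatives.
Context (R : realType) (T : R) (T0 : 0 < T).
Local Notation mu := (leb0T T).
Local Notation RM := (measurableTypeR R).
Local Notation leb := (@lebesgue_measure R).
Local Notation L2 := (L2 T).
Local Notation C0 := (C0 T).
Local Notation prim := (prim T0).
Local Notation one := (one T).
Implicit Types (h : L2) (psi : C0).

(* The primitives of square integrable functions are dense in C_0(0,T). *)
Lemma functional_prim_eq (D E : C0 -> R) : bounded_functional D -> bounded_functional E ->
  (forall h, D (prim h) = E (prim h)) -> D =1 E.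
Proof.
move=> bD bE DE psi.
have [C C0' DC] := bounded_functional_bound bD.
have [C' C'0 EC] := bounded_functional_bound bE.
apply/eqP; rewrite -subr_eq0 -normr_le0; apply/ler_addgt0Pr => e e0; rewrite add0r.
pose e' := e / (2 * (C + C' + 1)).
have CC : 0 < 2 * (C + C' + 1) by rewrite mulr_gt0// ltr_wpDl// addr_ge0.
have e'0 : 0 < e' by rewrite divr_gt0.
have [d d0 Hd] := unif_continuous_segment 0 T (@C0_continuous _ _ psi) e'0.
pose n := Num.trunc (T / d).
have nT : T / n.+1%:R <= d.
  rewrite ler_pdivrMr ?ltr0n// mulrC -ler_pdivrMr// ltW//.
  by have /andP[] := trunc_itv (divr_ge0 (ltW T0) (ltW d0)).
have err : `|psi - prim (interp n psi)| <= 2 * e'.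
  by apply: interp_err => x y xT yT xy; apply: Hd => //; exact: le_trans nT.
have -> : D psi - E psi = D (psi - prim (interp n psi)) - E (psi - prim (interp n psi)).
  by rewrite (bounded_functionalB bD) (bounded_functionalB bE) DE opprB addrA subrK.
rewrite (le_trans (ler_normB _ _))//.
apply: (@le_trans _ _ ((C + C') * (2 * e'))).
  rewrite mulrDl; apply: lerD.
    by apply: le_trans (DC _) _; rewrite ler_wpM2l.
  by apply: le_trans (EC _) _; rewrite ler_wpM2l.
rewrite /e' -[leRHS]mulr1 (_ : _ * (2 * _) = e * ((C + C') / (C + C' + 1))).
  rewrite ler_wpM2l ?(ltW e0)// ler_pdivrMr ?mul1r ?lerDl//.
  by rewrite ltr_wpDl// addr_ge0.
by field; rewrite gt_eqF// ltr_wpDl// addr_ge0.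
Qed.

Lemma continuous_linear_functional (V : normedModType R) (m : {linear V -> R}) :
  continuous m -> bounded_functional m.
Proof.
move=> cm; split; first by move=> k a b; rewrite linearP.
have := @continuous_linear_bounded _ _ _ 0 m (cm 0).
move/linear_boundedP => [M [_ HM]]; exists (M + 1) => a; apply: HM.
by rewrite ltrDl.
Qed.

Lemma functional_continuous_linear (V : normedModType R) (F : V -> R) :
  bounded_functional F -> exists m : {linear V -> R}, m =1 F /\ continuous m.
Proof.
move=> bF.
have lF : linear F by move=> k a b; rewrite bF.1.
pose mL := GRing.isLinear.Build R V R _ F lF.
pose m : {linear V -> R} := HB.pack F mL.
exists m; split => //; apply: bounded_linear_continuous.
have [C C0' FC] := bounded_functional_bound bF.
apply/linear_boundedP; exists C; split; first by rewrite num_real.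
by move=> M CM a /=; apply: le_trans (FC a) _; rewrite ler_wpM2r// ltW.
Qed.

Lemma test_function_continuous (phi : R -> R) : test_function T phi -> continuous (derive1 phi).
Proof.
move=> [dphi _] x; apply: differentiable_continuous; apply/derivable1_diffP.
by rewrite -derive1n1.
Qed.

Lemma test_function_bounded (phi : R -> R) : test_function T phi ->
  exists M, forall x, 0 < x < T -> `|derive1 phi x| <= M.
Proof.
move=> tphi; have [|c _ cmax] := @EVT_max _ (fun x => `|derive1 phi x|) 0 T (ltW T0).
  apply: continuous_subspaceT => x.
  by apply: continuous_comp; [exact: test_function_continuous|exact: norm_continuous].
exists `|derive1 phi c| => x /andP[x0 xT]; apply: cmax.
by rewrite in_itv/= !ltW.
Qed.

Lemma test_function_Lfun2 (phi : R -> R) : test_function T phi ->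
  (derive1 phi : RM -> R) \in Lfun mu 2%:E.
Proof.
move=> tphi; have [M phiM] := test_function_bounded tphi.
apply: (bounded_Lfun2 (M := M)) => //.
by apply: continuous_measurable; exact: test_function_continuous.
Qed.

Lemma Rintegral_FTC2 (F f : R -> R) a b : a <= b -> continuous f ->
  (forall x : R, is_derive x 1 F (f x)) -> \int[leb]_(x in `[a, b]) f x = F b - F a.
Proof.
rewrite le_eqVlt => /predU1P[->|ab] cf dF.
  by rewrite set_itv1 Rintegral_set1 subrr.
have cF : continuous F.
  by move=> x; apply: differentiable_continuous; apply/derivable1_diffP; case: (dF x).
rewrite /Rintegral (@continuous_FTC2 _ f F)//.
- exact: continuous_subspaceT.
- split => [x _||]; first by case: (dF x).
  + by apply: cvg_at_right_filter; exact: cF.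
  + by apply: cvg_at_left_filter; exact: cF.
- by move=> x _; rewrite (derive1_is dF).
Qed.

(** The fundamental theorem of calculus; the mean subtracted by [prim] is 0 since [phi] vanishes at
    [T]. *)
Lemma test_function_primitive (phi : C0) : test_function T phi ->
  prim (toL2 T (derive1 phi)) = phi.
Proof.
move=> tphi; have fl := test_function_Lfun2 tphi.
have dphi (x : R) : is_derive x 1 phi (derive1 phi x).
  by apply: derivable_is; have [/(_ 0%N x)] := tphi; rewrite derive1n0.
have md := Lfun_measurable fl.
have phi0 : phi 0 = 0 by apply: C0_out; rewrite ltxx.
have phiT : phi T = 0 by apply: C0_out; rewrite ltxx andbF.
have I x : 0 <= x <= T -> L2inner (toL2 T (derive1 phi)) (below T x) = phi x.
  move=> /andP[x0 xT]; rewrite L2inner_toL2//; last exact: below_Lfun2.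
  rewrite Rintegral_leb0T; last by apply: measurable_funM => //; exact: Lfun_measurable (below_Lfun2 T x).
  rewrite -[RHS]subr0 -[X in _ - X]phi0 -(Rintegral_FTC2 x0 (test_function_continuous tphi) dphi).
  have di : leb.-integrable setT (EFin \o (derive1 phi : RM -> R)).
    have [_ [a [b [_ _ ab]]]] := tphi.
    apply: (@compactly_supported_integrable _ _ a b); first exact: test_function_continuous.
    move=> y yab; rewrite derive1E -(near_eq_derive (f := cst 0)); first exact: derive_cst.
    have [ya|ay] := ltP y a.
      near=> z; rewrite ab//; apply/negP; rewrite negb_and -ltNge.
      by have -> : z < a by near: z; exact: lt_nbhsl.
    have yb : b < y by rewrite ltNge; apply/negP => yb; apply: yab; rewrite ay yb.
    near=> z; rewrite ab//; apply/negP; rewrite negb_and -!ltNge orbC.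
    by have -> : b < z by near: z; exact: lt_nbhsr.
  rewrite -Rintegral_itv_obnd_cbnd; last by apply: integrableS di.
  rewrite -Rintegral_itv_bndo_bndc; last by apply: integrableS di.
  rewrite Rintegral_mkcond [RHS]Rintegral_mkcond; apply: eq_Rintegral => t _.
  rewrite !patchE indicE !mem_setE !in_itv/=.
  have [t0|t0] := ltP 0 t => //=; have [tx|tx] := ltP t x; rewrite ?mulr0 ?if_same// mulr1.
  by rewrite (lt_le_trans tx xT).
apply/val_inj/funext => x; rewrite -[LHS]/(prim (toL2 T (derive1 phi)) x) -[RHS]/(phi x).
have [xT|/negP xT] := boolP (0 < x < T); last by rewrite !C0_out.
have xT' : 0 <= x <= T by case/andP : xT => *; rewrite !ltW.
by rewrite [LHS](primE T0 _ xT') -belowT !I ?lexx ?(ltW T0)// phiT mulr0 subr0.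
Unshelve. all: by end_near.
Qed.

Lemma prim_one : prim one = 0.
Proof.
apply/val_inj/funext => x; rewrite -[LHS]/(prim one x) -[RHS]/(0 : R).
have [xT|/negP xT] := boolP (0 < x < T); last by rewrite C0_out.
have /andP[x0 xT1] : 0 <= x <= T by case/andP : xT => *; rewrite !ltW.
rewrite (primE T0 _ (introT andP (conj x0 xT1))) L2inner_one_one// divfK ?gt_eqF//.
rewrite oneE L2inner_indic// setTI.
have -> : mu `]-oo, x[ = mu `]0, x[.
  rewrite /leb0T /mrestr; congr (leb _); apply/seteqP; split => t /=; rewrite !in_itv/=.
    by move=> [-> /andP[-> ->]].
  by move=> [/andP[_ ->] ->].
by rewrite mu_itv// subr0 subrr.
Qed.

Lemma Lfun2_ae (f g : RM -> R) : measurable_fun setT f -> g \in Lfun mu 2%:E ->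
  f = g %[ae mu] -> f \in Lfun mu 2%:E.
Proof.
move=> mf /Lfun2P[mg gi] fg; apply/Lfun2P; split => //.
have mf2 : measurable_fun setT (fun x => f x ^+ 2) by exact: measurable_funX.
have mg2 : measurable_fun setT (fun x => g x ^+ 2) by exact: measurable_funX.
apply/integrableP; split; first exact/measurable_EFinP.
case/integrableP : gi => _; apply: le_lt_trans; rewrite le_eqVlt; apply/orP; left; apply/eqP.
apply: ae_eq_integral => //.
- by apply: measurableT_comp => //; exact/measurable_EFinP.
- by apply: measurableT_comp => //; exact/measurable_EFinP.
- by apply: filterS fg => x /(_ I) /= -> _.
Qed.

(* The functional [h |-> m (prim h)] is bounded on L^2, so it is represented   *)
(* by some [g]; by du Bois-Reymond [u + g] is constant.                        *)
Lemma weak_derivative_prim (u : RM -> R) (m : {linear C0 -> R}) :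
  u \in Lfun mu 1 -> continuous m -> is_weak_derivative u m ->
  u \in Lfun mu 2%:E /\
  forall h, m (prim h) = - L2inner (toL2 T u) h + L2inner (toL2 T u) one / T * L2inner h one.
Proof.
move=> ul cm um; have mu_ := Lfun_measurable ul.
have bm := continuous_linear_functional cm.
have [C C0' mC] := bounded_functional_bound bm.
have bF : bounded_functional (fun h => m (prim h)).
  split; first by move=> k a b; rewrite prim_linear linearP.
  exists (C * (2 * Num.sqrt T)) => h; apply: le_trans (mC _) _.
  by rewrite -mulrA ler_wpM2l// prim_norm.
have [g Fg] := L2_Riesz bF.
have gl := L2_Lfun g; have gl1 := Lfun2_Lfun1 gl.
have [c uc] : exists c, (u \+ (g : RM -> R)) = cst c %[ae mu].
  apply: du_Bois_Reymond => //; first exact: Lfun1D.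
  move=> phi tphi; have [M phiM] := test_function_bounded tphi.
  have dl := test_function_Lfun2 tphi; have md := Lfun_measurable dl.
  under eq_Rintegral do rewrite /= mulrDl.
  rewrite Lfun1_RintegralD; [|exact: (Lfun1M (M := M))..].
  rewrite -(L2inner_toL2r g dl) -Fg test_function_primitive// um//.
  by rewrite addrN.
have u2 : u \in Lfun mu 2%:E.
  apply: (@Lfun2_ae _ (cst c \+ (fun x => -1 * g x))) => //.
    by apply: Lfun2D; [exact: cst_Lfun2|exact: Lfun2Z].
  by apply: filterS uc => x /(_ I) /= <- _; rewrite mulN1r addrK.
split => //.
have gE : g = c *: one - toL2 T u.
  rewrite -[LHS]toL2_coe /one -toL2Z ?cst_Lfun2// -scaleN1r -toL2Z// -toL2D ?Lfun2Z ?cst_Lfun2//.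
  apply: eq_toL2 => //; first by apply: Lfun2D; apply: Lfun2Z => //; exact: cst_Lfun2.
  by apply: filterS uc => x /(_ I) /= E _; rewrite /cst mulr1 -E; ring.
(* Testing with [one], whose primitive is 0, identifies [c] as the mean of [u]. *)
have cE : L2inner (toL2 T u) one = c * T.
  have := Fg one; rewrite prim_one linear0 gE L2innerBl L2innerZl L2inner_one_one//.
  by move=> /esym/eqP; rewrite subr_eq0 => /eqP ->.
move=> h; rewrite Fg gE L2innerBl L2innerZl cE mulfK ?gt_eqF//.
by rewrite (L2innerC h) addrC.
Qed.

Lemma weak_derivative_unique (u : RM -> R) (m m' : {linear C0 -> R}) :
  u \in Lfun mu 1 -> continuous m -> continuous m' ->
  is_weak_derivative u m -> is_weak_derivative u m' -> m =1 m'.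
Proof.
move=> ul cm cm' um um'; apply: functional_prim_eq; try exact: continuous_linear_functional.
move=> h; have [_ ->] := weak_derivative_prim ul cm um.
by have [_ ->] := weak_derivative_prim ul cm' um'.
Qed.

Lemma BVDP (u : BV T) : continuous (BVD u) /\ is_weak_derivative u (BVD u).
Proof.
have [_ [m [cm um]]] := BVP u.
by have := @getPex _ [set m : {linear C0 -> R} | continuous m /\ is_weak_derivative u m]; apply; exists m.
Qed.

Lemma BVD_bounded (u : BV T) : bounded_functional (BVD u).
Proof. by apply: continuous_linear_functional; have [] := BVDP u. Qed.

Lemma BV_Lfun1 (u : BV T) : (u : RM -> R) \in Lfun mu 1.
Proof. by have [] := BVP u. Qed.

Lemma BVD_unique (u : BV T) (m : {linear C0 -> R}) :
  continuous m -> is_weak_derivative u m -> BVD u =1 m.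
Proof.
move=> cm um; have [cD uD] := BVDP u.
exact: (weak_derivative_unique (BV_Lfun1 u)).
Qed.

Lemma BV_Lfun2 (u : BV T) : (u : RM -> R) \in Lfun mu 2%:E.
Proof. by have [cD uD] := BVDP u; have [] := weak_derivative_prim (BV_Lfun1 u) cD uD. Qed.

Lemma BVD_prim (u : BV T) h :
  BVD u (prim h) = - L2inner (toL2 T u) h + L2inner (toL2 T u) one / T * L2inner h one.
Proof. by have [cD uD] := BVDP u; have [_] := weak_derivative_prim (BV_Lfun1 u) cD uD. Qed.

End weak_derivatives.

Section dual_norm.
Context (R : realType) (T : R).
Local Notation C0 := (C0 T).
Implicit Types (D : C0 -> R).

Lemma dualnorm_ge0 D : 0 <= dualnorm D.
Proof.
rewrite /dualnorm; set A := (X in sup X).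
have [->|/set0P[y Ay]] := eqVneq A set0; first by rewrite sup0.
(* By convention the supremum of an unbounded set is 0. *)
have [ubA|nA] := pselect (has_ubound A); last by rewrite sup_out// => -[_].
by apply: (le_trans _ (ub_le_sup ubA Ay)); case: Ay => z _ <-.
Qed.

Lemma le_dualnorm D psi : bounded_functional D -> `|D psi| <= dualnorm D * `|psi|.
Proof.
move=> bD; have [C C0' DC] := bounded_functional_bound bD.
have [->|p0] := eqVneq psi 0; first by rewrite (bounded_functional0 bD) !normr0 mulr0.
have pp : 0 < `|psi| by rewrite normr_gt0.
rewrite -ler_pdivrMr//.
have -> : `|D psi| / `|psi| = `|D (`|psi|^-1 *: psi)|.
  by rewrite (bounded_functionalZ bD) normrM normfV normr_id mulrC.
apply: ub_le_sup.
  exists C => y [z /= z1 <-]; apply: (le_trans (DC z)); by rewrite ler_piMr.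
by exists (`|psi|^-1 *: psi) => //=; rewrite normrZ normfV normr_id mulVf ?gt_eqF.
Qed.

Lemma dualnorm_le D M : 0 <= M -> (forall psi, `|D psi| <= M * `|psi|) -> dualnorm D <= M.
Proof.
move=> M0 DM; rewrite /dualnorm; set A := (X in sup X).
have [->|/set0P A0] := eqVneq A set0; first by rewrite sup0.
apply: ge_sup => // y [z /= z1 <-]; apply: (le_trans (DM z)).
by rewrite ler_piMr.
Qed.

End dual_norm.

Section compactness.
Context (R : realType) (T : R) (T0 : 0 < T).
Local Notation mu := (leb0T T).
Local Notation RM := (measurableTypeR R).
Local Notation L2 := (L2 T).
Local Notation C0 := (C0 T).
Local Notation prim := (prim T0).
Local Notation one := (one T).
Implicit Types (h a : L2) (psi : C0).

Lemma C0_Lfun2 psi : (psi : RM -> R) \in Lfun mu 2%:E.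
Proof.
apply: (bounded_Lfun2 (M := `|psi|)); first exact: C0_measurable.
by move=> x _; exact: C0_le_norm.
Qed.

(** Derivatives do not see constants, and the constant 1 is not in C_0(0,T). Pairing with one fixed
    [eta] of nonzero integral controls the mean under weak* convergence. *)
Lemma C0_integral_neq0 : exists eta : C0, L2inner (toL2 T eta) one != 0.
Proof.
have T1 : 0 < T := T0.
have a0 : 0 < T / 4 by lra.
have ab : T / 4 < 3 * T / 4 by lra.
have bT : 3 * T / 4 < T by lra.
have [n In] := exists_bump_integral a0 ab bT.
have bP : bump (T / 4) (3 * T / 4) n \in C0_pred T.
  apply/mem_set; split; first exact: Cn_continuous (Cn_bump 0 _ _ _).
  move=> x xT; apply: bump_out; apply: contra_not xT => /andP[ax xb].
  by rewrite (lt_trans a0 ax) (lt_trans xb bT).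
exists (MkC0 bP); apply: contra_neq In => <-.
rewrite L2inner_toL2; [|exact: C0_Lfun2|exact: cst_Lfun2].
by apply: eq_Rintegral => x _; rewrite /cst mulr1.
Qed.

(* Data (a, D) related as the class of a function of bounded variation and its *)
(* derivative.                                                                 *)
Definition weak_pair (a : L2) (D : C0 -> R) :=
  bounded_functional D /\
  forall h, D (prim h) = - L2inner a h + L2inner a one / T * L2inner h one.

Lemma BV_weak_pair (u : BV T) : weak_pair (toL2 T u) (BVD u).
Proof. by split; [exact: BVD_bounded|exact: BVD_prim]. Qed.

Lemma weak_pairB a D a' D' : weak_pair a D -> weak_pair a' D' ->
  weak_pair (a - a') (fun psi => D psi - D' psi).
Proof.
move=> [bD aD] [bD' aD']; split.
  split; first by move=> k x y; rewrite bD.1 bD'.1; ring.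
  have [C _ HC] := bounded_functional_bound bD.
  have [C' _ HC'] := bounded_functional_bound bD'.
  by exists (C + C') => x; rewrite (le_trans (ler_normB _ _))// mulrDl lerD.
by move=> h; rewrite aD aD' !L2innerBl; ring.
Qed.

Section fixed_weight.
Variables (eta : C0) (eta_neq0 : L2inner (toL2 T eta) one != 0).
Local Notation E := (L2inner (toL2 T eta) one).

(** The defining formula at [h = eta], solved for the mean. *)
Lemma weak_pair_mean a D : weak_pair a D ->
  L2inner a one / T = (L2inner a (toL2 T eta) + D (prim (toL2 T eta))) / E.
Proof. by move=> [_ ->]; rewrite addrA addrN add0r mulfK. Qed.

(** A Poincare inequality: [h = a] in the formula expresses [|a|^2] by [D (prim a)] and the mean,
    which [weak_pair_mean] bounds; then divide by [|a|]. *)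
Lemma weak_pair_bound : exists2 K, 0 <= K & forall a D, weak_pair a D ->
  `|a| <= K * (`|L2inner a (toL2 T eta)| + dualnorm D).
Proof.
pose P := 2 * Num.sqrt T.
have P0 : 0 <= P by rewrite mulr_ge0 ?sqrtr_ge0.
pose Q := `|one| / `|E|; have Q0 : 0 <= Q by rewrite divr_ge0.
exists (P + Q * (1 + P * `|toL2 T eta|)).
  by rewrite addr_ge0// mulr_ge0// addr_ge0// mulr_ge0.
move=> a D aD; have [bD aDh] := aD.
have [->|a0] := eqVneq a 0.
  rewrite normr0 mulr_ge0//; last by rewrite addr_ge0// dualnorm_ge0.
  by rewrite addr_ge0// mulr_ge0// addr_ge0// mulr_ge0.
have ap : 0 < `|a| by rewrite normr_gt0.
rewrite -(ler_pM2r ap) -expr2 -L2inner_norm.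
have -> : L2inner a a = - D (prim a) + L2inner a one / T * L2inner a one by rewrite aDh; ring.
have dn0 := dualnorm_ge0 D.
have Dp h : `|D (prim h)| <= dualnorm D * (P * `|h|).
  by apply: (le_trans (le_dualnorm _ bD)); rewrite ler_wpM2l// prim_norm.
apply: (le_trans (ler_norm _)); apply: (le_trans (ler_normD _ _)).
rewrite normrN (weak_pair_mean aD) normrM normrM normfV.
have H1 := Dp a; have H2 := Dp (toL2 T eta); have H3 := L2inner_CS a one.
set x := `|L2inner a (toL2 T eta)| in H2 *.
have H4 : `|L2inner a (toL2 T eta) + D (prim (toL2 T eta))| <= x + dualnorm D * (P * `|toL2 T eta|).
  by apply: (le_trans (ler_normD _ _)); rewrite lerD.
have x0 : 0 <= x by exact: normr_ge0.
have H5 : `|L2inner a (toL2 T eta) + D (prim (toL2 T eta))| / `|E| * `|L2inner a one| <=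
    (x + dualnorm D * (P * `|toL2 T eta|)) / `|E| * (`|a| * `|one|).
  by apply: ler_pM => //; rewrite ?divr_ge0// ler_wpM2r// invr_ge0.
apply: (le_trans (lerD H1 H5)).
have -> : (x + dualnorm D * (P * `|toL2 T eta|)) / `|E| * (`|a| * `|one|) =
    Q * (x + dualnorm D * (P * `|toL2 T eta|)) * `|a| by rewrite /Q; ring.
rewrite (_ : dualnorm D * (P * `|a|) = P * dualnorm D * `|a|); last by ring.
rewrite -mulrDl ler_wpM2r ?(ltW ap)//.
set t := `|toL2 T eta|; have t0 : 0 <= t by exact: normr_ge0.
rewrite -subr_ge0.
have -> : (P + Q * (1 + P * t)) * (x + dualnorm D) - (P * dualnorm D + Q * (x + dualnorm D * (P * t)))
  = P * x + Q * (P * t) * x + Q * dualnorm D by ring.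
by rewrite !addr_ge0// !mulr_ge0.
Qed.

(* Primitives of square integrable functions form a compact subset of          *)
(* C_0(0,T): they are uniformly approximated by their interpolants, on which   *)
(* weak* convergence of the derivatives is tested by finitely many functions.  *)
Lemma weak_pair_strong_cvg (F : set_system nat) (FF : ProperFilter F)
    (a : nat -> L2) (D : nat -> C0 -> R) (K : R) :
  (forall k, weak_pair (a k) (D k)) -> (forall k, dualnorm (D k) <= K) ->
  L2inner (a k) (toL2 T eta) @[k --> F] --> 0 ->
  (forall psi, D k psi @[k --> F] --> 0) ->
  `|a k| @[k --> F] --> 0.
Proof.
move=> aD DK aeta D0.
pose c k := L2inner (a k) one / T.
have c0 : c k @[k --> F] --> 0.
  rewrite (_ : c = fun k => (L2inner (a k) (toL2 T eta) + D k (prim (toL2 T eta))) / E); last first.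
    by apply/funext => k; exact: weak_pair_mean.
  have : (L2inner (a k) (toL2 T eta) + D k (prim (toL2 T eta))) / E @[k --> F] --> (0 + 0) / E.
    by apply: cvgMl; apply: cvgD => //; exact: D0.
  by rewrite addr0 mul0r.
have K0 : 0 <= K by apply: le_trans (DK 0%N); exact: dualnorm_ge0.
pose S n k := \sum_(i < n.+1) `|D k (prim (cell T n i))|.
have S0 n : S n k @[k --> F] --> 0.
  suff H : forall r : seq 'I_n.+1, \sum_(i <- r) `|D k (prim (cell T n i))| @[k --> F] --> 0.
    exact: H.
  elim=> [|i r IH].
    by rewrite (_ : (fun k => _) = cst 0); [exact: cvg_cst|apply/funext => k; rewrite big_nil].
  rewrite (_ : (fun k => _) = fun k => `|D k (prim (cell T n i))| +
      \sum_(i <- r) `|D k (prim (cell T n i))|); last by apply/funext => k; rewrite big_cons.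
  have : `|D k (prim (cell T n i))| + \sum_(i <- r) `|D k (prim (cell T n i))| @[k --> F]
      --> `|0 : R| + 0 by apply: cvgD => //; apply: cvg_norm.
  by rewrite normr0 addr0.
(* With [h = a k], [|a k|^2 = - D (prim (a k)) + T c^2]. Replacing the primitive by its interpolant
   costs [O(sqrt (T / n.+1))], and the interpolant is a combination of the [n.+1] fixed functions in
   [S]. *)
have main n k : `|a k| ^+ 2 <=
    `|a k| * (4 * K * Num.sqrt (T / n.+1%:R) + 4 * Num.sqrt T * S n k) + T * c k ^+ 2.
  have [bD aDh] := aD k.
  rewrite -L2inner_norm.
  have -> : L2inner (a k) (a k) = - D k (prim (a k)) + T * c k ^+ 2.
    by rewrite aDh /c; field; rewrite gt_eqF.
  rewrite lerD2r; apply: (le_trans (ler_norm _)); rewrite normrN.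
  set psi := prim (a k); pose q := interp n psi.
  rewrite (_ : D k psi = D k (psi - prim q) + D k (prim q)); last first.
    by rewrite (bounded_functionalB bD) subrK.
  apply: (le_trans (ler_normD _ _)); rewrite mulrDr; apply: lerD.
    apply: (le_trans (le_dualnorm _ bD)).
    have err : `|psi - prim q| <= 2 * (2 * `|a k| * Num.sqrt (T / n.+1%:R)).
      apply: interp_err => x y _ _ xy; apply: (le_trans (prim_fun_holder T0 _ _ _)).
      by rewrite ler_wpM2l ?mulr_ge0// ler_sqrt// divr_ge0 ?(ltW T0).
    apply: (le_trans (ler_pM (dualnorm_ge0 _) (normr_ge0 _) (DK k) err)).
    by rewrite le_eqVlt; apply/orP; left; apply/eqP; ring.
  have -> : D k (prim q) = \sum_(i < n.+1) (psi (node T n i.+1) - psi (node T n i)) * D k (prim (cell T n i)).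
    rewrite /q /interp; elim/big_rec2 : _ => [|i y z _ IH].
      have -> : prim 0 = 0 by have := prim_linear T0 (-1) 0 0; rewrite scaler0 addr0 scaleN1r addNr.
      exact: bounded_functional0 bD.
    by rewrite prim_linear bD.1 IH.
  apply: (le_trans (ler_norm_sum _ _ _)).
  rewrite /S mulrA mulr_sumr; apply: ler_sum => i _; rewrite normrM ler_wpM2r//.
  have pb x : `|psi x| <= 2 * Num.sqrt T * `|a k|.
    by apply: (le_trans (C0_le_norm psi x)); exact: prim_norm.
  apply: (le_trans (ler_normB _ _)); apply: (le_trans (lerD (pb _) (pb _))).
  by rewrite le_eqVlt; apply/orP; left; apply/eqP; ring.
apply/cvgrPdist_le => e e0.
have [n Hn] : exists n, 4 * K * Num.sqrt (T / n.+1%:R) <= e / 4.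
  pose r := (e / 4 / (4 * K + 1)) ^+ 2.
  have KK : 0 < 4 * K + 1 by rewrite ltr_wpDl// mulr_ge0.
  have r0 : 0 < r by rewrite exprn_gt0// !divr_gt0.
  exists (Num.trunc (T / r)).
  have nT : T / (Num.trunc (T / r)).+1%:R <= r.
    rewrite ler_pdivrMr ?ltr0n// mulrC -ler_pdivrMr// ltW//.
    by have /andP[] := trunc_itv (divr_ge0 (ltW T0) (ltW r0)).
  apply: (@le_trans _ _ (4 * K * (e / 4 / (4 * K + 1)))).
    rewrite ler_wpM2l ?mulr_ge0//.
    rewrite -(@ler_pXn2r _ 2) ?nnegrE ?sqrtr_ge0//; last by rewrite !divr_ge0 ?(ltW e0) ?(ltW KK).
    by rewrite sqr_sqrtr// divr_ge0 ?(ltW T0).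
  rewrite mulrCA ler_piMr ?divr_ge0 ?(ltW e0)// ler_pdivrMr// mul1r lerDl//.
have sT : 0 < 4 * Num.sqrt T by rewrite mulr_gt0// sqrtr_gt0.
have h1 : 0 < e / 4 / (4 * Num.sqrt T) by rewrite !divr_gt0.
have h2 : 0 < e / 4 / T by rewrite !divr_gt0.
have h3 : T * c k ^+ 2 @[k --> F] --> 0.
  have : T * (c k * c k) @[k --> F] --> T * (0 * 0) by apply: cvgMr; apply: cvgM.
  by rewrite !mulr0; under eq_fun do rewrite -expr2.
have h4 : 0 < e * e / 4 by rewrite divr_gt0// mulr_gt0.
move/cvgrPdist_le : (S0 n) => /(_ _ h1) HS; move/cvgrPdist_le : h3 => /(_ _ h4) Hc.
near=> k; rewrite sub0r normrN normr_id.
have Sk : S n k <= e / 4 / (4 * Num.sqrt T).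
  rewrite (le_trans (ler_norm _))// -normrN -sub0r; near: k; exact: HS.
have ck : T * c k ^+ 2 <= e * e / 4.
  rewrite (le_trans (ler_norm _))// -normrN -sub0r; near: k; exact: Hc.
move: Sk; rewrite ler_pdivlMr// mulrC => Sk.
have := main n k; move: ck Sk Hn.
set x := `|a k|; set A := T * _; set B := 4 * _ * S n k; set C := 4 * K * _ => cA cB cC H.
have x0 : 0 <= x by exact: normr_ge0.
(* If [e < x], then [x^2 <= x e / 2 + e^2 / 4 < x^2]. *)
rewrite leNgt; apply/negP => ex.
have : x * (C + B) <= x * (e / 2) by rewrite ler_wpM2l//; lra.
have : e * e <= x * e by rewrite ler_wpM2r// ltW.
have : x * e < x ^+ 2 by rewrite expr2 ltr_pM2l// (lt_trans e0).
lra.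
Unshelve. all: by end_near.
Qed.

End fixed_weight.

(** Banach-Alaoglu along an ultrafilter: the pointwise limits inherit linearity and the bound. *)
Lemma ultralimit_functional (V : normedModType R) (U : set_system nat)
    (F : nat -> V -> R) (K : R) : UltraFilter U -> (forall k, bounded_functional (F k)) ->
  (forall k x, `|F k x| <= K * `|x|) ->
  exists2 G : V -> R, bounded_functional G & forall x, F k x @[k --> U] --> G x.
Proof.
move=> UU bF FK; have PU := @ultra_proper _ U UU.
have /choice[G FG] x : exists l : R, F k x @[k --> U] --> l.
  exact: (ultra_cvg_bounded UU (fun k => FK k x)).
exists G => //; split.
  move=> k x y; apply: (cvg_unique (@Rhausdorff R) (FG _)).
  rewrite (_ : (fun j => _) = (fun j => k * F j x + F j y)); last first.
    by apply/funext => j; rewrite (bF j).1.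
  by apply: cvgD => //; apply: cvgMr.
exists K => x; apply: (cvgr_to_le (cvg_norm (FG x))).
by apply: nearW => k; exact: FK.
Qed.

(** Functions and derivatives have limits separately, the former represented by [L2_Riesz]; the
    defining relation between them passes to the limit on each test function. *)
Lemma BV_weak_compactness (U : set_system nat) (w : nat -> BV T) (eta : C0) (M : R) :
  UltraFilter U -> L2inner (toL2 T eta) one != 0 ->
  (forall k, `|L2inner (toL2 T (w k)) (toL2 T eta)| <= M) ->
  (forall k, dualnorm (BVD (w k)) <= M) ->
  exists wbar : BV T,
    (forall h, L2inner (toL2 T (w k)) h @[k --> U] --> L2inner (toL2 T wbar) h) /\
    (forall psi, BVD (w k) psi @[k --> U] --> BVD wbar psi).
Proof.
move=> UU eta0 weta wD; have PU := @ultra_proper _ U UU.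
have [K K0 HK] := weak_pair_bound eta0.
have wb k : `|toL2 T (w k)| <= K * (M + M).
  apply: (le_trans (HK _ _ (BV_weak_pair (w k)))).
  by rewrite ler_wpM2l// lerD.
have [G1 bG1 HG1] : exists2 G : L2 -> R, bounded_functional G &
    forall h, L2inner (toL2 T (w k)) h @[k --> U] --> G h.
  apply: (ultralimit_functional (K := K * (M + M)) UU) => k; first exact: bounded_functional_inner.
  by move=> h; apply: (le_trans (L2inner_CS _ _)); rewrite ler_wpM2r.
have [G2 bG2 HG2] : exists2 G : C0 -> R, bounded_functional G &
    forall psi, BVD (w k) psi @[k --> U] --> G psi.
  apply: (ultralimit_functional (K := M) UU) => k; first exact: BVD_bounded.
  move=> psi; have := le_dualnorm psi (BVD_bounded (w k)) => /le_trans; apply.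
  by rewrite ler_wpM2r.
have [g G1g] := L2_Riesz bG1.
have [m [mG cm]] := functional_continuous_linear bG2.
have gm : is_weak_derivative (g : RM -> R) m.
  move=> phi tphi; rewrite mG.
  have dl := test_function_Lfun2 T0 tphi.
  rewrite -(L2inner_toL2r g dl) -G1g.
  apply: (cvg_unique (@Rhausdorff R) (HG2 phi)).
  rewrite (_ : (fun k => _) = (fun k => - L2inner (toL2 T (w k)) (toL2 T (derive1 phi)))).
    by apply: cvgN; exact: HG1.
  apply/funext => k; have [_ ->//] := BVDP (w k).
  by rewrite L2inner_toL2//; exact: BV_Lfun2.
have gBV : is_BV T (g : RM -> R).
  split; first exact: Lfun2_Lfun1 (L2_Lfun g).
  by exists m; split.
exists (MkBV gBV); split => [h|psi].
  by rewrite /= toL2_coe -G1g; exact: HG1.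
by rewrite (BVD_unique T0 cm)//= mG; exact: HG2.
Qed.

End compactness.

(** * Descent along lines *)

Section descent.
Context (R : realType) (T : R).
Local Notation L2 := (L2 T).
Variable (f : L2 -> R).
Implicit Types (u h : L2).

(** Riesz representation of the derivative ensures that [get] does not return its default value. *)
Lemma gradientP u h : differentiable f u -> 'd f u h = L2inner (gradient f u) h.
Proof.
move=> df; rewrite /gradient.
have [g Hg] := L2_Riesz (continuous_linear_functional (diff_continuous df)).
by have := @getPex _ [set g : L2 | forall h, 'd f u h = L2inner g h]; apply; exists g.
Qed.

Lemma is_derive_line u h (s : R) : (forall u, differentiable f u) ->
  is_derive s (1 : R) (fun t : R => f (u + t *: h)) (L2inner (gradient f (u + s *: h)) h).
Proof.
move=> df; pose g (t : R) := f (u + t *: h).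
have E : (fun e : R => e^-1 *: ((g \o shift s) (e *: (1 : R)) - g s)) =
         (fun e : R => e^-1 *: ((f \o shift (u + s *: h)) (e *: h) - f (u + s *: h))).
  apply/funext => e; rewrite /g /= /shift; congr (_ *: (f _ - _)).
  by rewrite [e *: 1]mulr1 scalerDl addrCA.
split; first by rewrite /derivable -/g E; exact: diff_derivable.
by rewrite /derive -/g E -[LHS]/('D_h f (u + s *: h)) deriveE// gradientP.
Qed.

(** The mean value theorem on the segment and the Lipschitz bound at the intermediate point, which
    yield the constant [L] in place of the sharp [L / 2]. *)
Lemma descent (L : R) : 0 <= L -> (forall u, differentiable f u) ->
  (forall u1 u2, `|gradient f u1 - gradient f u2| <= L * `|u1 - u2|) ->
  forall u h t, 0 <= t ->
  f (u + t *: h) <= f u + t * L2inner (gradient f u) h + L * t ^+ 2 * `|h| ^+ 2.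
Proof.
move=> L0 df lip u h t; rewrite le_eqVlt => /predU1P[<-|t0].
  by rewrite scale0r addr0 mul0r expr0n mulr0 mul0r !addr0.
have [||c] := @MVT R (fun s : R => f (u + s *: h))
    (fun s => L2inner (gradient f (u + s *: h)) h) 0 t t0.
- by move=> x _; exact: is_derive_line.
- apply: continuous_subspaceT => x; apply: differentiable_continuous.
  by apply/derivable1_diffP; case: (is_derive_line u h x df).
rewrite in_itv/= => /andP[c0 ct]; rewrite scale0r addr0 subr0 => E.
have -> : f (u + t *: h) = f u + L2inner (gradient f (u + c *: h)) h * t by rewrite -E; ring.
rewrite -addrA lerD2l.
have -> : L2inner (gradient f (u + c *: h)) h * t = t * L2inner (gradient f u) h +
   t * L2inner (gradient f (u + c *: h) - gradient f u) h
  by rewrite L2innerBl mulrBr [RHS]addrC subrK mulrC.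
rewrite lerD2l expr2 -!mulrA [leRHS]mulrCA ler_wpM2l ?(ltW t0)//.
apply: (le_trans (ler_norm _)); apply: (le_trans (L2inner_CS _ _)).
rewrite expr2 !mulrA ler_wpM2r//; apply: (le_trans (lip _ _)).
rewrite addrAC subrr add0r normrZ gtr0_norm// !mulrA ler_wpM2r//.
by rewrite ler_wpM2l// ltW.
Qed.

(** First-order condition for [f (u + t h) + t c] at [t = 0]: a negative one-sided slope would beat
    the quadratic term of [descent] for small [t]. The range [|t| <= 1] fits the scaling of weights
    by [1 + t]. *)
Lemma directional_min (L : R) u h (c : R) : 0 <= L -> (forall u, differentiable f u) ->
  (forall u1 u2, `|gradient f u1 - gradient f u2| <= L * `|u1 - u2|) ->
  (forall t, `|t| <= 1 -> f u <= f (u + t *: h) + t * c) ->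
  L2inner (gradient f u) h = - c.
Proof.
move=> L0 df lip fmin.
have key (k : L2) (d : R) : (forall t, 0 <= t <= 1 -> f u <= f (u + t *: k) + t * d) ->
    0 <= L2inner (gradient f u) k + d.
  move=> kmin; set x := L2inner _ _.
  rewrite leNgt; apply/negP => xd.
  pose H := L * `|k| ^+ 2 + 1; pose y := - (x + d).
  have y0 : 0 < y by rewrite oppr_gt0.
  have H0 : 0 < H by rewrite ltr_wpDl// mulr_ge0.
  (* For this [t] the quadratic term is at most half of the linear gain [t * y]. *)
  pose t := Num.min 1 (y / (2 * H)).
  have t0 : 0 < t by rewrite lt_min ltr01 divr_gt0// mulr_gt0.
  have t1 : t <= 1 by rewrite ge_min lexx.
  have tH : t * H <= y / 2.
    have : t <= y / (2 * H) by rewrite ge_min lexx orbT.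
    by rewrite invfM mulrA -ler_pdivlMr.
  have := kmin t; rewrite (ltW t0) t1 => /(_ isT).
  have := descent L0 df lip u k (ltW t0); rewrite -/x => h1 h2.
  have h3 : 0 <= t * (- y + t * (L * `|k| ^+ 2)).
    have -> : t * (- y + t * (L * `|k| ^+ 2)) =
      (f u + t * x + L * t ^+ 2 * `|k| ^+ 2 + t * d) - f u by rewrite /y; ring.
    by rewrite subr_ge0 (le_trans h2)// lerD2r.
  have h4 : t * (L * `|k| ^+ 2) <= t * H by rewrite ler_wpM2l ?(ltW t0)// lerDl.
  move: h3; rewrite pmulr_rge0// => h3.
  by lra.
apply/eqP; rewrite eq_le; apply/andP; split.
  rewrite -subr_ge0 addrC -L2innerNr; apply: key => t /andP[t0 t1].
  have := fmin (- t); rewrite normrN ger0_norm// => /(_ t1).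
  by rewrite scaleNr scalerN mulNr mulrN.
rewrite -subr_ge0 opprK; apply: key => t /andP[t0 t1].
by apply: fmin; rewrite ger0_norm.
Qed.

End descent.

(** * Derivatives of the atoms *)

Section derivatives.
Context (R : realType) (T : R) (T0 : 0 < T).
Local Notation mu := (leb0T T).
Local Notation RM := (measurableTypeR R).
Local Notation leb := (@lebesgue_measure R).
Local Notation C0 := (C0 T).
Local Notation prim := (prim T0).
Local Notation one := (one T).
Implicit Types (u v w : RM -> R) (D E : C0 -> R).

(** In contrast to [BVD], which is obtained by choice, this relation carries an explicit formula for
    the derivative through sums and multiples. *)
Definition has_derivative u D := [/\ u \in Lfun mu 1, bounded_functional D &
  forall phi : C0, test_function T phi -> D phi = - \int[mu]_x (u x * derive1 phi x)].

Lemma has_derivative_BV u D : has_derivative u D -> exists w : BV T, w = u :> (R -> R) /\ BVD w =1 D.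
Proof.
move=> [ul bD uD]; have [m [mD cm]] := functional_continuous_linear bD.
have um : is_weak_derivative u m by move=> phi tphi; rewrite mD uD.
have uBV : is_BV T u by split => //; exists m.
exists (MkBV uBV); split => // psi.
by rewrite -mD; exact: (BVD_unique T0 (u := MkBV uBV) cm).
Qed.

Lemma has_derivative_BVD (u : BV T) D : has_derivative u D -> BVD u =1 D.
Proof.
move=> [ul bD uD]; have [m [mD cm]] := functional_continuous_linear bD => psi.
rewrite -mD; apply: (BVD_unique T0) => // phi tphi.
by rewrite mD uD.
Qed.

Lemma has_derivative_Lfun2 u D : has_derivative u D -> u \in Lfun mu 2%:E.
Proof. by move=> /has_derivative_BV[w [<- _]]; exact: BV_Lfun2. Qed.

Lemma has_derivative_prim u D h : has_derivative u D ->
  D (prim h) = - L2inner (toL2 T u) h + L2inner (toL2 T u) one / T * L2inner h one.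
Proof. by move=> /has_derivative_BV[w [<- <-]]; exact: BVD_prim. Qed.

Lemma has_derivativeD u v D E : has_derivative u D -> has_derivative v E ->
  has_derivative (u \+ v) (fun psi => D psi + E psi).
Proof.
move=> [ul bD uD] [vl bE vE]; split; first exact: Lfun1D.
- split; first by move=> k a b; rewrite bD.1 bE.1; ring.
  have [C _ HC] := bounded_functional_bound bD.
  have [C' _ HC'] := bounded_functional_bound bE.
  by exists (C + C') => x; rewrite (le_trans (ler_normD _ _))// mulrDl lerD.
- move=> phi tphi; rewrite uD// vE// -opprD -Lfun1_RintegralD.
  + by congr (- _); apply: eq_Rintegral => x _; rewrite mulrDl.
  + have [M phiM] := test_function_bounded T0 tphi.
    apply: (Lfun1M (M := M)) => //; exact: Lfun_measurable (test_function_Lfun2 T0 tphi).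
  + have [M phiM] := test_function_bounded T0 tphi.
    apply: (Lfun1M (M := M)) => //; exact: Lfun_measurable (test_function_Lfun2 T0 tphi).
Qed.

Lemma Lfun1Z (k : R) u : u \in Lfun mu 1 -> (fun x => k * u x) \in Lfun mu 1.
Proof.
move=> ul; apply/Lfun1_integrable.
exact: eq_integrable (integrableZl measurableT k ((Lfun1_integrable _ _).1 ul)).
Qed.

Lemma has_derivativeZ (k : R) u D : has_derivative u D ->
  has_derivative (fun x => k * u x) (fun psi => k * D psi).
Proof.
move=> [ul bD uD]; split; first exact: Lfun1Z.
- split; first by move=> c a b; rewrite bD.1; ring.
  have [C _ HC] := bounded_functional_bound bD.
  by exists (`|k| * C) => x; rewrite normrM -mulrA ler_wpM2l.
- move=> phi tphi; rewrite uD// mulrN -Lfun1_RintegralZ.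
    by congr (- _); apply: eq_Rintegral => x _; rewrite mulrA.
  have [M phiM] := test_function_bounded T0 tphi.
  apply: (Lfun1M (M := M)) => //; exact: Lfun_measurable (test_function_Lfun2 T0 tphi).
Qed.

(** Jumps, kinks, slopes of kinks and, on (0,T), affine functions all have this form, so that a
    single integration by parts covers them. *)
Definition piece (c d a b : R) : RM -> R := fun x => (c * x + d) * \1_(`]a, b[ : set RM) x.

Lemma piece_measurable c d a b : measurable_fun setT (piece c d a b).
Proof.
apply: measurable_funM; last exact: measurable_indic.
apply: measurable_funD; last exact: measurable_cst.
by apply: measurable_funM; [exact: measurable_cst|exact: measurable_id].
Qed.

Lemma piece_bounded c d a b x : 0 < x < T -> `|piece c d a b x| <= `|c| * T + `|d|.
Proof.
move=> /andP[x0 xT]; rewrite /piece normrM.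
apply: (@le_trans _ _ `|c * x + d|).
  by rewrite ler_piMr// indicE; case: (_ \in _); rewrite ?normr1 ?normr0.
rewrite (le_trans (ler_normD _ _))// lerD2r normrM ler_wpM2l// gtr0_norm//.
exact: ltW.
Qed.

Lemma piece_Lfun2 c d a b : piece c d a b \in Lfun mu 2%:E.
Proof. exact: (bounded_Lfun2 (piece_measurable c d a b) (@piece_bounded c d a b)). Qed.

Lemma Rintegral_itv (g : R -> R) a b : 0 <= a -> a <= b -> b <= T -> continuous g ->
  \int[mu]_x (g x * \1_(`]a, b[ : set RM) x) = \int[leb]_(x in `[a, b]) g x.
Proof.
move=> a0 ab bT cg.
have gi : leb.-integrable `[a, b] (EFin \o g).
  apply: continuous_compact_integrable; first exact: segment_compact.
  exact: continuous_subspaceT.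
have mg : measurable_fun setT (g : RM -> R) by exact: continuous_measurable.
rewrite Rintegral_leb0T; last by apply: measurable_funM.
rewrite -Rintegral_itv_obnd_cbnd; last first.
  by apply: integrableS gi => //; exact: subset_itv_oc_cc.
rewrite -Rintegral_itv_bndo_bndc; last first.
  by apply: integrableS gi => //; exact: subset_itv_oo_cc.
rewrite Rintegral_mkcond [RHS]Rintegral_mkcond; apply: eq_Rintegral => t _.
rewrite !patchE indicE !mem_setE !in_itv/=.
have [/andP[at_ tb]|tab] := boolP (a < t < b); last by rewrite mulr0 if_same.
by rewrite (le_lt_trans a0 at_) (lt_le_trans tb bT) mulr1.
Qed.

Lemma Rintegral_piece (phi : C0) c d a b : test_function T phi ->
  0 <= a -> a <= b -> b <= T ->
  \int[mu]_x (piece c d a b x * derive1 phi x) =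
  (c * b + d) * phi b - (c * a + d) * phi a - \int[mu]_x (piece 0 c a b x * phi x).
Proof.
move=> tphi a0 ab bT.
have cphi := @C0_continuous _ _ phi.
have cdphi := test_function_continuous tphi.
have caff : continuous (fun x : R => c * x + d).
  by move=> x; apply: cvgD; [apply: cvgMr; exact: cvg_id|exact: cvg_cst].
have dphi (x : R) : is_derive x 1 phi (derive1 phi x).
  by apply: derivable_is; have [/(_ 0%N x)] := tphi; rewrite derive1n0.
pose F (x : R) := (c * x + d) * phi x.
pose G (x : R) := (c * x + d) * derive1 phi x + c * phi x.
have c1 : continuous (fun x : R => (c * x + d) * derive1 phi x).
  by move=> x; apply: cvgM; [exact: caff|exact: cdphi].
have c2 : continuous (fun x : R => c * phi x).
  by move=> x; apply: cvgMr; exact: cphi.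
have dF (x : R) : is_derive x 1 F (G x).
  have daff : is_derive x (1 : R) (fun x : R => c * x + d) c.
    have := is_deriveD (is_deriveZ c (is_derive_id x (1 : R))) (is_derive_cst d x (1 : R)).
    by rewrite addr0 /GRing.scale/= mulr1.
  apply: (is_derive_eq (is_deriveM daff (dphi x))).
  by rewrite /G /GRing.scale/= mulrC [c * _]mulrC; congr (_ + _); exact: mulrC.
have cG : continuous G by move=> x; apply: cvgD; [exact: c1|exact: c2].
have := Rintegral_FTC2 ab cG dF; rewrite -/(F b) -/(F a) => <-.
rewrite -(Rintegral_itv a0 ab bT cG).
have bl (g : R -> R) : continuous g -> (fun x : RM => g x * \1_(`]a, b[ : set RM) x) \in Lfun mu 1.
  move=> cg; have [|e _ emax] := @EVT_max _ (fun x => `|g x|) 0 T (ltW T0).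
    by apply: continuous_subspaceT => x; apply: continuous_comp; [exact: cg|exact: norm_continuous].
  apply: (bounded_Lfun1 (M := `|g e|)).
    by apply: measurable_funM; [exact: continuous_measurable|exact: measurable_indic].
  move=> x /andP[x0 xT]; rewrite normrM.
  apply: (@le_trans _ _ `|g x|); last by apply: emax; rewrite in_itv/= !ltW.
  by rewrite ler_piMr// indicE; case: (_ \in _); rewrite ?normr1 ?normr0.
have -> : \int[mu]_x (G x * \1_(`]a, b[ : set RM) x) =
   \int[mu]_x ((c * x + d) * derive1 phi x * \1_(`]a, b[ : set RM) x) +
   \int[mu]_x (c * phi x * \1_(`]a, b[ : set RM) x).
  rewrite -Lfun1_RintegralD; [|exact: (bl _ c1)|exact: (bl _ c2)].
  by apply: eq_Rintegral => x _; rewrite /G mulrDl.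
rewrite (_ : \int[mu]_x (piece 0 c a b x * phi x) = \int[mu]_x (c * phi x * \1_(`]a, b[ : set RM) x)).
  rewrite addrK; apply: eq_Rintegral => x _; rewrite /piece; ring.
by apply: eq_Rintegral => x _; rewrite /piece; ring.
Qed.

Lemma functional_integral w : w \in Lfun mu 2%:E ->
  bounded_functional (fun psi : C0 => \int[mu]_x (w x * psi x)).
Proof.
move=> wl; have E (psi : C0) : \int[mu]_x (w x * psi x) = L2inner (toL2 T w) (toL2 T psi).
  by rewrite L2inner_toL2//; exact: C0_Lfun2.
split=> [k a b|].
  rewrite !E -L2innerZr -L2innerDr; congr L2inner.
  rewrite -toL2Z ?C0_Lfun2// -toL2D ?C0_Lfun2//; last by apply: Lfun2Z; exact: C0_Lfun2.
exists (`|toL2 T w| * `|one|) => psi; rewrite E.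
apply: (le_trans (L2inner_CS _ _)); rewrite -mulrA ler_wpM2l//.
have -> : `|one| * `|psi| = `|toL2 T (fun x => `|psi| * cst 1 x)|.
  by rewrite toL2Z ?cst_Lfun2// normrZ normr_id mulrC.
apply: toL2_le; [exact: C0_Lfun2|by apply: Lfun2Z; exact: cst_Lfun2|].
by move=> x _; rewrite /cst mulr1 normr_id; exact: C0_le_norm.
Qed.

Lemma functional_eval (x : R) : bounded_functional (fun psi : C0 => psi x).
Proof.
split; first by move=> k a b.
by exists 1 => psi; rewrite mul1r; exact: C0_le_norm.
Qed.

Lemma functional_zero : bounded_functional (fun psi : C0 => 0 : R).
Proof. by split; [move=> *; rewrite mulr0 addr0|exists 0 => *; rewrite normr0 mul0r]. Qed.

Lemma functionalD D E : bounded_functional D -> bounded_functional E ->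
  bounded_functional (fun psi => D psi + E psi).
Proof.
move=> bD bE; split; first by move=> k a b; rewrite bD.1 bE.1; ring.
have [C _ HC] := bounded_functional_bound bD.
have [C' _ HC'] := bounded_functional_bound bE.
by exists (C + C') => x; rewrite (le_trans (ler_normD _ _))// mulrDl lerD.
Qed.

Lemma functionalZ k D : bounded_functional D -> bounded_functional (fun psi => k * D psi).
Proof.
move=> bD; split; first by move=> c a b; rewrite bD.1; ring.
have [C _ HC] := bounded_functional_bound bD.
by exists (`|k| * C) => x; rewrite normrM -mulrA ler_wpM2l.
Qed.

(* Piecewise affine functions: a jump of height [c x + d] at each interior     *)
(* endpoint (the values of [psi] at 0 and T vanish).                           *)
Lemma has_derivative_piece c d a b : 0 <= a -> a <= b -> b <= T ->
  has_derivative (piece c d a b) (fun psi => (c * a + d) * psi a +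
    (- (c * b + d)) * psi b + \int[mu]_x (piece 0 c a b x * psi x)).
Proof.
move=> a0 ab bT; split; first by apply: Lfun2_Lfun1; exact: piece_Lfun2.
  apply: functionalD; last by apply: functional_integral; exact: piece_Lfun2.
  by apply: functionalD; apply: functionalZ; exact: functional_eval.
by move=> phi tphi; rewrite Rintegral_piece//; ring.
Qed.

Lemma has_derivative_ae u v D : measurable_fun setT u ->
  (forall x, 0 < x < T -> u x = v x) -> has_derivative v D -> has_derivative u D.
Proof.
move=> mu_ uv [vl bD vD]; have mv := Lfun_measurable vl.
split => //.
  move/Lfun1_integrable : vl => /integrableP[_ vi]; apply/Lfun1_integrable/integrableP.
  split; first exact/measurable_EFinP.
  apply: le_lt_trans vi; rewrite le_eqVlt; apply/orP; left; apply/eqP.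
  apply: ae_eq_integral => //.
  - by apply: measurableT_comp => //; exact/measurable_EFinP.
  - by apply: measurableT_comp => //; exact/measurable_EFinP.
  - by apply: ae_leb0T => x xT _ /=; rewrite uv.
move=> phi tphi; rewrite vD//; congr (- _).
have md := Lfun_measurable (test_function_Lfun2 T0 tphi).
apply: ae_eq_Rintegral; [exact: measurable_funM|exact: measurable_funM|].
by apply: ae_leb0T => x xT _; rewrite uv.
Qed.

Lemma has_derivative_eq u D E : D =1 E -> has_derivative u D -> has_derivative u E.
Proof. by move=> /funext ->. Qed.

Lemma has_derivative_Sfun x : 0 < x < T -> has_derivative (Sfun T x) (fun psi => psi x).
Proof.
move=> /andP[x0 xT]; have := has_derivative_piece 0 1 (ltW x0) (ltW xT) (lexx T).
rewrite (_ : piece 0 1 x T = Sfun T x); last first.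
  by apply/funext => y; rewrite /piece mul0r add0r mul1r.
apply: has_derivative_eq => psi.
rewrite (_ : psi T = 0); last by apply: C0_out; rewrite ltxx andbF.
rewrite !mul0r add0r mul1r mulr0 addr0.
under eq_Rintegral do rewrite /piece !mul0r add0r mul0r mul0r.
by rewrite /Rintegral integral0 addr0.
Qed.

(** The slope of [Kfun]. In both branches its derivative is the Dirac mass at [x]. *)
Definition dKfun x : RM -> R := if x < T / 2 then piece 0 (-1) 0 x else piece 0 1 x T.

Lemma has_derivative_dKfun x : 0 < x < T -> has_derivative (dKfun x) (fun psi => psi x).
Proof.
move=> /andP[x0 xT]; rewrite /dKfun; case: ifP => _.
  have := has_derivative_piece 0 (-1) (lexx 0) (ltW x0) (ltW xT).
  apply: has_derivative_eq => psi.
  rewrite (_ : psi 0 = 0); last by apply: C0_out; rewrite ltxx.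
  under eq_Rintegral do rewrite /piece !mul0r add0r mul0r mul0r.
  by rewrite /Rintegral integral0 /=; ring.
have := has_derivative_piece 0 1 (ltW x0) (ltW xT) (lexx T).
apply: has_derivative_eq => psi.
rewrite (_ : psi T = 0); last by apply: C0_out; rewrite ltxx andbF.
under eq_Rintegral do rewrite /piece !mul0r add0r mul0r mul0r.
by rewrite /Rintegral integral0 /=; ring.
Qed.

Lemma has_derivative_Kfun x : 0 < x < T ->
  has_derivative (Kfun T x) (fun psi => \int[mu]_y (dKfun x y * psi y)).
Proof.
move=> /andP[x0 xT]; rewrite /dKfun /Kfun; case: ifP => _.
  have := has_derivative_piece (-1) x (lexx 0) (ltW x0) (ltW xT).
  rewrite (_ : piece (-1) x 0 x = (fun y => \1_(`]0, x[) y * (x - y))); last first.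
    by apply/funext => y; rewrite /piece mulrC mulN1r [- y + x]addrC.
  apply: has_derivative_eq => psi.
  by rewrite (_ : psi 0 = 0); [ring|apply: C0_out; rewrite ltxx].
have := has_derivative_piece 1 (- x) (ltW x0) (ltW xT) (lexx T).
rewrite (_ : piece 1 (- x) x T = (fun y => \1_(`]x, T[) y * (y - x))); last first.
  by apply/funext => y; rewrite /piece mulrC mul1r.
apply: has_derivative_eq => psi.
by rewrite (_ : psi T = 0); [ring|apply: C0_out; rewrite ltxx andbF].
Qed.

Lemma affine_measurable c d : measurable_fun setT (fun x : RM => c * x + d).
Proof.
apply: measurable_funD; last exact: measurable_cst.
by apply: measurable_funM; [exact: measurable_cst|exact: measurable_id].
Qed.

Lemma has_derivative_affine c d : has_derivative (fun x => c * x + d)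
  (fun psi => \int[mu]_y (c * psi y)).
Proof.
apply: (has_derivative_ae (v := piece c d 0 T)); first exact: affine_measurable.
  by move=> x xT; rewrite /piece indicE mem_setE in_itv/= xT mulr1.
have := has_derivative_piece c d (lexx 0) (ltW T0) (lexx T).
apply: has_derivative_eq => psi.
rewrite (_ : psi 0 = 0); last by apply: C0_out; rewrite ltxx.
rewrite (_ : psi T = 0); last by apply: C0_out; rewrite ltxx andbF.
rewrite !mulr0 !add0r; apply: ae_eq_Rintegral.
- by apply: measurable_funM; [exact: piece_measurable|exact: C0_measurable].
- by apply: measurable_funM; [exact: measurable_cst|exact: C0_measurable].
- by apply: ae_leb0T => x xT _; rewrite /piece indicE mem_setE in_itv/= xT mul0r add0r mulr1.
Qed.

End derivatives.

(** * Total generalized variation and optimality of the iterates *)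

Section TGV_bounds.
Context (R : realType) (T : R) (T0 : 0 < T) (alpha beta : R).
Hypotheses (alpha_gt0 : 0 < alpha) (beta_gt0 : 0 < beta).
Local Notation mu := (leb0T T).
Local Notation RM := (measurableTypeR R).
Local Notation L2 := (L2 T).
Local Notation C0 := (C0 T).
Local Notation prim := (prim T0).
Local Notation one := (one T).
Implicit Types (u v w : RM -> R) (D E : C0 -> R).

Lemma BV_has_derivative (u : BV T) : has_derivative u (BVD u).
Proof.
split; [exact: BV_Lfun1|exact: BVD_bounded|].
by move=> phi tphi; have [_ ->] := BVDP u.
Qed.

Lemma dualnormB_functional (u w : BV T) :
  bounded_functional (fun psi : C0 => BVD u psi - \int[mu]_x (w x * psi x)).
Proof.
have := functionalD (BVD_bounded u) (functionalZ (-1) (functional_integral (BV_Lfun2 T0 w))).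
by congr bounded_functional; apply/funext => psi; rewrite mulN1r.
Qed.

Definition tgv_value (u w : BV T) : R :=
  alpha * dualnorm (fun psi : C0 => BVD u psi - \int[mu]_x (w x * psi x)) +
  beta * dualnorm (BVD w).

Lemma TGV_le (u w : BV T) : TGV alpha beta u <= tgv_value u w.
Proof.
apply: ge_inf; last by exists w.
exists 0 => _ [w' _ <-]; rewrite addr_ge0// mulr_ge0 ?dualnorm_ge0//; exact: ltW.
Qed.

Lemma le_TGV (u : BV T) c : (forall w : BV T, c <= tgv_value u w) -> c <= TGV alpha beta u.
Proof.
move=> cw; apply: lb_le_inf; first by exists (tgv_value u u); exists u.
by move=> _ [w _ <-]; exact: cw.
Qed.

(* A competitor [w] in the minimum defining TGV, with value at most [s].       *)
Definition tgv_decomposition u s := exists w D E (a b : R),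
  [/\ has_derivative u D, has_derivative w E,
      forall psi, `|D psi - \int[mu]_x (w x * psi x)| <= a * `|psi|,
      forall psi, `|E psi| <= b * `|psi| &
      [/\ 0 <= a, 0 <= b & alpha * a + beta * b <= s]].

Lemma tgv_decompositionD u v s t : tgv_decomposition u s -> tgv_decomposition v t ->
  tgv_decomposition (u \+ v) (s + t).
Proof.
move=> [w [D [E [a [b [uD wE Da Eb [a0 b0 abs]]]]]]].
move=> [w' [D' [E' [a' [b' [vD wE' Da' Eb' [a0' b0' abt]]]]]]].
exists (w \+ w'), (fun psi => D psi + D' psi), (fun psi => E psi + E' psi), (a + a'), (b + b').
split; [exact: has_derivativeD|exact: has_derivativeD| | |].
- move=> psi.
  have wl := has_derivative_Lfun2 T0 wE; have wl' := has_derivative_Lfun2 T0 wE'.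
  have -> : \int[mu]_x ((w \+ w') x * psi x) =
      \int[mu]_x (w x * psi x) + \int[mu]_x (w' x * psi x).
    rewrite -Lfun1_RintegralD; [|exact: Lfun2_mul_Lfun1 wl (C0_Lfun2 psi)|exact: Lfun2_mul_Lfun1 wl' (C0_Lfun2 psi)].
    by apply: eq_Rintegral => x _; rewrite mulrDl.
  rewrite opprD addrACA (le_trans (ler_normD _ _))// mulrDl lerD//.
- by move=> psi; rewrite (le_trans (ler_normD _ _))// mulrDl lerD.
- by split; [exact: addr_ge0|exact: addr_ge0|lra].
Qed.

Lemma tgv_decompositionZ (k : R) u s : 0 <= k -> tgv_decomposition u s ->
  tgv_decomposition (fun x => k * u x) (k * s).
Proof.
move=> k0 [w [D [E [a [b [uD wE Da Eb [a0 b0 abs]]]]]]].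
exists (fun x => k * w x), (fun psi => k * D psi), (fun psi => k * E psi), (k * a), (k * b).
split; [exact: has_derivativeZ|exact: has_derivativeZ| | |].
- move=> psi; have wl := has_derivative_Lfun2 T0 wE.
  have -> : \int[mu]_x (k * w x * psi x) = k * \int[mu]_x (w x * psi x).
    rewrite -Lfun1_RintegralZ; last exact: Lfun2_mul_Lfun1 wl (C0_Lfun2 psi).
    by apply: eq_Rintegral => x _; rewrite mulrA.
  by rewrite -mulrBr normrM ger0_norm// -mulrA ler_wpM2l.
- by move=> psi; rewrite normrM ger0_norm// -mulrA ler_wpM2l.
- split; [exact: mulr_ge0|exact: mulr_ge0|].
  by rewrite !(mulrCA _ k) -mulrDr ler_wpM2l.
Qed.

Lemma tgv_decomposition_TGV (u : BV T) s : tgv_decomposition u s ->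
  exists2 w : BV T, tgv_value u w <= s & TGV alpha beta u <= s.
Proof.
move=> [w [D [E [a [b [uD wE Da Eb [a0 b0 abs]]]]]]].
have [W [Ww WE]] := has_derivative_BV T0 wE.
have val : tgv_value u W <= s.
  apply: (le_trans _ abs); apply: lerD; (apply: ler_wpM2l; first exact: ltW).
    apply: dualnorm_le => // psi; rewrite (has_derivative_BVD T0 uD).
    by rewrite Ww; exact: Da.
  by apply: dualnorm_le => // psi; rewrite WE.
by exists W => //; exact: le_trans (TGV_le _ _) val.
Qed.

Lemma has_derivative0 : has_derivative (cst 0 : RM -> R) (fun psi : C0 => 0).
Proof.
split; [exact: Lfun_cst|exact: functional_zero|].
move=> phi _; under eq_Rintegral do rewrite /cst mul0r.
by rewrite /Rintegral integral0 oppr0.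
Qed.

Definition is_atom u := exists (b : bool) (x : R), 0 < x < T /\
  (u = (fun y => (-1) ^+ b / alpha * Sfun T x y) \/
   u = (fun y => (-1) ^+ b / beta * Kfun T x y)).

Lemma ExtB_atom u : ExtB T alpha beta u -> is_atom u.
Proof.
case=> [[b [x [xT ->]]]|[b [x [/andP[x0 xT] ->]]]]; exists b, x; split => //; [by left| |by right].
have ba : 0 < beta / alpha by rewrite divr_gt0.
by rewrite (lt_trans ba x0) (lt_le_trans xT)// gerBl ltW.
Qed.

Lemma normr_sign_div (b : bool) (k : R) : 0 < k -> `|(-1) ^+ b / k| = k^-1.
Proof. by move=> k0; rewrite normrM normr_sign mul1r gtr0_norm// invr_gt0. Qed.

(** A jump has the competitor [w = 0] and costs [alpha * alpha^-1]; a kink has its own slope as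
    competitor and costs [beta * beta^-1]. *)
Lemma atom_decomposition u : is_atom u -> tgv_decomposition u 1.
Proof.
move=> [b [x [xT [->|->]]]]; set k := (-1) ^+ b / _.
- exists (cst 0), (fun psi => k * psi x), (fun=> 0), alpha^-1, 0; split.
  + by apply: has_derivativeZ => //; exact: has_derivative_Sfun.
  + exact: has_derivative0.
  + move=> psi; under eq_Rintegral do rewrite /cst mul0r.
    rewrite /Rintegral integral0 subr0 normrM normr_sign_div//.
    by rewrite ler_wpM2l ?invr_ge0 ?(ltW alpha_gt0)//; exact: C0_le_norm.
  + by move=> psi; rewrite normr0 mul0r.
  + by split; rewrite ?invr_ge0 ?(ltW alpha_gt0)// mulr0 addr0 divff// gt_eqF.
- exists (fun y => k * dKfun T x y), (fun psi => k * \int[mu]_y (dKfun T x y * psi y)),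
    (fun psi => k * psi x), 0, beta^-1; split.
  + by apply: has_derivativeZ => //; exact: has_derivative_Kfun.
  + by apply: has_derivativeZ => //; exact: has_derivative_dKfun.
  + move=> psi; have dl := has_derivative_Lfun2 T0 (has_derivative_dKfun T0 xT).
    rewrite -Lfun1_RintegralZ; last exact: Lfun2_mul_Lfun1 dl (C0_Lfun2 psi).
    rewrite (_ : \int[mu]_y (k * (dKfun T x y * psi y)) = \int[mu]_y (k * dKfun T x y * psi y)).
      by rewrite subrr normr0 mul0r.
    by apply: eq_Rintegral => y _; rewrite mulrA.
  + move=> psi; rewrite normrM normr_sign_div//.
    by rewrite ler_wpM2l ?invr_ge0 ?(ltW beta_gt0)//; exact: C0_le_norm.
  + by split; rewrite ?invr_ge0 ?(ltW beta_gt0)// mulr0 add0r divff// gt_eqF.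
Qed.

Lemma affine_decomposition u : affine u -> tgv_decomposition u 0.
Proof.
move=> [c [d ->]].
have c0 := has_derivative_affine T0 0 c.
exists (fun x => 0 * x + c), (fun psi => \int[mu]_y (c * psi y)), (fun psi => \int[mu]_y (0 * psi y)), 0, 0.
split => //; [exact: has_derivative_affine| | |].
- move=> psi; have -> : \int[mu]_x ((0 * x + c) * psi x) = \int[mu]_y (c * psi y).
    by apply: eq_Rintegral => y _; rewrite mul0r add0r.
  by rewrite subrr normr0 mul0r.
- move=> psi; under eq_Rintegral do rewrite mul0r.
  by rewrite /Rintegral integral0 normr0 mul0r.
- by split => //; rewrite !mulr0 addr0.
Qed.

Lemma decomposition_Lfun2 u s : tgv_decomposition u s -> u \in Lfun mu 2%:E.
Proof. by move=> [w [D [E [a [b [uD _ _ _ _]]]]]]; exact: (has_derivative_Lfun2 T0 uD). Qed.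

(** The competitors of the atoms combine with the same weights and the affine part is free, so TGV
    of the combination is at most the sum of the weights. *)
Lemma comb_decomposition (A : {fset (R -> R)}) lam l :
  (forall v, v \in A -> is_atom v) -> feasible A lam l ->
  tgv_decomposition (comb A lam l) (\sum_(v <- A) lam v).
Proof.
move=> atA [lam0 affl].
have -> : comb A lam l = (fun x => \sum_(v <- A) lam v * v x) \+ l by [].
rewrite -[X in tgv_decomposition _ X]addr0.
apply: tgv_decompositionD; last exact: affine_decomposition.
suff H : forall r : seq (R -> R), {subset r <= A} ->
  tgv_decomposition (fun x => \sum_(v <- r) lam v * v x) (\sum_(v <- r) lam v) by exact: H.
elim=> [_|v r IH rA].
  rewrite big_nil (_ : (fun x => _) = (fun x : RM => 0 * x + 0)); last first.
    by apply/funext => x; rewrite big_nil mul0r addr0.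
  by apply: affine_decomposition; exists 0, 0.
have vA : v \in A by apply: rA; rewrite mem_head.
rewrite big_cons (_ : (fun x => _) = (fun x => lam v * v x) \+ (fun x => \sum_(v <- r) lam v * v x)).
  apply: tgv_decompositionD; last by apply: IH => z zr; apply: rA; rewrite in_cons zr orbT.
  rewrite -[X in tgv_decomposition _ X]mulr1.
  by apply: tgv_decompositionZ; [exact: lam0|apply: atom_decomposition; exact: atA].
by apply/funext => x; rewrite big_cons.
Qed.

(** Makes the quadratic term of the descent step uniform over the iterations. On (0,T) jumps are
    bounded by [alpha^-1] and kinks by [T / beta]. *)
Lemma atom_bound : exists C, forall u, is_atom u -> `|toL2 T u| <= C.
Proof.
pose B := alpha^-1 + T / beta.
exists `|toL2 T (cst B)| => u uA.
have ul := decomposition_Lfun2 (atom_decomposition uA).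
apply: toL2_le => //; first exact: cst_Lfun2.
have B0 : 0 <= B by apply/ltW/addr_gt0; [rewrite invr_gt0|exact: divr_gt0].
move=> y /andP[y0 yT]; rewrite /cst (ger0_norm B0) /B.
have [b [x [/andP[x0 xT] [->|->]]]] := uA; rewrite normrM normr_sign_div//.
  apply: (@le_trans _ _ alpha^-1).
    rewrite ler_piMr ?invr_ge0 ?(ltW alpha_gt0)// /Sfun indicE.
    by case: (_ \in _); rewrite ?normr1 ?normr0.
  by rewrite lerDl divr_ge0 ?(ltW T0) ?(ltW beta_gt0).
apply: (@le_trans _ _ (T / beta)); last by rewrite lerDr invr_ge0 ltW.
rewrite mulrC ler_wpM2r ?invr_ge0 ?(ltW beta_gt0)// /Kfun.
have H (A : set R) (z : R) : `|z| <= T -> `|\1_A y * z| <= T.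
  move=> zT; rewrite normrM; apply: le_trans zT; rewrite ler_piMl// indicE.
  by case: (_ \in _); rewrite ?normr1 ?normr0.
by case: ifP => _; apply: H; rewrite ler_norml; lra.
Qed.

Section optimality.
Variables (f : L2 -> R) (L : R).
Hypotheses (L_ge0 : 0 <= L) (df : forall a : L2, differentiable f a).
Hypothesis lip : forall a b : L2, `|gradient f a - gradient f b| <= L * `|a - b|.
Variables (A : {fset (R -> R)}) (lam : (R -> R) -> R) (l : R -> R).
Hypotheses (atA : forall v, v \in A -> is_atom v) (minA : is_minimizer f A lam l).
Local Notation U := (toL2 T (comb A lam l)).
Local Notation g := (gradient f U).
Local Notation s := (\sum_(v <- A) lam v).

Lemma comb_Lfun2 : (comb A lam l : RM -> R) \in Lfun mu 2%:E.
Proof. by apply: decomposition_Lfun2; apply: comb_decomposition => //; case: minA. Qed.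

Lemma affine_Lfun2 c d : (fun x : RM => c * x + d) \in Lfun mu 2%:E.
Proof. exact: (has_derivative_Lfun2 T0 (has_derivative_affine T0 c d)). Qed.

(** Moving the affine part in either direction leaves the sum of the weights unchanged. *)
Lemma minimizer_affine c d : L2inner g (toL2 T (fun x => c * x + d)) = 0.
Proof.
rewrite -oppr0; apply: (directional_min L_ge0 df lip) => t _.
have [[lam0 [c' [d' lE]]] H] := minA.
have := H lam (fun x => l x + t * (c * x + d)).
rewrite /objective lerD2r mulr0 addr0.
rewrite (_ : comb A lam (fun x => l x + t * (c * x + d)) =
  comb A lam l \+ (fun x => t * (c * x + d))); last first.
  by apply/funext => x; rewrite /comb/= addrA.
have l2 := affine_Lfun2 c d; rewrite (toL2D comb_Lfun2 (Lfun2Z t l2)).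
have -> : toL2 T (fun x => t * (c * x + d)) = t *: toL2 T (fun x => c * x + d) by exact: toL2Z.
apply; split => //; exists (c' + t * c), (d' + t * d); rewrite lE.
by apply/funext => x; ring.
Qed.

(** Scaling the weights and the affine part together by [1 + t] is feasible for [|t| <= 1] and adds
    [t * s] to the sum of the weights. *)
Lemma minimizer_self : L2inner g U = - s.
Proof.
apply: (directional_min L_ge0 df lip) => t t1.
have [[lam0 [c [d lE]]] H] := minA.
have := H (fun v => (1 + t) * lam v) (fun x => (1 + t) * l x).
rewrite /objective -mulr_sumr.
rewrite (_ : comb A (fun v => (1 + t) * lam v) (fun x => (1 + t) * l x) =
  (fun x => (1 + t) * comb A lam l x)); last first.
  apply/funext => x; rewrite /comb mulrDr mulr_sumr; congr (_ + _).
  by apply: eq_bigr => v _; rewrite mulrA.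
rewrite toL2Z; last exact: comb_Lfun2.
rewrite scalerDl scale1r mulrDl mul1r (addrC s) addrA lerD2r; apply.
have t0 : 0 <= 1 + t by move: t1; rewrite ler_norml; lra.
split; first by move=> v vA; rewrite mulr_ge0// lam0.
exists ((1 + t) * c), ((1 + t) * d); rewrite lE.
by apply/funext => x; ring.
Qed.

Lemma minimizer_one : L2inner g one = 0.
Proof.
rewrite -(minimizer_affine 0 1); congr (L2inner _ (toL2 _ _)).
by apply/funext => x; rewrite mul0r add0r.
Qed.

(** As [g] and [p] both have mean zero, [prim] subtracts nothing: [p] is the function [p_k] of the
    algorithm and [q] is minus its [P_k]. *)
Local Notation p := (prim g).
Local Notation q := (prim (toL2 T p)).

Lemma derivative_pairing u D : has_derivative u D -> L2inner g (toL2 T u) = - D p.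
Proof.
move=> uD; rewrite (has_derivative_prim T0 _ uD) minimizer_one mulr0 addr0 opprK.
exact: L2innerC.
Qed.

(** The derivative of the function [x] is Lebesgue measure, so orthogonality of [g] to [x] is, after
    integration by parts, the vanishing of the integral of [p]. *)
Lemma prim_gradient_one : L2inner (toL2 T p) one = 0.
Proof.
have id := has_derivative_affine T0 1 0.
have := derivative_pairing id; rewrite minimizer_affine => /esym/eqP.
rewrite oppr_eq0 => /eqP; rewrite L2inner_one => H; rewrite -[RHS]H.
have pl := C0_Lfun2 p; apply: ae_eq_Rintegral.
- exact: L2_measurable.
- by apply: measurable_funM; [exact: measurable_cst|exact: C0_measurable].
- by apply: filterS (toL2E pl) => x /(_ I) -> _; rewrite mul1r.
Qed.

Lemma derivative_pairing2 u D : has_derivative u D -> \int[mu]_x (u x * p x) = - D q.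
Proof.
move=> uD; rewrite (has_derivative_prim T0 _ uD) prim_gradient_one mulr0 addr0 opprK.
by rewrite L2inner_toL2//; [exact: (has_derivative_Lfun2 T0 uD)|exact: C0_Lfun2].
Qed.

Lemma gradient_Sfun x : 0 < x < T -> L2inner g (toL2 T (Sfun T x)) = - p x.
Proof. by move=> xT; rewrite (derivative_pairing (has_derivative_Sfun T0 xT)). Qed.

Lemma gradient_Kfun x : 0 < x < T -> L2inner g (toL2 T (Kfun T x)) = q x.
Proof.
move=> xT; rewrite (derivative_pairing (has_derivative_Kfun T0 xT)).
by rewrite (derivative_pairing2 (has_derivative_dKfun T0 xT)) opprK.
Qed.

(** For every competitor [w], split [Dv] into [Dv - w], paired with [p], and [w], integrated by
    parts once more so that [Dw] is paired with [q]; then take the infimum over [w]. *)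
Lemma gradient_dual (v : BV T) M : `|p| <= M * alpha -> `|q| <= M * beta ->
  - L2inner g (toL2 T v) <= M * TGV alpha beta v.
Proof.
move=> pM qM.
have M0 : 0 <= M by rewrite -(pmulr_lge0 _ alpha_gt0) (le_trans _ pM).
have bound (w : BV T) : - L2inner g (toL2 T v) <= M * tgv_value v w.
  rewrite (derivative_pairing (BV_has_derivative v)) opprK.
  have -> : BVD v p = (BVD v p - \int[mu]_x (w x * p x)) - BVD w q.
    by rewrite (derivative_pairing2 (BV_has_derivative w)) opprK addrK.
  apply: (le_trans (ler_norm _)); apply: (le_trans (ler_normB _ _)).
  rewrite mulrDr; apply: lerD.
    have := le_dualnorm p (dualnormB_functional v w) => /le_trans; apply.
    by rewrite mulrA mulrC ler_wpM2r ?dualnorm_ge0// mulrC.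
  have := le_dualnorm q (BVD_bounded w) => /le_trans; apply.
  by rewrite mulrA mulrC ler_wpM2r ?dualnorm_ge0// mulrC.
(* The infimum is reached by dividing by [M], so [M = 0] is treated apart. *)
have [MM|Mn0] := eqVneq M 0; first by have := bound v; rewrite MM !mul0r.
have Mp : 0 < M by rewrite lt_neqAle eq_sym Mn0.
rewrite mulrC -ler_pdivrMr//; apply: le_TGV => w.
by rewrite ler_pdivrMr// mulrC.
Qed.

Lemma prim_leb (w : RM -> R) x : w \in Lfun mu 2%:E -> L2inner (toL2 T w) one = 0 -> 0 < x < T ->
  prim (toL2 T w) x = \int[lebesgue_measure]_(y in `]0, x[) w y.
Proof.
move=> wl h0 /andP[x0 xT]; rewrite (primE T0); last by rewrite !ltW.
rewrite h0 mulr0 subr0 L2inner_toL2//; last exact: below_Lfun2.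
have mh := Lfun_measurable wl.
rewrite Rintegral_leb0T; last by apply: measurable_funM => //; exact: measurable_indic.
rewrite Rintegral_mkcond [RHS]Rintegral_mkcond; apply: eq_Rintegral => t _.
rewrite !patchE indicE !mem_setE !in_itv/=.
have [t0|t0] := ltP 0 t => //=; have [tx|tx] := ltP t x; rewrite ?mulr0 ?if_same// mulr1.
by rewrite (lt_trans tx xT).
Qed.

Lemma pfunE x : 0 < x < T -> pfun f (comb A lam l) x = p x.
Proof.
move=> xT; rewrite -[g in RHS]toL2_coe prim_leb ?toL2_coe//; last exact: minimizer_one.
exact: Lrepr_subproof.
Qed.

Lemma PfunE x : 0 < x < T -> Defs.Pfun f (comb A lam l) x = - q x.
Proof.
move=> xT; rewrite (prim_leb (C0_Lfun2 p) prim_gradient_one xT).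
have e : \int[lebesgue_measure]_(s in `]0, x[) pfun f (comb A lam l) s =
    \int[lebesgue_measure]_(s in `]0, x[) p s.
  apply: eq_Rintegral => y; rewrite inE/= in_itv/= => /andP[y0 yx].
  by move: xT => /andP[_ xT]; rewrite pfunE// y0 (lt_trans yx).
by rewrite /Defs.Pfun e.
Qed.

Lemma eq_supnorm (a b : R -> R) : (forall x, 0 < x < T -> `|a x| = `|b x|) ->
  supnorm T a = supnorm T b.
Proof.
move=> ab; rewrite /supnorm; congr sup; apply/seteqP; split=> _ [x /= xT <-];
  by exists x => //; rewrite ab//; move: xT; rewrite in_itv.
Qed.

Lemma supnorm_pfun : supnorm T (pfun f (comb A lam l)) = `|p|.
Proof. by rewrite C0_normE; apply: eq_supnorm => x /pfunE ->. Qed.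

Lemma supnorm_Pfun : supnorm T (Defs.Pfun f (comb A lam l)) = `|q|.
Proof. by rewrite C0_normE; apply: eq_supnorm => x /PfunE ->; rewrite normrN. Qed.

(** The largest value of [- (g, v)] over atoms [v]. The stopping criterion is [gap <= 1]. *)
Definition gap : R := Num.max (`|p| / alpha) (`|q| / beta).

Lemma gap_p : `|p| <= gap * alpha.
Proof. by rewrite -ler_pdivrMr// le_max lexx. Qed.

Lemma gap_q : `|q| <= gap * beta.
Proof. by rewrite -ler_pdivrMr// le_max lexx orbT. Qed.

Lemma gap_gt1 : ~ stopping alpha beta f (comb A lam l) -> 1 < gap.
Proof.
rewrite /stopping supnorm_pfun supnorm_Pfun => ns; rewrite ltNge; apply/negP => g1; apply: ns.
by split; [apply: (le_trans gap_p)|apply: (le_trans gap_q)]; rewrite ler_piMl// ltW.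
Qed.

Section insertion.
Variables (xS xK : R).
Hypotheses (nstop : ~ stopping alpha beta f (comb A lam l))
  (maxS : is_max_point T (pfun f (comb A lam l)) xS)
  (maxK : is_max_point T (Defs.Pfun f (comb A lam l)) xK).
Local Notation v0 := (new_atom alpha beta f (comb A lam l) xS xK).

Lemma sg_sign (y : R) : y != 0 -> Num.sg y = (-1) ^+ (y < 0)%R.
Proof. by move=> y0; rewrite neqr0_sign. Qed.

(** Position and sign of the atom are chosen to attain the maximum in [gap]. Since [gap > 1], the
    value at the maximum point is nonzero, so [Num.sg] is a genuine sign and [v0] an atom. *)
Lemma new_atomP : is_atom v0 /\ - L2inner g (toL2 T v0) = gap.
Proof.
have [xST pS] := maxS; have [xKT qK] := maxK.
have g1 := gap_gt1 nstop; have g0 : 0 < gap := lt_trans ltr01 g1.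
rewrite /new_atom supnorm_pfun supnorm_Pfun.
move: pS qK; rewrite supnorm_pfun supnorm_Pfun !(pfunE xST) !(PfunE xKT) normrN => pS qK.
case: ifPn => [pq|]; last rewrite -ltNge => pq.
  have gE : gap = `|p| / alpha by rewrite /gap max_l.
  have pn0 : p xS != 0.
    by rewrite -normr_gt0 pS; move: g0; rewrite gE pmulr_lgt0 ?invr_gt0.
  rewrite sg_sign//; split; first by exists (p xS < 0)%R, xS; split => //; left.
  rewrite toL2Z ?(has_derivative_Lfun2 T0 (has_derivative_Sfun T0 xST))//.
  rewrite L2innerZr gradient_Sfun// mulrN opprK gE -pS mulrAC -sg_sign//.
  by rewrite -normrEsg.
have gE : gap = `|q| / beta by rewrite /gap max_r// ltW.
have qn0 : - q xK != 0.
  by rewrite oppr_eq0 -normr_gt0 qK; move: g0; rewrite gE pmulr_lgt0 ?invr_gt0.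
rewrite sg_sign//; split; first by exists (- q xK < 0)%R, xK; split => //; right.
rewrite toL2Z ?(has_derivative_Lfun2 T0 (has_derivative_Kfun T0 xKT))//.
rewrite L2innerZr gradient_Kfun// gE -qK -mulrN mulrAC -sg_sign//.
by rewrite -normrEsg normrN.
Qed.

(** The weight adds two cases because [v0] may already belong to [A1]; atoms pruned from [A] have
    weight 0 and leave the sum unchanged. *)
Lemma insertion_sum (A1 : {fset (R -> R)}) (F : (R -> R) -> R) t :
  A1 = [fset v in A | lam v != 0]%fset ->
  \sum_(v <- (A1 `|` [fset v0])%fset)
    ((if v \in A1 then lam v else 0) + (if v == v0 then t else 0)) * F v =
  \sum_(v <- A) lam v * F v + t * F v0.
Proof.
move=> A1E; under eq_bigr do rewrite mulrDl.
rewrite big_split/=; congr (_ + _).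
  rewrite -(big_fset_incl _ (A := A1)); last 2 first.
  - exact: fsubsetUl.
  - by move=> v _ /negbTE ->; rewrite mul0r.
  rewrite -[RHS](big_fset_incl _ (A := A1)); last 2 first.
  - by rewrite A1E; apply/fsubsetP => v; rewrite !inE => /andP[].
  - move=> v vA; rewrite A1E !inE vA/= negbK => /eqP ->; exact: mul0r.
  by rewrite big_seq [RHS]big_seq; apply: eq_bigr => v ->.
rewrite (big_fsetD1 v0) ?inE ?eqxx ?orbT//= big_seq big1 ?addr0// => v.
by rewrite !inE => /andP[/negbTE -> _]; rewrite mul0r.
Qed.

(** The new minimizer is compared with the old weights plus [t] on [v0]: the slope of [f] in this
    direction is [- gap], and the sum of the weights grows by [t]. *)
Lemma insertion_step (A1 : {fset (R -> R)}) lam1 l1 t :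
  A1 = [fset v in A | lam v != 0]%fset ->
  is_minimizer f (A1 `|` [fset v0])%fset lam1 l1 -> 0 <= t ->
  objective f (A1 `|` [fset v0])%fset lam1 l1 <=
  objective f A lam l - t * (gap - 1) + L * t ^+ 2 * `|toL2 T v0| ^+ 2.
Proof.
move=> A1E [_ min1] t0.
pose lam2 v := (if v \in A1 then lam v else 0) + (if v == v0 then t else 0).
have [[lam0 affl] _] := minA.
have feas : feasible (A1 `|` [fset v0])%fset lam2 l.
  split => // v _; apply: addr_ge0; last by case: ifP.
  by case: ifP => //; rewrite A1E !inE => /andP[vA _]; exact: lam0.
apply: (le_trans (min1 lam2 l feas)); rewrite /objective.
have [at0 gv] := new_atomP.
have vl := decomposition_Lfun2 (atom_decomposition at0).
have -> : comb (A1 `|` [fset v0])%fset lam2 l = comb A lam l \+ (fun x => t * v0 x).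
  apply/funext => x; rewrite /comb/= addrAC; congr (_ + _).
  exact: (insertion_sum (fun v => v x)).
have -> : \sum_(v <- (A1 `|` [fset v0])%fset) lam2 v = s + t.
  have := insertion_sum (fun=> 1) t A1E; rewrite mulr1.
  by under eq_bigr do rewrite mulr1; under [in RHS]eq_bigr do rewrite mulr1.
rewrite toL2D ?toL2Z//; [|exact: comb_Lfun2|exact: Lfun2Z].
have := descent L_ge0 df lip U (toL2 T v0) t0.
rewrite -[L2inner _ _]opprK gv; lra.
Qed.

End insertion.

End optimality.

End TGV_bounds.

(** The sets of [F] and the preimages of neighbourhoods of a cluster point generate a proper filter,
    which extends to an ultrafilter; thus no subsequence is extracted. *)
Lemma cluster_ultraP (I : pointedType) (X : topologicalType) (F : set_system I) (u : I -> X) (x : X) :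
  Filter F ->
  cluster (u @ F) x <-> exists U, [/\ UltraFilter U, F `<=` U & u @ U --> x].
Proof.
move=> FF; split=> [ux|[U [UU FU Ux]] A B FA xB]; last first.
  have PU := @ultra_proper _ U UU.
  have /filter_ex[i [Ai Bi]] : U (u @^-1` A `&` u @^-1` B).
    by apply: filterI; [exact: FU|exact: Ux].
  by exists (u i).
pose G := filter_from [set AB : set I * set X | F AB.1 /\ nbhs x AB.2]
  (fun AB => AB.1 `&` u @^-1` AB.2).
have GF : Filter G.
  apply: filter_from_filter; first by exists (setT, setT); split; exact: filterT.
  move=> [A B] [A' B'] /= [FA xB] [FA' xB']; exists (A `&` A', B `&` B').
    by split; exact: filterI.
  by move=> i [[Ai Ai'] [Bi Bi']].
have GP : ProperFilter G.
  apply: filter_from_proper => -[A B] /= [FA xB].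
  have [|_ [[i Ai <-] Bi]] := ux (u @` A) B _ xB; last by exists i.
  by apply: (@filterS I F _ A) => // i Ai; exists i.
have [U [UU GU]] := ultraFilterLemma GP.
exists U; split => // [A FA|B xB]; apply: GU.
  by exists (A, setT) => /=; [split => //; exact: filterT|move=> i []].
by exists (setT, B) => /=; [split => //; exact: filterT|move=> i []].
Qed.

(** Serves to pass from [u] to the iterates [u n.+1], and from [j n.+1] to [j n] in a limit. *)
Lemma eventually_shift (X : Type) (u : nat -> X) : (fun n => u n.+1) @ \oo = u @ \oo.
Proof.
apply/seteqP; split=> A [N _ NA].
  by exists N.+1 => // -[//|n] /= Nn; exact: NA.
by exists N => // n /= Nn; apply: NA => /=; exact: leq_trans Nn _.
Qed.

(** * Weak* limits of iterates *)

Section weak_star_limits.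
Context (R : realType) (T : R) (T0 : 0 < T) (alpha beta : R).
Hypotheses (alpha_gt0 : 0 < alpha) (beta_gt0 : 0 < beta).
Local Notation mu := (leb0T T).
Local Notation L2 := (L2 T).
Local Notation C0 := (C0 T).
Local Notation one := (one T).

Lemma BVpairingE (u : BV T) (p : C0 * C0) :
  BVpairing u p = L2inner (toL2 T u) (toL2 T p.1) + BVD u p.2.
Proof. by rewrite L2inner_toL2//; [exact: BV_Lfun2|exact: C0_Lfun2]. Qed.

(** The pairs [(phi, 0)] and [(0, psi)] separate the two halves of [BVpairing]. *)
Lemma BV_cvgP (F : set_system nat) (u : nat -> BV T) (ubar : BV T) : Filter F ->
  u k @[k --> F] --> ubar <->
  (forall phi : C0, L2inner (toL2 T (u k)) (toL2 T phi) @[k --> F] --> L2inner (toL2 T ubar) (toL2 T phi)) /\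
  (forall psi : C0, BVD (u k) psi @[k --> F] --> BVD ubar psi).
Proof.
move=> FF.
have pairP : (forall p : C0 * C0, BVpairing (u k) p @[k --> F] --> BVpairing ubar p) <->
  {ptws, (fun k => BVpairing (u k)) @ F --> BVpairing ubar}.
  by rewrite pointwise_cvgP.
split=> [uu|[u1 u2]].
  have {}uu : forall p : C0 * C0, BVpairing (u k) p @[k --> F] --> BVpairing ubar p.
    apply/pairP; apply: (cvg_comp _ _ uu).
    exact: (@initial_continuous (BV T) _ (@BVpairing R T) ubar).
  split=> [phi|psi].
    have := uu (phi, 0); rewrite BVpairingE/= linear0 addr0.
    by rewrite (_ : (fun k => _) = (fun k => L2inner (toL2 T (u k)) (toL2 T phi)))//;
      apply/funext => k; rewrite BVpairingE/= linear0 addr0.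
  have z0 : toL2 T (0 : C0) = 0 by rewrite -[RHS]toL2_0.
  have := uu (0, psi); rewrite BVpairingE/= z0 L2inner0r add0r.
  by rewrite (_ : (fun k => _) = (fun k => BVD (u k) psi))//;
    apply/funext => k; rewrite BVpairingE/= z0 L2inner0r add0r.
have /pairP uu : forall p : C0 * C0, BVpairing (u k) p @[k --> F] --> BVpairing ubar p.
  move=> p; rewrite BVpairingE.
  rewrite (_ : (fun k => _) = (fun k => L2inner (toL2 T (u k)) (toL2 T p.1) + BVD (u k) p.2)).
    by apply: cvgD; [exact: u1|exact: u2].
  by apply/funext => k; rewrite BVpairingE.
move=> B [_ [[D oD <-] Dubar] DB].
apply: (filterS DB); apply: uu; exact: open_nbhs_nbhs.
Qed.

Lemma L2inner_cvg (F : set_system nat) (a b : nat -> L2) (abar bbar : L2) : ProperFilter F ->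
  `|a k - abar| @[k --> F] --> 0 -> `|b k - bbar| @[k --> F] --> 0 ->
  L2inner (a k) (b k) @[k --> F] --> L2inner abar bbar.
Proof.
move=> FF ak bk; apply/subr_cvg0/norm_cvg0P.
have bound k : `|L2inner (a k) (b k) - L2inner abar bbar| <=
    `|a k - abar| * `|b k - bbar| + `|a k - abar| * `|bbar| + `|abar| * `|b k - bbar|.
  have -> : L2inner (a k) (b k) - L2inner abar bbar = L2inner (a k - abar) (b k - bbar) +
      L2inner (a k - abar) bbar + L2inner abar (b k - bbar).
    rewrite !L2innerBl !L2innerBr; move: (L2inner _ _) (L2inner _ _) (L2inner _ _) (L2inner _ _) => x y z t.
    lra.
  apply: (le_trans (ler_normD _ _)); apply: lerD; last exact: L2inner_CS.
  by apply: (le_trans (ler_normD _ _)); apply: lerD; exact: L2inner_CS.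
apply: (@squeeze_cvgr _ F _ R (cst 0)
  (fun k => `|a k - abar| * `|b k - bbar| + `|a k - abar| * `|bbar| + `|abar| * `|b k - bbar|)).
- by apply: nearW => k; rewrite normr_ge0 bound.
- exact: cvg_cst.
have -> : (0 : R) = 0 * 0 + 0 * `|bbar| + `|abar| * 0 by rewrite !mul0r mulr0 !addr0.
apply: cvgD; last by apply: cvgM => //; exact: cvg_cst.
by apply: cvgD; apply: cvgM => //; exact: cvg_cst.
Qed.

(** For fixed [phi] and [psi] in the unit ball the tested inequality passes to the limit; the two
    suprema are taken afterwards, one after the other. *)
Lemma tgv_value_lsc (F : set_system nat) (u w : nat -> BV T) (ubar wbar : BV T) (s : nat -> R) sbar :
  ProperFilter F -> (forall k, tgv_value alpha beta (u k) (w k) <= s k) ->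
  s k @[k --> F] --> sbar ->
  (forall psi, BVD (u k) psi @[k --> F] --> BVD ubar psi) ->
  (forall h, L2inner (toL2 T (w k)) h @[k --> F] --> L2inner (toL2 T wbar) h) ->
  (forall psi, BVD (w k) psi @[k --> F] --> BVD wbar psi) ->
  tgv_value alpha beta ubar wbar <= sbar.
Proof.
move=> FF us ss uD wl wD.
have dualnorm_le1 (D : C0 -> R) (M : R) : (forall phi : C0, `|phi| <= 1 -> `|D phi| <= M) ->
    dualnorm D <= M.
  move=> DM; apply: ge_sup; last by move=> _ [phi phi1 <-]; exact: DM.
  by exists `|D 0|; exists 0; rewrite /= ?normr0.
have H (phi psi : C0) : `|phi| <= 1 -> `|psi| <= 1 ->
    alpha * `|BVD ubar phi - \int[mu]_x (wbar x * phi x)| + beta * `|BVD wbar psi| <= sbar.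
  move=> phi1 psi1; pose D k := BVD (u k) phi - L2inner (toL2 T (w k)) (toL2 T phi).
  have -> : \int[mu]_x (wbar x * phi x) = L2inner (toL2 T wbar) (toL2 T phi).
    by rewrite L2inner_toL2//; [exact: BV_Lfun2|exact: C0_Lfun2].
  apply: (@ler_cvg_to _ F _ R (fun k => alpha * `|D k| + beta * `|BVD (w k) psi|) s).
  - have Dc : D k @[k --> F] --> BVD ubar phi - L2inner (toL2 T wbar) (toL2 T phi).
      by apply: cvgB; [exact: uD|exact: wl].
    have wc := wD psi; have ac : cst alpha k @[k --> F] --> alpha by exact: cvg_cst.
    have bc : cst beta k @[k --> F] --> beta by exact: cvg_cst.
    by apply: cvgD; [apply: cvgM ac (cvg_norm Dc)|apply: cvgM bc (cvg_norm wc)].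
  - exact: ss.
  apply: nearW => k; apply: le_trans (us k); apply: lerD; (apply: ler_wpM2l; first exact: ltW).
    have := le_dualnorm phi (dualnormB_functional T0 (u k) (w k)).
    rewrite -(L2inner_toL2 (BV_Lfun2 T0 (w k)) (C0_Lfun2 phi)) => /le_trans; apply.
    by rewrite ler_piMr// dualnorm_ge0.
  by have := le_dualnorm psi (BVD_bounded (w k)) => /le_trans; apply; rewrite ler_piMr// dualnorm_ge0.
rewrite /tgv_value -lerBrDr mulrC -ler_pdivlMr//; apply: (dualnorm_le1 _ _) => phi phi1.
rewrite ler_pdivlMr// lerBrDr addrC -lerBrDr mulrC -ler_pdivlMr//.
apply: dualnorm_le1 => psi psi1.
by rewrite ler_pdivlMr// lerBrDr addrC mulrC (mulrC _ beta) H.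
Qed.

Section limit.
Variables (f : L2 -> R) (L : R) (eta : C0) (eta_neq0 : L2inner (toL2 T eta) one != 0).
Hypothesis lip : forall a b : L2, `|gradient f a - gradient f b| <= L * `|a - b|.
(** An abstract view of the iterates: [s] are the sums of weights, [gp] the gaps, and [w k] is a
    competitor in TGV at [u k]. *)
Variables (u w : nat -> BV T) (s gp : nat -> R) (M : R).
Local Notation g k := (gradient f (toL2 T (u k))).
Hypotheses (uD : forall k, dualnorm (BVD (u k)) <= M)
  (ueta : forall k, `|L2inner (toL2 T (u k)) (toL2 T eta)| <= M)
  (uw : forall k, tgv_value alpha beta (u k) (w k) <= s k) (sM : forall k, s k <= M)
  (gself : forall k, L2inner (g k) (toL2 T (u k)) = - s k)
  (gdual : forall k (v : BV T), - L2inner (g k) (toL2 T v) <= gp k * TGV alpha beta v)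
  (gp1 : gp k @[k --> \oo] --> (1 : R)).

Lemma weak_star_compact U : UltraFilter U ->
  exists ubar : BV T, u k @[k --> U] --> ubar.
Proof.
move=> UU; have PU := @ultra_proper _ U UU.
have [ubar [ul ud]] := BV_weak_compactness T0 UU eta_neq0 ueta uD.
by exists ubar; apply/BV_cvgP; split => [phi|]; [exact: ul|exact: ud].
Qed.

(** The TGV value bounds [Dw] directly; the pairing of [w] with [eta] is [Du] at [eta] minus
    [Du - w] at [eta], both bounded. *)
Lemma competitor_bound : exists M' : R, forall k,
  `|L2inner (toL2 T (w k)) (toL2 T eta)| <= M' /\ dualnorm (BVD (w k)) <= M'.
Proof.
have M0 : 0 <= M := le_trans (dualnorm_ge0 _) (uD 0).
exists (M / beta + (M / alpha + M) * `|eta|) => k.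
have uwM := le_trans (uw k) (sM k).
have a0 : 0 <= alpha * dualnorm (fun psi : C0 => BVD (u k) psi - \int[mu]_x (w k x * psi x)).
  by rewrite mulr_ge0 ?dualnorm_ge0// ltW.
have b0 : 0 <= beta * dualnorm (BVD (w k)) by rewrite mulr_ge0 ?dualnorm_ge0// ltW.
split; last first.
  apply: (@le_trans _ _ (M / beta)).
    by rewrite ler_pdivlMr// mulrC; apply: le_trans uwM; rewrite /tgv_value lerDr.
  rewrite lerDl mulr_ge0// addr_ge0// divr_ge0//; exact: ltW.
apply: (@le_trans _ _ ((M / alpha + M) * `|eta|)); last first.
  by rewrite lerDr divr_ge0// ltW.
rewrite L2inner_toL2; [|exact: BV_Lfun2|exact: C0_Lfun2].
set I := (X in `|X|).
have -> : I = BVD (u k) eta - (BVD (u k) eta - I) by rewrite subKr.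
apply: (le_trans (ler_normB _ _)); rewrite addrC mulrDl; apply: lerD.
  have := le_dualnorm eta (dualnormB_functional T0 (u k) (w k)) => /le_trans; apply.
  by rewrite ler_wpM2r// ler_pdivlMr// mulrC; apply: le_trans uwM; rewrite /tgv_value lerDl.
by have := le_dualnorm eta (BVD_bounded (u k)) => /le_trans; apply; rewrite ler_wpM2r.
Qed.

Lemma weak_star_strong U (ubar : BV T) : ProperFilter U -> u k @[k --> U] --> ubar ->
  `|toL2 T (u k) - toL2 T ubar| @[k --> U] --> 0.
Proof.
move=> PU /BV_cvgP[ul ud].
apply: (@weak_pair_strong_cvg _ _ T0 _ eta_neq0 U PU _ (fun k psi => BVD (u k) psi - BVD ubar psi)
  (M + dualnorm (BVD ubar))).
- by move=> k; apply: weak_pairB; exact: BV_weak_pair.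
- move=> k; apply: dualnorm_le => [|psi].
    by apply: addr_ge0; [exact: le_trans (dualnorm_ge0 _) (uD k)|exact: dualnorm_ge0].
  apply: (le_trans (ler_normB _ _)); rewrite mulrDl; apply: lerD.
    have := le_dualnorm psi (BVD_bounded (u k)) => /le_trans; apply.
    by rewrite ler_wpM2r.
  exact: le_dualnorm psi (BVD_bounded ubar).
- rewrite (_ : (fun k => _) = (fun k => L2inner (toL2 T (u k)) (toL2 T eta) - L2inner (toL2 T ubar) (toL2 T eta))).
    by apply/subr_cvg0; exact: ul.
  by apply/funext => k; rewrite L2innerBl.
- by move=> psi; apply/subr_cvg0; exact: ud.
Qed.

(** Strong convergence of iterates and gradients gives [TGV ubar <= - (gbar, ubar)] and
    [- (gbar, v) <= TGV v] in the limit; their sum is the claim. *)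
Lemma limit_optimal U (ubar v : BV T) : UltraFilter U -> \oo `<=` U -> u k @[k --> U] --> ubar ->
  L2inner (- gradient f (toL2 T ubar)) (toL2 T v - toL2 T ubar) + TGV alpha beta ubar <=
  TGV alpha beta v.
Proof.
move=> UU ooU uu; have PU := @ultra_proper _ U UU.
have us := weak_star_strong PU uu.
set gbar := gradient f (toL2 T ubar).
have gs : `|g k - gbar| @[k --> U] --> 0.
  apply: (@squeeze_cvgr _ U _ R (cst 0) (fun k => L * `|toL2 T (u k) - toL2 T ubar|)).
  - by apply: nearW => k; rewrite normr_ge0 lip.
  - exact: cvg_cst.
  - by rewrite -[X in _ --> X](mulr0 L); apply: cvgM => //; exact: cvg_cst.
have sl : s k @[k --> U] --> - L2inner gbar (toL2 T ubar).
  rewrite (_ : (fun k => _) = (fun k => - L2inner (g k) (toL2 T (u k)))).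
    by apply: cvgN; exact: L2inner_cvg.
  by apply/funext => k; rewrite gself opprK.
have [M' wM'] := competitor_bound.
have [wbar [wl wd]] := BV_weak_compactness T0 UU eta_neq0 (fun k => (wM' k).1) (fun k => (wM' k).2).
have [_ ud] := (BV_cvgP u ubar _).1 uu.
have lo := tgv_value_lsc PU uw sl ud wl wd.
have hi : - L2inner gbar (toL2 T v) <= TGV alpha beta v.
  apply: (@ler_cvg_to _ U _ R (fun k => - L2inner (g k) (toL2 T v)) (fun k => gp k * TGV alpha beta v)).
  - apply: cvgN; apply: L2inner_cvg => //.
    rewrite (_ : (fun k => _) = cst 0); first exact: cvg_cst.
    by apply/funext => k; rewrite subrr normr0.
  - rewrite -[X in _ --> X]mul1r; apply: cvgM; last exact: cvg_cst.
    by move=> B /gp1 /ooU.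
  - by apply: nearW => k; exact: gdual.
have {}lo := le_trans (TGV_le alpha_gt0 beta_gt0 ubar wbar) lo.
rewrite L2innerNl L2innerBr opprB addrC addrA; apply: le_trans hi.
by rewrite gerDr -lerBrDr sub0r.
Qed.

End limit.

End weak_star_limits.

(** The best [t] bounds the square of [gp n - 1] by [4 K] times the decrease of [j], and the
    decreases tend to 0 because [j] is nonincreasing and bounded below. *)
Lemma descent_gap_cvg (R : realType) (j gp : nat -> R) (K m : R) : 0 < K ->
  (forall n, 1 <= gp n) -> (forall n, m <= j n) ->
  (forall n t, 0 <= t -> j n.+1 <= j n - t * (gp n - 1) + K * t ^+ 2) ->
  gp n @[n --> \oo] --> (1 : R).
Proof.
move=> K0 gp1 jm step.
have sq n : (gp n - 1) ^+ 2 <= 4 * K * (j n - j n.+1).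
  (* The minimizer in [t] of the quadratic bound. *)
  have t0 : 0 <= (gp n - 1) / (2 * K) by rewrite divr_ge0 ?subr_ge0 ?mulr_ge0// ltW.
  have := step n _ t0; move: (gp n - 1) (j n) (j n.+1) => d a b H.
  have : b <= a - d ^+ 2 / (4 * K).
    apply: (le_trans H); rewrite le_eqVlt; apply/orP; left; apply/eqP; field.
    by rewrite gt_eqF.
  by rewrite lerBrDr addrC -lerBrDr ler_pdivrMr ?mulr_gt0// mulrC.
have dec n : j n.+1 <= j n.
  by have := step n 0 (lexx 0); rewrite mul0r expr0n/= mulr0 subr0 addr0.
have cj : cvgn j.
  apply: nonincreasing_is_cvgn; first exact/nonincreasing_seqP.
  by exists m => _ [n _ <-]; exact: jm.
have c0 : 4 * K * (j n - j n.+1) @[n --> \oo] --> 4 * K * (limn j - limn j).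
  apply: cvgM; first exact: cvg_cst.
  apply: cvgB; first exact: cj.
  by have := cj; rewrite -(eventually_shift j).
rewrite subrr mulr0 in c0.
apply/cvgrPdist_le => e e0; have e20 : 0 < e ^+ 2 by rewrite exprn_gt0.
move/cvgrPdist_le : c0 => /(_ _ e20); apply: filterS => n.
rewrite sub0r normrN => /(le_trans (ler_norm _)) /(le_trans (sq n)).
by rewrite distrC ger0_norm ?subr_ge0// ler_pXn2r// nnegrE ?subr_ge0// ltW.
Qed.

(** * The iterates of the algorithm *)

Section boundedness.
Context (R : realType) (T : R) (T0 : 0 < T).
Local Notation mu := (leb0T T).
Local Notation RM := (measurableTypeR R).

Lemma BVnorm_bound (eta : C0 T) (u : BV T) C : BVnorm u <= C ->
  dualnorm (BVD u) <= C /\ `|L2inner (toL2 T u) (toL2 T eta)| <= `|eta| * C.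
Proof.
have N0 : 0 <= fine ('N[mu]_1[EFin \o u])%E by rewrite fine_ge0// Lnorm_ge0.
move=> uC; have D0 := dualnorm_ge0 (BVD u).
have NC : fine ('N[mu]_1[EFin \o u])%E <= C by apply: le_trans uC; rewrite /BVnorm lerDl.
split; first by apply: le_trans uC; rewrite /BVnorm lerDr.
apply: (@le_trans _ _ (`|eta| * fine ('N[mu]_1[EFin \o u])%E)); last by rewrite ler_wpM2l.
have ui := BV_Lfun1 u; have el := C0_Lfun2 eta; have ul := BV_Lfun2 T0 u.
rewrite L2inner_toL2//; have uei := Lfun2_mul_Lfun1 ul el.
apply: (le_trans (le_normr_Rintegral _ _)) => //; first exact/Lfun1_integrable.
have -> : fine ('N[mu]_1[EFin \o u])%E = \int[mu]_x `|u x|.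
  by rewrite Lnorm1 /Rintegral.
have absi (h : RM -> R) : h \in Lfun mu 1 -> mu.-integrable setT (EFin \o (fun x => `|h x|)).
  by move=> /Lfun1_integrable /integrable_abse.
rewrite -RintegralZl//; last exact: absi.
apply: le_Rintegral => //; [exact: absi| |].
  have := integrableZl (measurableT : measurable (setT : set RM)) `|eta| (absi _ ui).
  by apply: eq_integrable.
by move=> x _; rewrite normrM mulrC ler_wpM2r// C0_le_norm.
Qed.

End boundedness.

Section iterates.
Context (R : realType) (T alpha beta : R).
Hypotheses (T0 : 0 < T) (alpha_gt0 : 0 < alpha) (beta_gt0 : 0 < beta).
Variables (f : L2 T -> R) (L Cf : R).
Hypotheses (L_ge0 : 0 <= L) (df : forall a : L2 T, differentiable f a)
  (lip : forall a b : L2 T, `|gradient f a - gradient f b| <= L * `|a - b|)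
  (f_lb : forall a : L2 T, - Cf <= f a).
Variables (A Aplus : nat -> {fset (R -> R)}) (lam : nat -> (R -> R) -> R)
  (l : nat -> R -> R) (u : nat -> BV T) (xS xK : nat -> R).
Hypotheses (run : algorithm_run alpha beta f A Aplus lam l u xS xK)
  (no_termination : forall k, (1 <= k)%N -> ~ stopping alpha beta f (u k)).
Local Notation gapn n := (gap T0 alpha beta f (Aplus n) (lam n.+1) (l n.+1)).
Local Notation sn n := (\sum_(v <- Aplus n) lam n.+1 v).
Local Notation jn n := (objective f (Aplus n) (lam n.+1) (l n.+1)).

(** The induction passes through optimality: that the function inserted next is an atom rests on
    [gap > 1] at the minimizer of step [n]. *)
Lemma run_atoms n v : v \in Aplus n -> is_atom T alpha beta v.
Proof.
elim: n v => [|n IH] v.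
  rewrite (run_Aplus0 run) => vA; apply: ExtB_atom => //.
  exact: (run_init run).
rewrite (run_Aplus run)// !inE => /orP[|/eqP ->].
  by rewrite (run_A run) !inE => /andP[vA _]; exact: IH.
have nt := @no_termination n.+1 isT; have mS := run_xS run (ltn0Sn n); have mK := run_xK run (ltn0Sn n).
rewrite (run_u run) in nt mS mK *.
by have [] := new_atomP T0 alpha_gt0 beta_gt0 L_ge0 df lip IH (run_minimizer run n) nt mS mK.
Qed.

Lemma run_gap_gt1 n : 1 < gapn n.
Proof.
have nt := @no_termination n.+1 isT; rewrite (run_u run) in nt.
exact: (gap_gt1 T0 alpha_gt0 beta_gt0 L_ge0 df lip (@run_atoms n) (run_minimizer run n) nt).
Qed.

Lemma run_sum_ge0 n : 0 <= sn n.
Proof.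
rewrite big_seq; apply: sumr_ge0 => v vA.
by have [[+ _] _] := run_minimizer run n; apply.
Qed.

Lemma run_objective_lb n : - Cf <= jn n.
Proof. by rewrite -[- Cf]addr0; apply: lerD; [exact: f_lb|exact: run_sum_ge0]. Qed.

Lemma run_objective_step : exists2 K, 0 < K & forall n t, 0 <= t ->
  jn n.+1 <= jn n - t * (gapn n - 1) + K * t ^+ 2.
Proof.
have [C HC] := atom_bound T0 alpha_gt0 beta_gt0.
(* The summand 1 keeps the constant positive. *)
exists (L * C ^+ 2 + 1); first by rewrite ltr_wpDl// mulr_ge0// sqr_ge0.
move=> n t t0.
have nt := @no_termination n.+1 isT; have mS := run_xS run (ltn0Sn n); have mK := run_xK run (ltn0Sn n).
have minS := run_minimizer run n.+1; rewrite (run_Aplus run)// in minS *.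
rewrite (run_u run) in nt mS mK minS *.
have := insertion_step T0 alpha_gt0 beta_gt0 L_ge0 df lip (@run_atoms n) (run_minimizer run n)
  nt mS mK (run_A run n) minS t0.
have [atv _] := new_atomP T0 alpha_gt0 beta_gt0 L_ge0 df lip (@run_atoms n) (run_minimizer run n) nt mS mK.
move/le_trans; apply; rewrite lerD2l -mulrA (mulrC (t ^+ 2)) mulrA ler_wpM2r ?sqr_ge0//.
apply: (@le_trans _ _ (L * C ^+ 2)); last by rewrite lerDl.
rewrite ler_wpM2l//; have vC := HC _ atv.
by rewrite ler_pXn2r// nnegrE// (le_trans _ vC).
Qed.

Lemma run_gap_cvg : gapn n @[n --> \oo] --> (1 : R).
Proof.
have [K K0 HK] := run_objective_step.
apply: (descent_gap_cvg K0 _ run_objective_lb HK) => n.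
exact: ltW (run_gap_gt1 n).
Qed.

Lemma run_objective_le n : jn n <= jn 0.
Proof.
elim: n => // n; apply: le_trans; have [K K0 HK] := run_objective_step.
by have := HK n 0 (lexx 0); rewrite mul0r expr0n/= mulr0 subr0 addr0.
Qed.

Lemma run_objectiveE n : jn n = f (toL2 T (u n.+1)) + sn n.
Proof. by rewrite /objective (run_u run). Qed.

Lemma run_decomposition n : tgv_decomposition T alpha beta (u n.+1) (sn n).
Proof.
rewrite (run_u run); apply: comb_decomposition => //; first exact: run_atoms.
by have [] := run_minimizer run n.
Qed.

End iterates.

Theorem corollary2 (R : realType) (T alpha beta : R)
  (T_gt0 : 0 < T) (alpha_gt0 : 0 < alpha) (beta_gt0 : 0 < beta)
  (f : L2 T -> R)
  (A1 : continuously_differentiable f)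
  (A2 : exists2 Lf : R, 0 < Lf & forall u1 u2 : L2 T,
     `|gradient f u1 - gradient f u2| <= Lf * `|u1 - u2|)
  (A3 : exists2 Cf : R, 0 < Cf & forall u : L2 T, - Cf <= f u)
  (A4 : forall t : R, exists C : R, forall u : BV T,
     f (toL2 T u) + TGV alpha beta u <= t -> BVnorm u <= C)
  (A Aplus : nat -> {fset (R -> R)}) (lam : nat -> (R -> R) -> R)
  (l : nat -> R -> R) (u : nat -> BV T) (xS xK : nat -> R)
  (run : algorithm_run alpha beta f A Aplus lam l u xS xK)
  (no_termination : forall k, (1 <= k)%N -> ~ stopping alpha beta f (u k)) :
  (exists ubar : BV T, cluster (u @ \oo) ubar) /\
  (forall ubar : BV T, cluster (u @ \oo) ubar ->
     forall v : BV T,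
       L2inner (- gradient f (toL2 T ubar)) (toL2 T v - toL2 T ubar)
       + TGV alpha beta ubar <= TGV alpha beta v).
Proof.
have [Lf Lf_gt0 lip] := A2; have [Cf _ f_lb] := A3.
have [df _] := A1; have L_ge0 := ltW Lf_gt0.
(* The objectives decrease and dominate [J] at the iterates, so all iterates lie in the sublevel set
   of the first objective. *)
have [C HC] := A4 (objective f (Aplus 0) (lam 1) (l 1)).
have [eta eta_neq0] := C0_integral_neq0 T_gt0.
pose U n := u n.+1; pose s n := \sum_(v <- Aplus n) lam n.+1 v.
pose gp n := gap T_gt0 alpha beta f (Aplus n) (lam n.+1) (l n.+1).
have atoms := run_atoms T_gt0 alpha_gt0 beta_gt0 L_ge0 df lip run no_termination.
have /choice[w Hw] : forall n, exists w : BV T,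
    tgv_value alpha beta (U n) w <= s n /\ TGV alpha beta (U n) <= s n.
  move=> n; have dec := run_decomposition T_gt0 alpha_gt0 beta_gt0 L_ge0 df lip run no_termination n.
  have [w ? ?] := tgv_decomposition_TGV T_gt0 alpha_gt0 beta_gt0 dec.
  by exists w.
have jle n : f (toL2 T (U n)) + s n <= objective f (Aplus 0) (lam 1) (l 1).
  rewrite -(run_objectiveE run).
  exact: (run_objective_le T_gt0 alpha_gt0 beta_gt0 L_ge0 df lip run no_termination).
have HB n : dualnorm (BVD (U n)) <= C /\ `|L2inner (toL2 T (U n)) (toL2 T eta)| <= `|eta| * C.
  apply: BVnorm_bound => //; apply: HC; apply: le_trans (jle n).
  by rewrite lerD2l; exact: (Hw n).2.
(* One bound for derivatives, pairings with [eta] and sums of weights; the last is the first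
   objective minus the lower bound [- Cf] of [f]. *)
pose M := Num.max (Num.max C (`|eta| * C)) (objective f (Aplus 0) (lam 1) (l 1) + Cf).
have UD n : dualnorm (BVD (U n)) <= M by rewrite /M !le_max (HB n).1.
have Ueta n : `|L2inner (toL2 T (U n)) (toL2 T eta)| <= M by rewrite /M !le_max (HB n).2 orbT.
have sM n : s n <= M.
  rewrite /M le_max; apply/orP; right; rewrite -lerBlDr; apply: le_trans (jle n).
  by rewrite addrC lerD2r.
have self n : L2inner (gradient f (toL2 T (U n))) (toL2 T (U n)) = - s n.
  by rewrite /U (run_u run); exact: (minimizer_self T_gt0 alpha_gt0 beta_gt0 L_ge0 df lip (@atoms n) (run_minimizer run n)).
have dual n (v : BV T) : - L2inner (gradient f (toL2 T (U n))) (toL2 T v) <= gp n * TGV alpha beta v.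
  rewrite /U (run_u run).
  apply: (gradient_dual alpha_gt0 beta_gt0 L_ge0 df lip (@atoms n) (run_minimizer run n)).
    exact: gap_p.
  exact: gap_q.
have gp1 := run_gap_cvg T_gt0 alpha_gt0 beta_gt0 L_ge0 df lip f_lb run no_termination.
rewrite -eventually_shift; split=> [|ubar].
  have [W [UW ooW]] := ultra_above_oo.
  have [ubar Uubar] := weak_star_compact T_gt0 eta_neq0 UD Ueta UW.
  by exists ubar; apply/cluster_ultraP; exists W.
move=> /cluster_ultraP[W [UW ooW Wubar]] v.
exact: (limit_optimal T_gt0 alpha_gt0 beta_gt0 eta_neq0 lip UD (fun n => (Hw n).1) sM self dual gp1 v UW ooW Wubar).
Qed.
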